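(* Let $s\in(0,1/2)$, let $\mathcal{N}\subset\mathbb{R}^d$ be a compact smooth submanifold without boundary, let $\omega\subset\mathbb{R}$ be a bounded open interval, and let $\{u_n\}\subset\widehat H^s(\omega;\mathcal{N})$ be a sequence of minimizing $s$-harmonic maps in $\omega$ such that $\sup_n\mathcal{E}_s(u_n,\omega)<\infty$ and $u_n\to u$ in $L^2_{\rm loc}(\mathbb{R})$. Then $u_n^{\rm e}\to u^{\rm e}$ strongly in $H^1(\Omega;\mathbb{R}^d,y^ad\mathbf{x})$ for every bounded admissible open set $\Omega\subset\mathbb{R}^2_+$ such that $\overline{\partial^0\Omega}\subset\omega$.
   Context: $\mathcal{E}_s(u,\omega):=\frac{\gamma_s}{2}\iint_{\omega\times\omega}\frac{|u(x)-u(y)|^2}{|x-y|^{1+2s}}dxdy+\gamma_s\iint_{\omega\times(\mathbb{R}\setminus\omega)}\frac{|u(x)-u(y)|^2}{|x-y|^{1+2s}}dxdy$ with $\gamma_s:=s2^{2s}\pi^{-1/2}\Gamma(\frac{1+2s}{2})/\Gamma(1-s)$; $\widehat H^s(\omega;\mathcal{N})$ is the set of $u\in L^2_{\rm loc}(\mathbb{R};\mathbb{R}^d)$ with $\mathcal{E}_s(u,\omega)<\infty$ and $u\in\mathcal{N}$ a.e. on $\mathbb{R}$; $u$ is a minimizing $s$-harmonic map in $\omega$ if $\mathcal{E}_s(u,\omega)\le\mathcal{E}_s(\tilde u,\omega)$ for all $\tilde u\in\widehat H^s(\omega;\mathcal{N})$ with ${\rm spt}(\tilde u-u)\subset\omega$.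 Let $a:=1-2s$, $\mathbb{R}^2_+=\{(x,y):y>0\}$, $\mathbb{R}\simeq\mathbb{R}\times\{0\}$. For $u\in\widehat H^s(\omega;\mathbb{R}^d)$, the extension is $u^{\rm e}(x,y):=\sigma_s\int_{\mathbb{R}}\frac{y^{2s}u(t)}{((x-t)^2+y^2)^{\frac{1+2s}{2}}}dt$, $\sigma_s:=\pi^{-1/2}\Gamma(\frac{1+2s}{2})/\Gamma(s)$; it solves ${\rm div}(y^a\nabla u^{\rm e})=0$ in $\mathbb{R}^2_+$ with $u^{\rm e}=u$ on $\mathbb{R}$. For a bounded open $\Omega\subset\mathbb{R}^2_+$, $\partial^0\Omega:=\{\mathbf{x}\in\partial\Omega\cap\partial\mathbb{R}^2_+: B_r(\mathbf{x})\cap\mathbb{R}^2_+\subset\Omega\text{ for some }r>0\}$, $\partial^+\Omega:=\partial\Omega\cap\mathbb{R}^2_+$; $\Omega$ is admissible if $\partial\Omega$ is Lipschitz, $\partial^0\Omega$ is nonempty with Lipschitz boundary (relative to $\mathbb{R}$), and $\partial\Omega=\partial^+\Omega\cup\overline{\partial^0\Omega}$. $H^1(\Omega;\mathbb{R}^d,y^ad\mathbf{x})$ is the space of $v$ with $\int_\Omega y^a(|v|^2+|\nabla v|^2)d\mathbf{x}<\infty$, with its natural norm. *)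

(* Defs.v *)
From HB Require Import structures.
From mathcomp Require Import all_boot all_order all_algebra.
From mathcomp Require Import all_classical all_reals all_analysis.

Set Implicit Arguments.
Unset Strict Implicit.
Unset Printing Implicit Defensive.

Import Order.TTheory GRing.Theory Num.Theory.
Import numFieldNormedType.Exports.

Local Open Scope classical_set_scope.
Local Open Scope ring_scope.

Section Defs.
Variable R : realType.

Notation leb := (@lebesgue_measure R).

Definition sqn (d : nat) (v : 'rV[R]_d) : R := \sum_(i < d) (v ord0 i) ^+ 2.

Definition Gamma (x : R) : R :=
  fine (\int[leb]_(t in `]0%R, +oo[) ((t `^ (x - 1)) * expR (- t))%:E)%E.

Definition gamma_s (s : R) : R :=
  s * 2 `^ (2 * s) * (Num.sqrt pi)^-1 * Gamma ((1 + 2 * s) / 2) / Gamma (1 - s).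

Definition sigma_s (s : R) : R :=
  (Num.sqrt pi)^-1 * Gamma ((1 + 2 * s) / 2) / Gamma s.

Definition Es_kernel (s : R) (d : nat) (u : R -> 'rV[R]_d) (z : R * R) : \bar R :=
  (sqn (u z.1 - u z.2) / (`|z.1 - z.2| `^ (1 + 2 * s)))%:E.

Definition Es (s : R) (d : nat) (u : R -> 'rV[R]_d) (om : set R) : \bar R :=
  ((gamma_s s / 2)%:E *
     \int[(leb \x leb)%E]_(z in om `*` om) Es_kernel s u z
   + (gamma_s s)%:E *
     \int[(leb \x leb)%E]_(z in om `*` ~` om) Es_kernel s u z)%E.

Definition L2loc (d : nat) (u : R -> 'rV[R]_d) : Prop :=
  (forall i : 'I_d, measurable_fun setT (fun x => u x ord0 i)) /\
  (forall a b : R, (\int[leb]_(x in `[a, b]) (sqn (u x))%:E < +oo)%E).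

Definition L2loc_cvg (d : nat) (u_ : nat -> R -> 'rV[R]_d) (u : R -> 'rV[R]_d) : Prop :=
  forall a b : R,
    ((fun n => \int[leb]_(x in `[a, b]) (sqn (u_ n x - u x))%:E) @ \oo --> 0%E)%E.

Fixpoint iderive (d m : nat) (vs : seq 'rV[R]_d) (F : 'rV[R]_d -> 'rV[R]_m)
  : 'rV[R]_d -> 'rV[R]_m :=
  match vs with
  | [::] => F
  | v :: vs' => fun x => derive (iderive vs' F) x v
  end.

Definition smooth_on (d m : nat) (U : set 'rV[R]_d) (F : 'rV[R]_d -> 'rV[R]_m) : Prop :=
  forall (vs : seq 'rV[R]_d) (x : 'rV[R]_d), U x -> differentiable (iderive vs F) x.

Definition eball (d : nat) (p : 'rV[R]_d) (r : R) : set 'rV[R]_d :=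
  [set q | sqn (q - p) < r ^+ 2].

Definition compact_smooth_submanifold (d : nat) (N : set 'rV[R]_d) : Prop :=
  compact N /\
  exists m : nat, forall p, N p ->
    exists r : R, 0 < r /\
    exists F : 'rV[R]_d -> 'rV[R]_m,
      smooth_on (eball p r) F /\
      (forall x, eball p r x -> forall w : 'rV[R]_m, exists v, derive F x v = w) /\
      (forall x, eball p r x -> (N x <-> F x = 0)).

(** Essential support of f : R -> R^d (complement of the largest open set on
    which f vanishes a.e.). *)
Definition ess_spt (d : nat) (f : R -> 'rV[R]_d) : set R :=
  [set x | forall r : R, 0 < r ->
     ~ (leb.-negligible ([set y | `|y - x| < r] `&` [set y | f y != 0]))].

Definition Hhat (s : R) (d : nat) (om : set R) (N : set 'rV[R]_d) (u : R -> 'rV[R]_d)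
  : Prop :=
  L2loc u /\ (Es s u om < +oo)%E /\ {ae leb, forall x, N (u x)}.

Definition minimizing_sharmonic (s : R) (d : nat) (om : set R) (N : set 'rV[R]_d)
  (u : R -> 'rV[R]_d) : Prop :=
  forall v : R -> 'rV[R]_d, Hhat s om N v -> ess_spt (v - u) `<=` om ->
    (Es s u om <= Es s v om)%E.

Definition ext (s : R) (d : nat) (u : R -> 'rV[R]_d) (p : R * R) : 'rV[R]_d :=
  \row_(i < d) (sigma_s s *
     Rintegral leb setT (fun t : R =>
        p.2 `^ (2 * s) * u t ord0 i / (((p.1 - t) ^+ 2 + p.2 ^+ 2) `^ ((1 + 2 * s) / 2)))).

Definition upper : set (R * R) := [set p | 0 < p.2].

Definition ball2 (p : R * R) (r : R) : set (R * R) :=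
  [set q | (q.1 - p.1) ^+ 2 + (q.2 - p.2) ^+ 2 < r ^+ 2].

Definition bdry {T : topologicalType} (A : set T) : set T :=
  closure A `\` interior A.

Definition bounded2 (O : set (R * R)) : Prop :=
  exists M : R, forall p, O p -> `|p.1| <= M /\ `|p.2| <= M.

Definition rot (th : R) (q : R * R) : R * R :=
  (cos th * q.1 - sin th * q.2, sin th * q.1 + cos th * q.2).

(** Lipschitz boundary of an open set of R^2: locally (after a rigid motion)
    the set is the strict epigraph of a Lipschitz function. *)
Definition lipschitz_boundary2 (O : set (R * R)) : Prop :=
  forall p, bdry O p ->
    exists r : R, 0 < r /\ exists th : R, exists g : R -> R,
      (exists L : R, forall x y, `|g x - g y| <= L * `|x - y|) /\
      (forall q, ball2 p r q ->
         (O q <-> g (rot th (q.1 - p.1, q.2 - p.2)).1 <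
                  (rot th (q.1 - p.1, q.2 - p.2)).2)).

Definition lipschitz_boundary1 (A : set R) : Prop :=
  forall p, bdry A p ->
    exists r : R, 0 < r /\
      ((forall x, `|x - p| < r -> (A x <-> x < p)) \/
       (forall x, `|x - p| < r -> (A x <-> p < x))).

Definition bdry0 (O : set (R * R)) : set R :=
  [set x | bdry O (x, 0) /\ exists r : R, 0 < r /\ ball2 (x, 0) r `&` upper `<=` O].

Definition bdryplus (O : set (R * R)) : set (R * R) := bdry O `&` upper.

Definition admissible (O : set (R * R)) : Prop :=
  lipschitz_boundary2 O /\
  bdry0 O !=set0 /\ lipschitz_boundary1 (bdry0 O) /\
  bdry O = bdryplus O `|` [set (x, 0) | x in closure (bdry0 O)].

Definition dx (d : nat) (v : R * R -> 'rV[R]_d) (p : R * R) : 'rV[R]_d :=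
  derive1 (fun x => v (x, p.2)) p.1.
Definition dy (d : nat) (v : R * R -> 'rV[R]_d) (p : R * R) : 'rV[R]_d :=
  derive1 (fun y => v (p.1, y)) p.2.

Definition H1a_sqnorm (a : R) (d : nat) (O : set (R * R)) (v : R * R -> 'rV[R]_d)
  : \bar R :=
  (\int[(leb \x leb)%E]_(p in O)
     (p.2 `^ a * (sqn (v p) + sqn (dx v p) + sqn (dy v p)))%:E)%E.

End Defs.

(* Main.v *)
(* Since [s < 1/2], the kernel [|x - y|^(-1-2s)] is integrable on [I x (R \ I)] for an
   interval [I], so the map equal to the limit [u] on [I] and to [u_n] outside is an
   admissible competitor for [u_n]. Comparing energies, all interactions between [I]
   and its complement converge by dominated convergence (the maps are bounded, with
   values in [N]), and the energy of [u_n] on [I x I] is asymptotically at most that of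
   [u]. Fatou's lemma then makes [w_n = u_n - u] small in energy on [I x R].

   For bounded [w], the weighted gradient energy of the extension above [I] is at most a
   constant times the energy of [w] on [I x R], and away from the real line everything
   converges by dominated convergence. An admissible [O] is close to the real line only
   above a compact part of the interval, so the two regions cover it.

   Pointwise convergence holds along subsequences and almost everywhere only; the limit
   being always the same, this suffices. *)

Require Import Defs.
From HB Require Import structures.
From mathcomp Require Import all_boot all_order all_algebra.
From mathcomp Require Import all_classical all_reals all_analysis measurable_realfun.
From mathcomp Require Import ring lra.

Import Order.TTheory GRing.Theory Num.Theory.
Import numFieldNormedType.Exports.

Local Open Scope classical_set_scope.
Local Open Scope ring_scope.

(** * Integrals of powers *)

Section PowerIntegrals.
Variable R : realType.
Notation leb := (@lebesgue_measure R).
Implicit Types (f F : R -> R) (x y p q : R).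

(** The constraint shapes the competitor: interpolating between [u_n] and [u] near the ends of [I]
    would leave [N], while a sharp switch keeps the values in [N] at the price of a jump. The
    interval [I] is the given one shortened by a margin [e] at both ends. The same [e] serves twice:
    it keeps the support of the modification inside the interval, and the domain lies over [I] below
    height [e].

    The passage to the extension has to be local as well. Both derivatives of the kernel have zero
    mean, so the gradient at (x, y) depends only on the differences u(x) - u(t), with t anywhere on
    the line. Squaring with a suitable weight and integrating over the height gives back the kernel
    |x - t|^(-1-2s), with x in [I] and t arbitrary. This is why the energy on I x R is the quantity
    to control, and why the localisation takes place at the point x alone.

    Bounds and limits are stated at every point; maps are adjusted to this by giving them the value
    0 on a single null set. *)

Lemma ge0_FTC_bound f F (M : R) (A B : nat -> R) :
  (forall n, A n < B n) ->
  {homo A : n m / (n <= m)%N >-> m <= n} ->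
  {homo B : n m / (n <= m)%N >-> n <= m} ->
  (forall x, (\bigcup_n `[A n, B n]%classic) x ->
     [/\ 0 <= f x, {for x, continuous f}, is_derive x 1 F (f x)
       & 0 <= F x <= M]) ->
  (\int[leb]_(x in \bigcup_n `[A n, B n]%classic) (f x)%:E <= M%:E)%E.
Proof.
move=> AB Adec Binc H.
have inD n x : x \in `[A n, B n] -> (\bigcup_n `[A n, B n]%classic) x.
  by move=> xn; exists n.
have cf n : {within `[A n, B n], continuous f}.
  apply: continuous_in_subspaceT => x; rewrite inE => xn.
  by have [] := H _ (inD n _ xn).
have cvgI : (\int[leb]_(x in `[A n, B n]) (f x)%:E @[n --> \oo] -->
    \int[leb]_(x in \bigcup_n `[A n, B n]%classic) (f x)%:E)%E.
  apply: ge0_nondecreasing_set_cvg_integral.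
  - apply/nondecreasing_seqP => n; rewrite subsetEset => x /=.
    rewrite !in_itv/= => /andP[h1 h2].
    by rewrite (le_trans (Adec _ _ (leqnSn n)))//= (le_trans h2)// Binc.
  - by move=> n; exact: measurable_itv.
  - move=> n; apply/measurable_EFinP.
    by apply: subspace_continuous_measurable_fun; [exact: measurable_itv|exact: cf].
  - by move=> n x xn; rewrite lee_fin; have [] := H _ (inD n _ xn).
rewrite -(cvg_lim _ cvgI)//; apply: lime_le.
  by apply/cvg_ex; eexists; exact: cvgI.
(* On [[A n, B n]] the integral is [F (B n) - F (A n)], at most [M] because [F] stays between 0 and
   [M]. The behaviour of [F] at the ends of the union never enters. *)
apply: nearW => n.
have dF x : x \in `[A n, B n] -> derivable F x 1.
  by move=> xn; have [_ _ /@ex_derive] := H _ (inD n _ xn).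
rewrite (@continuous_FTC2 _ f F)//.
- have hB : B n \in `[A n, B n] by rewrite in_itv/= lexx ltW.
  have hA : A n \in `[A n, B n] by rewrite in_itv/= lexx ltW.
  have /andP[_ FB] : 0 <= F (B n) <= M by have [] := H _ (inD n _ hB).
  have /andP[FA _] : 0 <= F (A n) <= M by have [] := H _ (inD n _ hA).
  by rewrite -EFinB lee_fin; lra.
- have cF : {within `[A n, B n], continuous F}.
    by apply: derivable_within_continuous => x; exact: dF.
  have [_ cA cB] := (continuous_within_itvP F (AB n)).1 cF.
  split => //= x xn; apply: dF; exact: subset_itv_oo_cc.
- move=> x xn; rewrite derive1E.
  have [_ _ d _] := H _ (inD n _ (subset_itv_oo_cc xn)).
  exact: derive_val.
Qed.

Lemma inv_nat_le (n m : nat) : (n <= m)%N -> (m.+3%:R : R)^-1 <= (n.+3%:R)^-1.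
Proof. by move=> nm; rewrite lef_pV2 ?posrE ?ltr0n// ler_nat !ltnS. Qed.

Lemma inv_nat_lt_eps (e : R) : 0 < e -> exists n : nat, (n.+3%:R)^-1 < e.
Proof.
move=> e0; exists (Num.trunc e^-1).
rewrite -[ltRHS]invrK ltf_pV2 ?posrE ?invr_gt0 ?ltr0n//.
have h : e^-1 < (Num.trunc e^-1).+1%:R by rewrite truncnS_gt.
by apply: (lt_le_trans h); rewrite ler_nat ltnW.
Qed.

Lemma ge0_FTC_bound_oo f F (M l r : R) : l < r ->
  (forall x, l < x < r ->
     [/\ 0 <= f x, {for x, continuous f}, is_derive x 1 F (f x)
       & 0 <= F x <= M]) ->
  (\int[leb]_(x in `]l, r[) (f x)%:E <= M%:E)%E.
Proof.
move=> lr H.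
(* A denominator of at least 3 removes less than half of the length at each end, so [A n < B n]
   already for [n = 0]. *)
pose A n : R := l + (r - l) / n.+3%:R; pose B n : R := r - (r - l) / n.+3%:R.
have rl : 0 < r - l by rewrite subr_gt0.
have p3 n : (r - l) / n.+3%:R <= (r - l) / 3.
  by rewrite ler_pM2l// (@inv_nat_le 0).
have p0 n : 0 < (r - l) / n.+3%:R by rewrite divr_gt0// ltr0n.
have -> : `]l, r[%classic = \bigcup_n `[A n, B n]%classic.
  apply/seteqP; split => x /=; rewrite in_itv/=.
    move=> /andP[lx xr].
    pose e := Num.min (x - l) (r - x) / (r - l).
    have e0 : 0 < e by rewrite divr_gt0// lt_min !subr_gt0 lx.
    have [n] := inv_nat_lt_eps _ e0.
    rewrite /e ltr_pdivlMr// mulrC lt_min => /andP[h1 h2].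
    exists n => //=; rewrite in_itv/= /A /B; move: h1 h2.
    by set c := (r - l) / _ => h1 h2; apply/andP; split; lra.
  move=> [n _]/=; rewrite in_itv/= /A /B; have := p0 n.
  by set c := (r - l) / _ => c0 /andP[h1 h2]; apply/andP; split; lra.
apply: (@ge0_FTC_bound f F).
- by move=> n; rewrite /A /B; have := p3 n; set c := (r - l) / _; lra.
- by move=> n m nm; rewrite /A lerD2l ler_pM2l// inv_nat_le.
- by move=> n m nm; rewrite /B lerD2l lerN2 ler_pM2l// inv_nat_le.
- move=> x [n _]/=; rewrite in_itv/= /A /B; have := p0 n.
  set c := (r - l) / _ => c0 /andP[h1 h2]; apply: H.
  by apply/andP; split; lra.
Qed.

Lemma ge0_FTC_bound_oy f F (M l : R) :
  (forall x, l < x ->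
     [/\ 0 <= f x, {for x, continuous f}, is_derive x 1 F (f x)
       & 0 <= F x <= M]) ->
  (\int[leb]_(x in `]l, +oo[) (f x)%:E <= M%:E)%E.
Proof.
move=> H.
pose A n : R := l + (n.+3%:R)^-1; pose B n : R := l + 1 + n%:R.
have p0 n : 0 < (n.+3%:R : R)^-1 by rewrite invr_gt0 ltr0n.
have -> : `]l, +oo[%classic = \bigcup_n `[A n, B n]%classic.
  apply/seteqP; split => x /=; rewrite in_itv/= andbT.
    move=> lx.
    have [|n] := inv_nat_lt_eps (x - l); first by rewrite subr_gt0.
    move=> h1; exists (maxn n (Num.trunc (x - l)).+1) => //=.
    have h2 : (x - l) < (Num.trunc (x - l)).+1%:R by rewrite truncnS_gt.
    have := inv_nat_le _ _ (leq_maxl n (Num.trunc (x - l)).+1).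
    have : (Num.trunc (x - l)).+1%:R <= (maxn n (Num.trunc (x - l)).+1)%:R :> R.
      by rewrite ler_nat leq_maxr.
    rewrite in_itv/= /A /B; move: h1; set c := _^-1; set e := _%:R; set g := _^-1.
    by move=> h1 h3 h4; apply/andP; split; lra.
  move=> [n _]/=; rewrite in_itv/= /A /B; have := p0 n.
  by set c := _^-1 => c0 /andP[h1 h2]; lra.
apply: (@ge0_FTC_bound f F).
- move=> n; rewrite /A /B.
  have : (n.+3%:R : R)^-1 < 1 by rewrite invf_lt1 ?ltr0n// ltr1n.
  by have : 0 <= n%:R :> R by []; set c := _^-1; lra.
- by move=> n m nm; rewrite /A lerD2l inv_nat_le.
- by move=> n m nm; rewrite /B lerD2l ler_nat.
- move=> x [n _]/=; rewrite in_itv/= /A /B; have := p0 n.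
  by set c := _^-1 => c0 /andP[h1 h2]; apply: H; lra.
Qed.

Lemma ge0_FTC_bound_Nyo f F (M r : R) :
  (forall x, x < r ->
     [/\ 0 <= f x, {for x, continuous f}, is_derive x 1 F (f x)
       & 0 <= F x <= M]) ->
  (\int[leb]_(x in `]-oo, r[) (f x)%:E <= M%:E)%E.
Proof.
move=> H.
pose B n : R := r - (n.+3%:R)^-1; pose A n : R := r - 1 - n%:R.
have p0 n : 0 < (n.+3%:R : R)^-1 by rewrite invr_gt0 ltr0n.
have -> : `]-oo, r[%classic = \bigcup_n `[A n, B n]%classic.
  apply/seteqP; split => x /=; rewrite in_itv/=.
    move=> xr.
    have [|n] := inv_nat_lt_eps (r - x); first by rewrite subr_gt0.
    move=> h1; exists (maxn n (Num.trunc (r - x)).+1) => //=.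
    have h2 : (r - x) < (Num.trunc (r - x)).+1%:R by rewrite truncnS_gt.
    have := inv_nat_le _ _ (leq_maxl n (Num.trunc (r - x)).+1).
    have : (Num.trunc (r - x)).+1%:R <= (maxn n (Num.trunc (r - x)).+1)%:R :> R.
      by rewrite ler_nat leq_maxr.
    rewrite in_itv/= /A /B; move: h1; set c := _^-1; set e := _%:R; set g := _^-1.
    by move=> h1 h3 h4; apply/andP; split; lra.
  move=> [n _]/=; rewrite in_itv/= /A /B; have := p0 n.
  by set c := _^-1 => c0 /andP[h1 h2]; lra.
apply: (@ge0_FTC_bound f F).
- move=> n; rewrite /A /B.
  have : (n.+3%:R : R)^-1 < 1 by rewrite invf_lt1 ?ltr0n// ltr1n.
  by have : 0 <= n%:R :> R by []; set c := _^-1; lra.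
- by move=> n m nm; rewrite /A lerD2l lerN2 ler_nat.
- by move=> n m nm; rewrite /B lerD2l lerN2 inv_nat_le.
- move=> x [n _]/=; rewrite in_itv/= /A /B; have := p0 n.
  by set c := _^-1 => c0 /andP[h1 h2]; apply: H; lra.
Qed.

End PowerIntegrals.

Section PowerIntegrals2.
Set Implicit Arguments.
Unset Strict Implicit.
Variable R : realType.
Notation leb := (@lebesgue_measure R).
Implicit Types (f F : R -> R) (x y p q : R).

Lemma is_derive_powR_comp (g : R -> R) (g' y q : R) : 0 < g y ->
  is_derive y 1 g g' ->
  is_derive y 1 (fun z => g z `^ q) (q * g y `^ (q - 1) * g').
Proof.
move=> gy dg.
have := @is_derive1_comp R (fun z => z `^ q) g y _ _ (is_derive1_powR q gy) dg.
by [].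
Qed.

Lemma is_derive_continuous (g : R -> R) (g' y : R) :
  is_derive y 1 g g' -> {for y, continuous g}.
Proof.
by move=> [dg _]; exact/differentiable_continuous/derivable1_diffP.
Qed.

Lemma measurable_EFin_mulr_expR_powR x : measurable_fun setT
  (fun t : R => ((t `^ (x - 1)) * expR (- t))%:E).
Proof.
apply/measurable_EFinP; apply: measurable_funM.
  exact: measurable_powR.
by apply: (measurableT_comp (@measurable_expR R)); exact: oppr_measurable.
Qed.

Lemma sqr_le_expR (t : R) : 0 <= t -> (2 + t) ^+ 2 <= 4 * expR t.
Proof.
move=> t0; have -> : expR t = expR (t / 2) ^+ 2 by rewrite -expRM_natl; congr expR; field.
have h : 1 + t / 2 <= expR (t / 2) by exact: expR_ge1Dx.
have -> : (2 + t) ^+ 2 = 4 * (1 + t / 2) ^+ 2 by field.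
by rewrite ler_pM2l// ler_sqr ?nnegrE ?expR_ge0//; lra.
Qed.

Lemma powR_le_add1 (t x : R) : 0 <= t -> 0 < x < 1 -> t `^ x <= 1 + t.
Proof.
move=> t0 /andP[x0 x1].
have [t1|t1] := leP t 1.
  have : t `^ x <= 1 `^ x by apply: ge0_ler_powR; rewrite ?nnegrE// ltW.
  by rewrite powR1; lra.
have : t `^ x <= t by apply: ler1_powR; rewrite ltW.
lra.
Qed.

Lemma Gamma_integral_lty x : 0 < x < 1 ->
  (\int[leb]_(t in `]0%R, +oo[) ((t `^ (x - 1)) * expR (- t))%:E < +oo)%E.
Proof.
move=> x01; have /andP[x0 x1] := x01.
(* The integrand is at most [4 / x] times the derivative of the bounded function [F]. *)
pose F t : R := t `^ x / (1 + t `^ x).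
pose f t : R := (x * t `^ (x - 1)) * (1 + t `^ x) ^- 2.
have dF (t : R) : 0 < t -> is_derive t 1 F (f t).
  move=> t0.
  have d1 := is_derive1_powR x t0.
  have p0 := powR_ge0 t x.
  have n0 : 1 + t `^ x != 0 by rewrite gt_eqF//; lra.
  have dV : is_derive t 1 (fun z : R => (1 + z `^ x)^-1)
      (- (1 + t `^ x) ^- 2 *: (0 + x * t `^ (x - 1))).
    by apply: is_deriveV.
  have := is_deriveM d1 dV.
  rewrite /F /f => H; apply: (is_derive_eq H).
  rewrite /GRing.scale/=; field.
  by rewrite n0.
have cf (t : R) : 0 < t -> {for t, continuous f}.
  move=> t0; apply: cvgM.
    apply: cvgM; first exact: cvg_cst.
    exact: (is_derive_continuous (is_derive1_powR (x - 1) t0)).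
  apply: cvgV; first by rewrite gt_eqF// exprn_gt0// ltr_wpDr// powR_ge0.
  apply: cvgM; apply: cvgD; try exact: cvg_cst;
    exact: (is_derive_continuous (is_derive1_powR x t0)).
have HF : (\int[leb]_(t in `]0%R, +oo[) (f t)%:E <= 1%:E)%E.
  apply: (@ge0_FTC_bound_oy _ f F) => t t0; split.
  - by rewrite /f mulr_ge0 ?invr_ge0 ?sqr_ge0// mulr_ge0 ?powR_ge0// ltW.
  - exact: cf.
  - exact: dF.
  - have p0 := powR_ge0 t x; rewrite /F divr_ge0 ?ler_pdivrMr//; lra.
have mf : measurable_fun (`]0, +oo[%classic : set R) (fun t : R => (f t)%:E).
  apply/measurable_EFinP; apply: open_continuous_measurable_fun => //.
  by move=> t; rewrite inE/= in_itv/= andbT => t0; exact: cf.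
have f0 t : 0 < t -> 0 <= f t.
  by move=> t0; rewrite /f mulr_ge0 ?invr_ge0 ?sqr_ge0// mulr_ge0 ?powR_ge0// ltW.
apply: (@le_lt_trans _ _ ((4 / x)%:E * \int[leb]_(t in `]0%R, +oo[) (f t)%:E)%E).
  rewrite -ge0_integralZl_EFin//; last 2 first.
  - by move=> t /=; rewrite in_itv/= andbT lee_fin; exact: f0.
  - by rewrite divr_ge0// ltW.
  apply: ge0_le_integral => //.
  - by move=> t _; rewrite lee_fin mulr_ge0 ?powR_ge0 ?expR_ge0.
  - exact: measurable_funTS (measurable_EFin_mulr_expR_powR x).
  - by apply: measurable_funeM.
  - move=> t /=; rewrite in_itv/= andbT => t0.
    rewrite -EFinM lee_fin /f.
    have p0 := powR_ge0 t x.
    have -> : 4 / x * (x * t `^ (x - 1) / (1 + t `^ x) ^+ 2) =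
        t `^ (x - 1) * (4 / (1 + t `^ x) ^+ 2).
      by field; rewrite !gt_eqF//; lra.
    apply: ler_wpM2l; first exact: powR_ge0.
    rewrite expRN ler_pdivlMr ?exprn_gt0//; last by lra.
    rewrite mulrC ler_pdivrMr ?expR_gt0//.
    (* Since t^x <= 1 + t, the squared denominator of [f] is at most (2 + t)^2 <= 4 e^t. This is the
       4 in [4 / x]; the division by [x] cancels the factor [x] of [f]. *)
    apply: le_trans (sqr_le_expR (ltW t0)).
    rewrite ler_sqr ?nnegrE//; try lra.
    by have := powR_le_add1 (ltW t0) x01; lra.
apply: (@le_lt_trans _ _ ((4 / x)%:E * 1%:E)%E); last by rewrite -EFinM ltry.
by apply: lee_wpmul2l => //; rewrite lee_fin divr_ge0 ?ltW.
Qed.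

(** [fine] sends [+oo] to 0, so positivity needs the finiteness just proved as well as a lower
    bound. The latter is taken on [[1, 2]], where both factors of the integrand are smallest at
    2. *)
Lemma Gamma_gt0 x : 0 < x < 1 -> 0 < Gamma x.
Proof.
move=> x01; have /andP[x0 x1] := x01; rewrite /Gamma fine_gt0//.
rewrite Gamma_integral_lty// andbT.
pose c : R := 2 `^ (x - 1) * expR (- 2).
apply: (@lt_le_trans _ _ (\int[leb]_(t in `]1%R, 2%R[) (c%:E))%E).
  rewrite integral_cst//= lebesgue_measure_itv/= lte_fin ifT; last by rewrite ltr1n.
  by rewrite -EFinB -EFinM lte_fin mulr_gt0 ?mulr_gt0 ?powR_gt0 ?expR_gt0//; lra.
apply: (@le_trans _ _ (\int[leb]_(t in `]1%R, 2%R[) ((t `^ (x - 1)) * expR (- t))%:E)%E).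
  apply: ge0_le_integral => //.
  - by move=> t _; rewrite lee_fin mulr_ge0 ?powR_ge0 ?expR_ge0.
  - exact: measurable_funTS (measurable_EFin_mulr_expR_powR x).
  - move=> t /=; rewrite in_itv/= => /andP[t1 t2]; rewrite lee_fin.
    apply: ler_pM; rewrite ?powR_ge0 ?expR_ge0//; last by rewrite ler_expR; lra.
    have -> : x - 1 = - (1 - x) by lra.
    rewrite !powRN lef_pV2 ?posrE ?powR_gt0//; last by lra.
    by apply: ge0_ler_powR; rewrite ?nnegrE; lra.
apply: ge0_subset_integral => //.
- exact: measurable_funTS (measurable_EFin_mulr_expR_powR x).
- by move=> t _; rewrite lee_fin mulr_ge0 ?powR_ge0 ?expR_ge0.
- by move=> t /=; rewrite !in_itv/= => /andP[t1 t2]; rewrite andbT; lra.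
Qed.

Lemma gamma_s_gt0 (s : R) : 0 < s < 1 / 2 -> 0 < gamma_s s.
Proof.
move=> /andP[s0 s1]; rewrite /gamma_s.
rewrite divr_gt0 ?mulr_gt0 ?powR_gt0 ?invr_gt0 ?sqrtr_gt0 ?pi_gt0//.
  by apply: Gamma_gt0; apply/andP; split; lra.
by apply: Gamma_gt0; apply/andP; split; lra.
Qed.

Lemma powR_tail_right (b x q : R) : 0 < q -> x < b ->
  (\int[leb]_(y in `]b, +oo[) ((y - x) `^ (- (1 + q)))%:E
     <= ((b - x) `^ (- q) / q)%:E)%E.
Proof.
move=> q0 xb.
(* The additive constant makes the antiderivative start from 0 at [b], as the FTC bound asks for
   values between 0 and the claimed bound. *)
pose F y : R := ((b - x) `^ (- q) - (y - x) `^ (- q)) / q.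
have D y r : x < y -> is_derive y 1 (fun z => (z - x) `^ r) (r * (y - x) `^ (r - 1)).
  move=> xy; apply: is_derive_eq; first apply: is_derive_powR_comp; first by rewrite subr_gt0.
  by rewrite /GRing.scale/=; ring.
apply: (@ge0_FTC_bound_oy _ _ F) => y yb; have xy : x < y by lra.
split.
- exact: powR_ge0.
- exact: (is_derive_continuous (D y _ xy)).
- rewrite /F; have d := D y (- q) xy.
  have d2 : is_derive y 1 (fun z => ((b - x) `^ (- q) - (z - x) `^ (- q)) * q^-1)
     ((0 - (- q * (y - x) `^ (- q - 1))) * q^-1).
    apply: is_derive_eq; rewrite /GRing.scale/=.
    by field; rewrite gt_eqF.
  apply: (is_derive_eq d2).
  have -> : - (1 + q) = - q - 1 by lra.
  by field; rewrite gt_eqF.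
- have h : (y - x) `^ (- q) <= (b - x) `^ (- q).
    rewrite !powRN lef_pV2 ?posrE ?powR_gt0 ?subr_gt0//.
    by apply: ge0_ler_powR; rewrite ?nnegrE; lra.
  have := powR_ge0 (y - x) (- q) => h2.
  rewrite /F divr_ge0 ?subr_ge0//=; last by lra.
  by rewrite ler_pM2r ?invr_gt0//; lra.
Qed.

Lemma powR_tail_left (a x q : R) : 0 < q -> a < x ->
  (\int[leb]_(y in `]-oo, a[) ((x - y) `^ (- (1 + q)))%:E
     <= ((x - a) `^ (- q) / q)%:E)%E.
Proof.
move=> q0 xb.
pose F y : R := ((x - y) `^ (- q)) / q.
have D y r : y < x -> is_derive y 1 (fun z => (x - z) `^ r) (- (r * (x - y) `^ (r - 1))).
  move=> xy; apply: is_derive_eq; first apply: is_derive_powR_comp; first by rewrite subr_gt0.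
  by rewrite /GRing.scale/=; ring.
apply: (@ge0_FTC_bound_Nyo _ _ F) => y yb; have xy : y < x by lra.
split.
- exact: powR_ge0.
- exact: (is_derive_continuous (D y _ xy)).
- rewrite /F; have d := D y (- q) xy.
  have d2 : is_derive y 1 (fun z => ((x - z) `^ (- q)) * q^-1)
     ((- (- q * (x - y) `^ (- q - 1))) * q^-1).
    apply: is_derive_eq; rewrite /GRing.scale/=.
    by field; rewrite gt_eqF.
  apply: (is_derive_eq d2).
  have -> : - (1 + q) = - q - 1 by lra.
  by field; rewrite gt_eqF.
- have h : (x - y) `^ (- q) <= (x - a) `^ (- q).
    rewrite !powRN lef_pV2 ?posrE ?powR_gt0 ?subr_gt0//.
    by apply: ge0_ler_powR; rewrite ?nnegrE; lra.
  have := powR_ge0 (x - y) (- q) => h2.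
  rewrite /F divr_ge0//=; last by lra.
  by rewrite ler_pM2r ?invr_gt0//; lra.
Qed.

Lemma powR_sing_right (a b q : R) : 0 < q < 1 -> a < b ->
  (\int[leb]_(x in `]a, b[) ((b - x) `^ (- q))%:E
     <= ((b - a) `^ (1 - q) / (1 - q))%:E)%E.
Proof.
move=> /andP[q0 q1] ab.
pose F y : R := ((b - a) `^ (1 - q) - (b - y) `^ (1 - q)) / (1 - q).
have D y r : y < b -> is_derive y 1 (fun z => (b - z) `^ r) (- (r * (b - y) `^ (r - 1))).
  move=> xy; apply: is_derive_eq; first apply: is_derive_powR_comp; first by rewrite subr_gt0.
  by rewrite /GRing.scale/=; ring.
apply: (@ge0_FTC_bound_oo _ _ F) => // y /andP[ay yb].
split.
- exact: powR_ge0.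
- exact: (is_derive_continuous (D y _ yb)).
- rewrite /F; have d := D y (1 - q) yb.
  have d2 : is_derive y 1 (fun z => ((b - a) `^ (1 - q) - (b - z) `^ (1 - q)) * (1 - q)^-1)
     ((0 - - ((1 - q) * (b - y) `^ (1 - q - 1))) * (1 - q)^-1).
    apply: is_derive_eq; rewrite /GRing.scale/=.
    by field; rewrite gt_eqF// subr_gt0.
  apply: (is_derive_eq d2).
  have -> : 1 - q - 1 = - q by lra.
  by field; rewrite gt_eqF// subr_gt0.
- have h : (b - y) `^ (1 - q) <= (b - a) `^ (1 - q).
    by apply: ge0_ler_powR; rewrite ?nnegrE; lra.
  have := powR_ge0 (b - y) (1 - q) => h2.
  rewrite /F divr_ge0 ?subr_ge0//=; last by lra.
  by rewrite ler_pM2r ?invr_gt0 ?subr_gt0//; lra.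
Qed.

Lemma powR_sing_left (a b q : R) : 0 < q < 1 -> a < b ->
  (\int[leb]_(x in `]a, b[) ((x - a) `^ (- q))%:E
     <= ((b - a) `^ (1 - q) / (1 - q))%:E)%E.
Proof.
move=> /andP[q0 q1] ab.
pose F y : R := ((y - a) `^ (1 - q)) / (1 - q).
have D y r : a < y -> is_derive y 1 (fun z => (z - a) `^ r) (r * (y - a) `^ (r - 1)).
  move=> xy; apply: is_derive_eq; first apply: is_derive_powR_comp; first by rewrite subr_gt0.
  by rewrite /GRing.scale/=; ring.
apply: (@ge0_FTC_bound_oo _ _ F) => // y /andP[ay yb].
split.
- exact: powR_ge0.
- exact: (is_derive_continuous (D y _ ay)).
- rewrite /F; have d := D y (1 - q) ay.
  have d2 : is_derive y 1 (fun z => ((z - a) `^ (1 - q)) * (1 - q)^-1)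
     ((((1 - q) * (y - a) `^ (1 - q - 1))) * (1 - q)^-1).
    apply: is_derive_eq; rewrite /GRing.scale/=.
    by field; rewrite gt_eqF// subr_gt0.
  apply: (is_derive_eq d2).
  have -> : 1 - q - 1 = - q by lra.
  by field; rewrite gt_eqF// subr_gt0.
- have h : (y - a) `^ (1 - q) <= (b - a) `^ (1 - q).
    by apply: ge0_ler_powR; rewrite ?nnegrE; lra.
  have := powR_ge0 (y - a) (1 - q) => h2.
  rewrite /F divr_ge0//=; last by lra.
  by rewrite ler_pM2r ?invr_gt0 ?subr_gt0//; lra.
Qed.

End PowerIntegrals2.

(** * Radial integrals and the interaction of an interval with its complement *)

Section RadialIntegrals.
Set Implicit Arguments.
Unset Strict Implicit.
Variable R : realType.
Notation leb := (@lebesgue_measure R).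

Lemma ge0_integral_setX d1 d2 (T1 : measurableType d1) (T2 : measurableType d2)
    (m1 : {sigma_finite_measure set T1 -> \bar R})
    (m2 : {sigma_finite_measure set T2 -> \bar R})
    (A : set T1) (B : set T2) (f : T1 * T2 -> \bar R) :
  measurable A -> measurable B -> measurable_fun setT f ->
  (forall z, (0 <= f z)%E) ->
  (\int[(m1 \x m2)%E]_(z in A `*` B) f z =
   \int[m1]_(x in A) \int[m2]_(y in B) f (x, y))%E.
Proof.
move=> mA mB mf f0.
rewrite integral_mkcond fubini_tonelli1; last 2 first.
- by apply/(measurable_restrictT _ (measurableX mA mB)); exact: measurable_funTS.
- by move=> z; apply: erestrict_ge0.
rewrite [RHS]integral_mkcond; apply: eq_integral => x _.
rewrite /fubini_F patchE; case: ifPn => xA.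
  rewrite [RHS]integral_mkcond; apply: eq_integral => y _.
  by rewrite !patchE in_setX/= xA.
by rewrite integral0_eq// => y _; rewrite patchE in_setX/= (negbTE xA).
Qed.

Lemma powR_sqr (a q : R) : 0 <= a -> (a ^+ 2) `^ q = a `^ (2 * q).
Proof. by move=> a0; rewrite powRrM powR_mulrn. Qed.

Lemma powR_invN (a q : R) : 0 <= a -> a^-1 `^ (- q) = a `^ q.
Proof. by move=> a0; rewrite -powR_inv1// -powRrM mulN1r opprK. Qed.

Lemma le_powRN (a b q : R) : 0 < a -> a <= b -> 0 <= q -> b `^ (- q) <= a `^ (- q).
Proof.
move=> a0 ab q0; rewrite !powRN lef_pV2 ?posrE ?powR_gt0//; last exact: lt_le_trans ab.
by apply: ge0_ler_powR; rewrite ?nnegrE// ltW// (lt_le_trans a0).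
Qed.

Lemma measurable_powR_comp d (T : measurableType d) (D : set T) (f : T -> R) q :
  measurable_fun D f -> measurable_fun D (fun x => f x `^ q).
Proof. by move=> mf; exact: measurableT_comp (@measurable_powR R q) mf. Qed.

Lemma setC_itvoo (a b : R) : a < b ->
  ~` `]a, b[%classic = `]-oo, a]%classic `|` `[b, +oo[%classic.
Proof.
move=> ab; apply/seteqP; split => y /=; rewrite !in_itv/= andbT.
  have [ya|ay] := leP y a; first by move=> _; left.
  by move=> /= yb; right; rewrite leNgt; apply/negP.
by case=> h /andP[h1 h2]; lra.
Qed.

Lemma measurable_integral_param d1 d2 (T1 : measurableType d1) (T2 : measurableType d2)
    (m2 : {sigma_finite_measure set T2 -> \bar R}) (B : set T2) (f : T1 * T2 -> \bar R) :
  measurable B -> measurable_fun setT f -> (forall z, (0 <= f z)%E) ->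
  measurable_fun setT (fun x => \int[m2]_(y in B) f (x, y))%E.
Proof.
move=> mB mf f0.
rewrite (_ : (fun x => _) = fubini_F m2 (f \_ (setT `*` B))); last first.
  apply/funext => x; rewrite /fubini_F [LHS]integral_mkcond; apply: eq_integral => y _.
  by rewrite !patchE in_setX in_setT.
apply: measurable_fun_fubini_tonelli_F; last by move=> z; apply: erestrict_ge0.
by apply/(measurable_restrictT _ (measurableX measurableT mB)); exact: measurable_funTS.
Qed.

(** A Beta integral: for q > 1/2 it equals sqrt(pi) Gamma(q - 1/2) / Gamma(q). At q = 1/2 + s this
    is the reciprocal of [sigma_s s]. *)
Definition radial_mass (q : R) : \bar R :=
  (\int[leb]_z ((z ^+ 2 + 1) `^ (- q))%:E)%E.

Lemma continuous_bracket (q : R) :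
  continuous (fun t : R => (t ^+ 2 + 1) `^ (- q)).
Proof.
move=> t; have h : 0 < t ^+ 2 + 1 by rewrite ltr_wpDl ?sqr_ge0.
have d : is_derive t 1 (fun t : R => t ^+ 2 + 1) (2 * t).
  by apply: is_derive_eq; rewrite /GRing.scale/=; ring.
have : {for t, continuous (fun t : R => (t ^+ 2 + 1) `^ (- q))}.
  exact: (is_derive_continuous (@is_derive_powR_comp _ (fun t : R => t ^+ 2 + 1) _ _ (- q) h d)).
by [].
Qed.

Lemma radial_mass_lty q : 1 / 2 < q -> (radial_mass q < +oo)%E.
Proof.
move=> q2; rewrite /radial_mass ge0_symfun_integralT//; last 3 first.
- by move=> x; exact: powR_ge0.
- exact: continuous_bracket.
- by move=> x /=; rewrite sqrrN.
rewrite (_ : [set x | _] = `[0, +oo[%classic); last first.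
  by apply/seteqP; split => x/=; rewrite in_itv/= andbT.
have mb : measurable_fun setT (fun z : R => ((z ^+ 2 + 1) `^ (- q))%:E).
  by apply/measurable_EFinP; apply: continuous_measurable_fun; exact: continuous_bracket.
rewrite -integral_itv_obnd_cbnd; last exact: measurable_funTS mb.
have mt : measurable_fun setT (fun z : R => ((z - (-1)) `^ (- (1 + (2 * q - 1))))%:E).
  apply/measurable_EFinP.
  apply: measurable_powR_comp.
  by apply: measurable_funB.
(* The inequality (x + 1)^2 <= 2 (x^2 + 1) bounds the integrand by 2^q (x + 1)^(-2q), a power tail
   seen from the point -1. The outer factor 2 comes from the symmetry of the integrand. *)
apply: (@le_lt_trans _ _ (2%:E * ((2 `^ q)%:E *
    \int[leb]_(y in `]0%R, +oo[) ((y - (-1)) `^ (- (1 + (2 * q - 1))))%:E))%E).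
  apply: lee_wpmul2l => //.
  rewrite -ge0_integralZl_EFin ?powR_ge0//; last 2 first.
  - by move=> x _; rewrite lee_fin powR_ge0.
  - exact: measurable_funTS mt.
  apply: ge0_le_integral => //.
  - by move=> x _; rewrite lee_fin powR_ge0.
  - exact: measurable_funTS mb.
  - by apply: measurable_funeM; exact: measurable_funTS mt.
  - move=> x /=; rewrite in_itv/= andbT => x0; rewrite -EFinM lee_fin.
    have -> : 2 `^ q * (x - (-1)) `^ (- (1 + (2 * q - 1))) =
        ((x + 1) ^+ 2 / 2) `^ (- q).
      rewrite powRM ?sqr_ge0// powR_sqr; last by lra.
      rewrite powR_invN// mulrC opprK.
      by congr (_ `^ _ * _); lra.
    apply: le_powRN; last by lra.
      by rewrite divr_gt0// exprn_gt0//; lra.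
    rewrite ler_pdivrMr//; have := sqr_ge0 (x - 1).
    by rewrite !expr2; lra.
have := @powR_tail_right R 0 (-1) (2 * q - 1) _ _ => H.
rewrite muleA -EFinM lte_mul_pinfty//.
apply: (le_lt_trans (H _ _)); rewrite ?ltry//; lra.
Qed.

Lemma radial_integral (x y q : R) : 0 < y ->
  (\int[leb]_t (((x - t) ^+ 2 + y ^+ 2) `^ (- q))%:E =
   (y `^ (1 - 2 * q))%:E * radial_mass q)%E.
Proof.
move=> y0; rewrite /radial_mass.
pose F t : R := (t - x) / y.
have dF (t : R) : is_derive t 1 F y^-1.
  rewrite /F; have d : is_derive t 1 (fun t => (t - x) * y^-1) y^-1.
    by apply: is_derive_eq; rewrite /GRing.scale/=; ring.
  exact: d.
have dFE : F^`()%classic = cst y^-1.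
  by apply/funext => t; rewrite derive1E; exact: derive_val.
rewrite [in RHS](@increasing_ge0_integration_by_substitutionT _ F) ?dFE//.
- rewrite -ge0_integralZl_EFin ?powR_ge0//; last 2 first.
  + by move=> t _; rewrite lee_fin mulr_ge0 ?powR_ge0// invr_ge0 ltW.
  + apply/measurable_EFinP; apply: measurable_funM; last exact: measurable_cst.
    apply: measurable_powR_comp; apply: measurable_funD => //.
    by apply: measurable_funX; apply: measurable_funM => //; apply: measurable_funB.
  apply: eq_integral => t _; rewrite -EFinM; congr EFin; rewrite /F !fctE /comp /=.
  have -> : (x - t) ^+ 2 + y ^+ 2 = y ^+ 2 * (((t - x) / y) ^+ 2 + 1).
    by field; rewrite gt_eqF.
  rewrite powRM ?sqr_ge0 ?addr_ge0 ?sqr_ge0// powR_sqr ?ltW//.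
  rewrite powRD ?(gt_eqF y0) ?implybT// powRr1 ?ltW//.
  have -> : 2 * - q = - (2 * q) by ring.
  by field; rewrite gt_eqF.
- by move=> u v uv; rewrite /F ltr_pM2r ?invr_gt0// ltrD2r.
- by move=> ?; exact: cvg_cst.
- exact: is_cvg_cst.
- exact: is_cvg_cst.
- apply/cvgrNyPle => A; near=> t; rewrite /F ler_pdivrMr// lerBlDr.
  by near: t; apply: nbhs_ninfty_le; exact: num_real.
- apply/cvgryPge => A; near=> t; rewrite /F ler_pdivlMr// lerBrDr.
  by near: t; apply: nbhs_pinfty_ge; exact: num_real.
- exact: continuous_bracket.
- by move=> z; exact: powR_ge0.
Unshelve. all: by end_near.
Qed.

(* The integrand is dominated by a multiple of the derivative of
   [y |-> (y / (tau + y)) `^ s], which takes values in [0, 1]. *)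
Lemma vertical_integral (s tau : R) : 0 < s -> 0 < tau ->
  (\int[leb]_(y in `]0%R, +oo[)
     (y `^ (s - 1) * (tau ^+ 2 + y ^+ 2) `^ (- ((1 + 3 * s) / 2)))%:E
   <= (2 `^ ((1 + 3 * s) / 2) / s * tau `^ (- (1 + 2 * s)))%:E)%E.
Proof.
move=> s0 t0.
pose F y : R := (y / (tau + y)) `^ s.
pose f y : R := s * (y / (tau + y)) `^ (s - 1) * (tau * (tau + y) ^- 2).
have dG (y : R) : 0 < y -> is_derive y 1 (fun y => y * (tau + y)^-1) (tau * (tau + y) ^- 2).
  move=> y0; have n0 : tau + y != 0 by rewrite gt_eqF// addr_gt0.
  have dV : is_derive y 1 (fun z : R => (tau + z)^-1) (- (tau + y) ^- 2 *: (0 + 1)).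
    by apply: is_deriveV.
  have H := is_deriveM (is_derive_id y 1) dV.
  apply: (is_derive_eq H); rewrite /GRing.scale/=; field.
  by rewrite n0.
have G0 (y : R) : 0 < y -> 0 < y / (tau + y) by move=> y0; rewrite divr_gt0// addr_gt0.
have dF (y : R) : 0 < y -> is_derive y 1 F (f y).
  move=> y0.
  exact: (@is_derive_powR_comp _ (fun y => y * (tau + y)^-1) _ _ s (G0 y y0) (dG y y0)).
have cf (y : R) : 0 < y -> {for y, continuous f}.
  move=> y0; apply: cvgM.
    apply: cvgM; first exact: cvg_cst.
    exact: (is_derive_continuous (@is_derive_powR_comp _ (fun y => y * (tau + y)^-1) _ _ (s - 1) (G0 y y0) (dG y y0))).
  apply: cvgM; first exact: cvg_cst.
  apply: cvgV; first by rewrite gt_eqF// exprn_gt0// addr_gt0.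
  by apply: cvgM; apply: cvgD; try exact: cvg_cst; exact: cvg_id.
have f0 (y : R) : 0 < y -> 0 <= f y.
  move=> y0; rewrite /f mulr_ge0//; first by rewrite mulr_ge0 ?powR_ge0// ltW.
  by rewrite mulr_ge0 ?invr_ge0 ?sqr_ge0// ltW.
have HF : (\int[leb]_(y in `]0%R, +oo[) (f y)%:E <= 1%:E)%E.
  apply: (@ge0_FTC_bound_oy _ f F) => y y0; split.
  - exact: f0.
  - exact: cf.
  - exact: dF.
  - rewrite powR_ge0/=; apply: (@le_trans _ _ (1 `^ s)); last by rewrite powR1.
    apply: ge0_ler_powR; rewrite ?nnegrE ?ltW ?G0//.
    by rewrite ltr_pdivrMr ?addr_gt0//; lra.
have mf : measurable_fun (`]0, +oo[%classic : set R) (fun y : R => (f y)%:E).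
  apply/measurable_EFinP; apply: open_continuous_measurable_fun => //.
  by move=> y; rewrite inE/= in_itv/= andbT => y0; exact: cf.
pose C := 2 `^ ((1 + 3 * s) / 2) / s * tau `^ (- (1 + 2 * s)).
have C0 : 0 <= C by rewrite /C mulr_ge0 ?divr_ge0 ?powR_ge0// ltW.
apply: (@le_trans _ _ (C%:E * \int[leb]_(y in `]0%R, +oo[) (f y)%:E)%E); last first.
  by rewrite -[leRHS]mule1; apply: lee_wpmul2l.
rewrite -ge0_integralZl_EFin//; last first.
  by move=> y /=; rewrite in_itv/= andbT lee_fin; exact: f0.
apply: ge0_le_integral => //.
- by move=> y _; rewrite lee_fin mulr_ge0 ?powR_ge0.
- apply/measurable_EFinP/measurable_funTS; apply: measurable_funM; first exact: measurable_powR_comp.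
  apply: measurable_powR_comp.
  by apply: measurable_funD => //; exact: measurable_funX.
- by apply: measurable_funeM.
move=> y /=; rewrite in_itv/= andbT => y0; rewrite -EFinM lee_fin.
have ty : 0 < tau + y by rewrite addr_gt0.
have -> : C * f y = y `^ (s - 1) *
   (2 `^ ((1 + 3 * s) / 2) * (tau `^ (- (2 * s)) * (tau + y) `^ (- (1 + s)))).
  rewrite /C /f powRM ?invr_ge0 ?ltW//.
  have -> : (tau + y)^-1 `^ (s - 1) = (tau + y) `^ (- (s - 1)).
    by rewrite -{1}[s - 1]opprK powR_invN// ltW.
  have -> : tau `^ (- (1 + 2 * s)) = tau `^ (- (2 * s)) * tau^-1.
    rewrite -(powR_inv1 (ltW t0)) -powRD ?(gt_eqF t0) ?implybT//.
    by congr (_ `^ _); lra.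
  have -> : (tau + y) `^ (- (1 + s)) = (tau + y) `^ (- (s - 1)) * (tau + y) ^- 2.
    rewrite -(powR_invn 2 (ltW ty)) -powRD ?(gt_eqF ty) ?implybT//.
    by congr (_ `^ _); lra.
  by field; rewrite !gt_eqF.
apply: ler_wpM2l; first exact: powR_ge0.
set q := (1 + 3 * s) / 2.
apply: (@le_trans _ _ (((tau + y) ^+ 2 / 2) `^ (- q))).
  apply: le_powRN; last by rewrite /q; lra.
    by rewrite divr_gt0// exprn_gt0//; lra.
  rewrite ler_pdivrMr//; have := sqr_ge0 (tau - y).
  by rewrite !expr2; lra.
rewrite powRM ?sqr_ge0// powR_sqr; last by lra.
rewrite powR_invN// mulrC.
apply: ler_wpM2l; first exact: powR_ge0.
(* The decay of order 1 + 3s is shared out: the part of order 2s is bounded by its value at y = 0,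
   which produces the power of [tau], and the part of order 1 + s is the one contained in [f]. *)
have -> : 2 * - q = - (2 * s) + - (1 + s) by rewrite /q; lra.
rewrite powRD ?(gt_eqF ty) ?implybT//.
apply: ler_wpM2r; first exact: powR_ge0.
by apply: le_powRN; lra.
Qed.

Definition cross_kernel (s : R) (z : R * R) : \bar R :=
  (`|z.1 - z.2| `^ (- (1 + 2 * s)))%:E.

Lemma measurable_cross_kernel s : measurable_fun setT (cross_kernel s).
Proof.
apply/measurable_EFinP.
apply: measurable_powR_comp.
by apply: measurableT_comp => //; apply: measurable_funB.
Qed.

(* The only place where [s < 1 / 2] is essential: indicators of intervals have
   finite energy, so competitors may jump. *)
Lemma cross_kernel_lty (s a b : R) : 0 < s < 1 / 2 -> a < b ->
  (\int[(leb \x leb)%E]_(z in `]a, b[ `*` ~` `]a, b[) cross_kernel s z < +oo)%E.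
Proof.
move=> /andP[s0 s1] ab.
have mI : measurable (`]a, b[%classic : set R) by exact: measurable_itv.
have k0 z : (0 <= cross_kernel s z)%E by rewrite lee_fin powR_ge0.
have mk (x : R) : measurable_fun setT (fun y => cross_kernel s (x, y)).
  exact: measurableT_comp (measurable_cross_kernel s) (pair1_measurable _).
rewrite ge0_integral_setX//; [|exact: measurableC|exact: measurable_cross_kernel].
have mr (r : R) : measurable_fun setT (fun x : R => ((b - x) `^ r)%:E).
  apply/measurable_EFinP; apply: measurable_powR_comp.
  by apply: measurable_funB.
have ml (r : R) : measurable_fun setT (fun x : R => ((x - a) `^ r)%:E).
  apply/measurable_EFinP; apply: measurable_powR_comp.
  by apply: measurable_funB.
pose c : R := (2 * s)^-1.
have c0 : 0 <= c by rewrite invr_ge0; lra.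
(* For fixed [x] the two half-lines of the complement are tails with exponent q = 2s; [c] is the
   factor 1 / q of the tail bounds. *)
apply: (@le_lt_trans _ _ (\int[leb]_(x in `]a, b[)
   (c%:E * ((x - a) `^ (- (2 * s)))%:E + c%:E * ((b - x) `^ (- (2 * s)))%:E))%E).
  apply: ge0_le_integral => //.
  - by move=> x _; apply: integral_ge0.
  - apply: measurable_funTS.
    apply: (@measurable_integral_param _ _ _ _ leb _ (cross_kernel s)) => //.
      exact: measurableC.
    exact: measurable_cross_kernel.
  - by apply: measurable_funTS; apply: emeasurable_funD; apply: measurable_funeM; [exact: ml|exact: mr].
  - move=> x /=; rewrite in_itv/= => /andP[ax xb].
    rewrite setC_itvoo// ge0_integral_setU//=; last 2 first.
    + exact: measurable_funTS (mk x).
    + rewrite disj_set2E; apply/eqP; rewrite -subset0 => y []/=.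
      by rewrite !in_itv/= andbT; lra.
    rewrite -integral_itv_bndo_bndc; last exact: measurable_funTS (mk x).
    rewrite -integral_itv_obnd_cbnd; last exact: measurable_funTS (mk x).
    have s20 : 0 < 2 * s by lra.
    apply: leeD.
    + rewrite -EFinM mulrC; apply: le_trans (powR_tail_left s20 ax).
      rewrite le_eqVlt; apply/orP; left; apply/eqP; apply: eq_integral => y.
      rewrite inE/= in_itv/= => ya; rewrite /cross_kernel/= gtr0_norm//; lra.
    + rewrite -EFinM mulrC; apply: le_trans (powR_tail_right s20 xb).
      rewrite le_eqVlt; apply/orP; left; apply/eqP; apply: eq_integral => y.
      rewrite inE/= in_itv/= andbT => ya; rewrite /cross_kernel/= ltr0_norm ?opprB//; lra.
rewrite ge0_integralD//; last 4 first.
- by move=> x _; rewrite -EFinM lee_fin mulr_ge0 ?powR_ge0.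
- by apply: measurable_funTS; apply: measurable_funeM; first [exact: ml|exact: mr].
- by move=> x _; rewrite -EFinM lee_fin mulr_ge0 ?powR_ge0.
- by apply: measurable_funTS; apply: measurable_funeM; first [exact: ml|exact: mr].
rewrite !ge0_integralZl_EFin//; try (by apply: measurable_funTS; first [exact: ml|exact: mr]);
  try by move=> x _; rewrite lee_fin powR_ge0.
(* The remaining singularities at the two ends of the interval have order 2s, and are integrable
   because 2s < 1. *)
have s01 : 0 < 2 * s < 1 by apply/andP; split; lra.
apply: lte_add_pinfty; apply: lte_mul_pinfty; rewrite ?lee_fin//.
- by apply: le_lt_trans (powR_sing_left s01 ab) _; rewrite ltry.
- by apply: le_lt_trans (powR_sing_right s01 ab) _; rewrite ltry.
Qed.

End RadialIntegrals.

(** * The extension kernel *)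

Section ExtensionKernel.
Set Implicit Arguments.
Unset Strict Implicit.
Variable R : realType.
Notation leb := (@lebesgue_measure R).

Definition pexp (s : R) : R := (1 + 2 * s) / 2.
Definition rho (x y t : R) : R := (x - t) ^+ 2 + y ^+ 2.

(* The extension kernel is [sigma_s s * pker s x y t]. *)
Definition pker (s : R) (x y t : R) : R := y `^ (2 * s) * rho x y t `^ (- pexp s).
Definition pkerx (s : R) (x y t : R) : R :=
  y `^ (2 * s) * (- pexp s * rho x y t `^ (- pexp s - 1) * (2 * (x - t))).
Definition pkery (s : R) (x y t : R) : R :=
  2 * s * y `^ (2 * s - 1) * rho x y t `^ (- pexp s) +
  y `^ (2 * s) * (- pexp s * rho x y t `^ (- pexp s - 1) * (2 * y)).

Lemma rho_gt0 x y t : 0 < y -> 0 < rho x y t.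
Proof. by move=> y0; rewrite /rho ltr_wpDl ?sqr_ge0// exprn_gt0. Qed.

Lemma pker_is_derivex (s : R) (y t x : R) : 0 < y ->
  is_derive x 1 (fun x => pker s x y t) (pkerx s x y t).
Proof.
move=> y0.
have d : is_derive x 1 (fun x => rho x y t) (2 * (x - t)).
  by rewrite /rho; apply: is_derive_eq; rewrite /GRing.scale/=; ring.
have := @is_derive_powR_comp _ (fun x => rho x y t) _ _ (- pexp s) (rho_gt0 x t y0) d.
by move=> d2; apply: is_derive_eq.
Qed.

Lemma pker_is_derivey (s : R) (x t y : R) : 0 < y ->
  is_derive y 1 (fun y => pker s x y t) (pkery s x y t).
Proof.
move=> y0.
have d : is_derive y 1 (fun y => rho x y t) (2 * y).
  by rewrite /rho; apply: is_derive_eq; rewrite /GRing.scale/=; ring.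
have d2 := @is_derive_powR_comp _ (fun y => rho x y t) _ _ (- pexp s) (rho_gt0 x t y0) d.
have d1 := is_derive1_powR (2 * s) y0.
have H := is_deriveM d1 d2.
by apply: (is_derive_eq H); rewrite /pkery /GRing.scale/=; ring.
Qed.

(** For y > 0 this is [pker s x y t / y]: differentiating the kernel costs at most one power of the
    height. *)
Definition grad_weight (s : R) (x y t : R) : R := y `^ (2 * s - 1) * rho x y t `^ (- pexp s).

Lemma rho_powRS (s : R) x y t : 0 < y ->
  rho x y t `^ (- pexp s - 1) = rho x y t `^ (- pexp s) / rho x y t.
Proof.
move=> y0; have r0 := rho_gt0 x t y0.
by rewrite powRB ?(gt_eqF r0) ?implybT// powRr1// ltW.
Qed.

Lemma powR_2sB1 (s : R) (y : R) : 0 < y -> y `^ (2 * s) = y `^ (2 * s - 1) * y.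
Proof.
move=> y0; rewrite -{3}(powRr1 (ltW y0)) -powRD ?(gt_eqF y0) ?implybT//.
by rewrite subrK.
Qed.

(** [pkerx] is [grad_weight] times -(1 + 2s) y (x - t) / rho, and y |x - t| <= rho. The factor 1 +
    2s is below 2; the constant 3 is a common bound for both partial derivatives. *)
Lemma pkerx_le (s : R) (hs : 0 < s < 1 / 2) x y t :
  0 < y -> `|pkerx s x y t| <= 3 * grad_weight s x y t.
Proof. have /andP[s0 s1] := hs.
move=> y0; have r0 := rho_gt0 x t y0.
have w0 : 0 <= grad_weight s x y t by rewrite mulr_ge0 ?powR_ge0.
have -> : pkerx s x y t = grad_weight s x y t * (- (1 + 2 * s) * (y * (x - t) / rho x y t)).
  rewrite /pkerx /grad_weight rho_powRS// (powR_2sB1 s y0) /pexp.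
  by field; rewrite gt_eqF.
rewrite normrM (ger0_norm w0) mulrC; apply: ler_wpM2r => //.
rewrite normrM (_ : `|- (1 + 2 * s)| = 1 + 2 * s); last by rewrite normrN ger0_norm//; lra.
have h : `|y * (x - t) / rho x y t| <= 1.
  rewrite normrM normrV ?unitfE ?gt_eqF// (gtr0_norm r0) ler_pdivrMr// mul1r.
  rewrite ler_norml /rho; have := sqr_ge0 (y - (x - t)); have := sqr_ge0 (y + (x - t)).
  have := sqr_ge0 (x - t); have := sqr_ge0 y; rewrite !expr2.
  by move=> *; apply/andP; split; nra.
apply: (@le_trans _ _ ((1 + 2 * s) * 1)); last by lra.
by apply: ler_wpM2l => //; lra.
Qed.

Lemma pkery_le (s : R) (hs : 0 < s < 1 / 2) x y t :
  0 < y -> `|pkery s x y t| <= 3 * grad_weight s x y t.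
Proof. have /andP[s0 s1] := hs.
move=> y0; have r0 := rho_gt0 x t y0.
have w0 : 0 <= grad_weight s x y t by rewrite mulr_ge0 ?powR_ge0.
have -> : pkery s x y t = grad_weight s x y t * (2 * s - (1 + 2 * s) * (y ^+ 2 / rho x y t)).
  rewrite /pkery /grad_weight rho_powRS// (powR_2sB1 s y0) /pexp.
  by field; rewrite gt_eqF.
rewrite normrM (ger0_norm w0) mulrC; apply: ler_wpM2r => //.
have h : 0 <= y ^+ 2 / rho x y t <= 1.
  rewrite divr_ge0 ?sqr_ge0 ?(ltW r0)//= ler_pdivrMr// mul1r /rho.
  by rewrite lerDr sqr_ge0.
case/andP: h => h1 h2.
by rewrite ler_norml; apply/andP; split; nra.
Qed.

Lemma measurable_rho d (T : measurableType d) (f g h : T -> R) :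
  measurable_fun setT f -> measurable_fun setT g -> measurable_fun setT h ->
  measurable_fun setT (fun z => rho (f z) (g z) (h z)).
Proof.
move=> mf mg mh; apply: measurable_funD; apply: measurable_funX => //.
exact: measurable_funB.
Qed.

Lemma measurable_pker (s : R) d (T : measurableType d) (f g h : T -> R) :
  measurable_fun setT f -> measurable_fun setT g -> measurable_fun setT h ->
  measurable_fun setT (fun z => pker s (f z) (g z) (h z)).
Proof.
move=> mf mg mh; apply: measurable_funM; apply: measurable_powR_comp => //.
exact: measurable_rho.
Qed.

Lemma measurable_pkerx (s : R) d (T : measurableType d) (f g h : T -> R) :
  measurable_fun setT f -> measurable_fun setT g -> measurable_fun setT h ->
  measurable_fun setT (fun z => pkerx s (f z) (g z) (h z)).
Proof.
move=> mf mg mh; apply: measurable_funM; first exact: measurable_powR_comp.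
apply: measurable_funM; last first.
  by apply: measurable_funM => //; exact: measurable_funB.
by apply: measurable_funM => //; apply: measurable_powR_comp; exact: measurable_rho.
Qed.

Lemma measurable_pkery (s : R) d (T : measurableType d) (f g h : T -> R) :
  measurable_fun setT f -> measurable_fun setT g -> measurable_fun setT h ->
  measurable_fun setT (fun z => pkery s (f z) (g z) (h z)).
Proof.
move=> mf mg mh; apply: measurable_funD.
  apply: measurable_funM; last by apply: measurable_powR_comp; exact: measurable_rho.
  by apply: measurable_funM => //; exact: measurable_powR_comp.
apply: measurable_funM; first exact: measurable_powR_comp.
apply: measurable_funM; last exact: measurable_funM.
by apply: measurable_funM => //; apply: measurable_powR_comp; exact: measurable_rho.
Qed.

(** The bound is required at every point, not almost everywhere, so that it can be used for [f x] at
    each fixed [x]. Maps into a compact set meet it after a change on a null set. *)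
Definition bdd_mfun (M : R) (f : R -> R) :=
  measurable_fun setT f /\ forall t, `|f t| <= M.

Lemma integrable_rho x y r : 0 < y -> 1 / 2 < r ->
  leb.-integrable setT (fun t => (rho x y t `^ (- r))%:E).
Proof.
move=> y0 r0; apply/integrableP; split.
  apply/measurable_EFinP; apply: measurable_powR_comp; exact: measurable_rho.
under eq_integral do rewrite gee0_abs ?lee_fin ?powR_ge0//.
rewrite radial_integral// lte_mul_pinfty ?lee_fin ?powR_ge0//.
exact: radial_mass_lty.
Qed.

Lemma pexp_gt_half (s : R) (hs : 0 < s < 1 / 2) : 1 / 2 < pexp s.
Proof. have /andP[s0 s1] := hs; by rewrite /pexp; lra. Qed.

Lemma integrable_dom (k f : R -> R) (c M x y r : R) : 0 < y -> 1 / 2 < r ->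
  measurable_fun setT k -> (forall t, `|k t| <= c * rho x y t `^ (- r)) ->
  bdd_mfun M f -> leb.-integrable setT (fun t => (k t * f t)%:E).
Proof.
move=> y0 r0 mk kc [mf fM].
have M0 : 0 <= M by apply: le_trans (fM 0).
have iG := integrableZl measurableT (c * M) (integrable_rho x y0 r0).
apply: (le_integrable measurableT _ _ iG).
  by apply/measurable_EFinP; exact: measurable_funM.
move=> t _; rewrite -EFinM !abse_EFin lee_fin [leLHS]normrM.
apply: (le_trans _ (ler_norm _)); rewrite mulrAC.
by apply: ler_pM.
Qed.

(** The scalar extension without its factor [sigma_s s], followed by the integrals that will be its
    partial derivatives. *)
Definition pext (s : R) (f : R -> R) (p : R * R) : R := \int[leb]_t (pker s p.1 p.2 t * f t).
Definition pextx (s : R) (f : R -> R) (p : R * R) : R := \int[leb]_t (pkerx s p.1 p.2 t * f t).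
Definition pexty (s : R) (f : R -> R) (p : R * R) : R := \int[leb]_t (pkery s p.1 p.2 t * f t).

Lemma integrable_pker (s : R) (hs : 0 < s < 1 / 2) M f (x y : R) : 0 < y -> bdd_mfun M f ->
  leb.-integrable setT (fun t => (pker s x y t * f t)%:E).
Proof. have /andP[s0 s1] := hs.
move=> y0; apply: (@integrable_dom _ _ (y `^ (2 * s)) M x y (pexp s) y0 (pexp_gt_half hs)).
  exact: measurable_pker.
by move=> t; rewrite ger0_norm// mulr_ge0 ?powR_ge0.
Qed.

Lemma grad_weightE (s : R) x y t :
  3 * grad_weight s x y t = 3 * y `^ (2 * s - 1) * rho x y t `^ (- pexp s).
Proof. by rewrite mulrA. Qed.

Lemma is_derive_Rintegral (k k' : R -> R -> R) (G f : R -> R) (M z0 r : R) : 0 < r ->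
  (forall z t, `|z - z0| < r -> is_derive z 1 (k ^~ t) (k' z t)) ->
  (forall z t, `|z - z0| < r -> `|k' z t| <= G t) ->
  leb.-integrable setT (EFin \o G) ->
  (forall z, `|z - z0| < r -> leb.-integrable setT (fun t => (k z t * f t)%:E)) ->
  bdd_mfun M f ->
  is_derive z0 1 (fun z => \int[leb]_t (k z t * f t)) (\int[leb]_t (k' z0 t * f t)).
Proof.
move=> r0 dk kG iG ik [mf fM].
have M0 : 0 <= M by apply: le_trans (fM 0).
pose F z t := k z t * f t.
have inI z : `]z0 - r, z0 + r[%classic z -> `|z - z0| < r.
  by rewrite /= in_itv/= => /andP[? ?]; rewrite ltr_norml; apply/andP; split; lra.
have Iz0 : `]z0 - r, z0 + r[%classic z0.
  by rewrite /= in_itv/=; apply/andP; split; lra.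
have dF z t : `|z - z0| < r -> is_derive z 1 (F ^~ t) (k' z t * f t).
  move=> zr; have d := dk z t zr; have H := is_deriveM d (is_derive_cst (f t) z 1).
  by apply: (is_derive_eq H); rewrite /GRing.scale/=; ring.
have intf x : `]z0 - r, z0 + r[%classic x -> leb.-integrable setT (EFin \o F x).
  by move=> /inI; exact: ik.
have derf x t : `]z0 - r, z0 + r[%classic x -> setT t -> derivable (F ^~ t) x 1.
  by move=> /inI xr _; have [] := dF x t xr.
have d1E x t : `]z0 - r, z0 + r[%classic x -> partial1of2 F x t = k' x t * f t.
  by move=> /inI xr; rewrite partial1of2E; have d := dF x t xr; exact: derive_val.
have iG2 : leb.-integrable setT (EFin \o (fun t => G t * M)).
  have -> : EFin \o (fun t => G t * M) = (fun t => M%:E * (EFin \o G) t)%E.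
    by apply/funext => t /=; rewrite mulrC EFinM.
  by apply: integrableZl.
have G0 t : 0 <= G t * M.
  by rewrite mulr_ge0//; apply: le_trans (kG z0 t _); rewrite ?subrr ?normr0.
have Gub x t : `]z0 - r, z0 + r[%classic x -> setT t -> `|partial1of2 F x t| <= G t * M.
  move=> xI _; rewrite d1E// normrM ler_pM//; exact: kG (inI _ xI).
have D := @derivable_under_integral _ _ _ leb F setT measurableT z0 _ _ Iz0 intf derf
  _ G0 iG2 Gub.
have V := @differentiation_under_integral _ _ _ leb F setT measurableT z0 _ _ Iz0 intf derf
  _ G0 iG2 Gub.
apply: DeriveDef; first exact: D.
rewrite -derive1E V; apply: eq_Rintegral => t _; exact: d1E.
Qed.

(** From (x0 - t)^2 <= 2 (x - t)^2 + y0^2 / 2 and y0 <= 2 y follows rho x0 y0 t <= 2 (x - t)^2 + 6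
    y^2, which is within 8 rho x y t. Differentiation under the integral sign thus has a majorant
    independent of the nearby point. *)
Lemma rho_near x0 y0 x y t : 0 < y0 -> `|x - x0| < y0 / 2 -> `|y - y0| < y0 / 2 ->
  0 < y /\ rho x0 y0 t / 8 <= rho x y t.
Proof.
move=> y00; rewrite !ltr_norml => /andP[h1 h2] /andP[h3 h4]; split; first by lra.
rewrite ler_pdivrMr// /rho.
have : (x0 - x) ^+ 2 <= (y0 / 2) ^+ 2.
  by rewrite -ler_sqrt ?sqr_ge0 ?exprn_ge0 ?divr_ge0 ?(ltW y00)// !sqrtr_sqr ler_norml;
     rewrite (ger0_norm (_ : 0 <= y0 / 2)); try (apply/andP; split); lra.
have := sqr_ge0 (x - t - (x0 - x)).
have : (y0 / 2) ^+ 2 <= y ^+ 2 by rewrite ler_sqr ?nnegrE; lra.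
have := sqr_ge0 (x - t); have := sqr_ge0 y0.
by rewrite !expr2 => *; nra.
Qed.

Definition grad_dom (s : R) x0 y0 t : R :=
  3 * ((y0 / 2) `^ (2 * s - 1) * (rho x0 y0 t / 8) `^ (- pexp s)).

Lemma integrable_grad_dom (s : R) (hs : 0 < s < 1 / 2) x0 y0 : 0 < y0 ->
  leb.-integrable setT (EFin \o grad_dom s x0 y0).
Proof. have /andP[s0 s1] := hs.
move=> y00.
have -> : EFin \o grad_dom s x0 y0 = (fun t =>
    (3 * ((y0 / 2) `^ (2 * s - 1) * 8 `^ pexp s))%:E * (rho x0 y0 t `^ (- pexp s))%:E)%E.
  apply/funext => t; rewrite /grad_dom /= -EFinM; congr EFin.
  by rewrite powRM ?(ltW (rho_gt0 _ _ _))// ?powR_invN//; ring.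
by apply: integrableZl => //; apply: integrable_rho => //; exact: (pexp_gt_half hs).
Qed.

Lemma grad_weight_near (s : R) (hs : 0 < s < 1 / 2) x0 y0 x y t : 0 < y0 -> `|x - x0| < y0 / 2 -> `|y - y0| < y0 / 2 ->
  3 * grad_weight s x y t <= grad_dom s x0 y0 t.
Proof. have /andP[s0 s1] := hs.
move=> y00 h1 h2; have [y_gt0 rr] := rho_near t y00 h1 h2.
have r0 := rho_gt0 x0 t y00.
rewrite /grad_dom ler_pM2l// ler_pM ?powR_ge0//.
  have -> : 2 * s - 1 = - (1 - 2 * s) by ring.
  apply: le_powRN; [lra| |lra].
  by move: h2; rewrite ltr_norml => /andP[? ?]; lra.
apply: le_powRN => //; first by rewrite divr_gt0.
by have := (pexp_gt_half hs); lra.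
Qed.

Lemma pext_is_derivex (s : R) (hs : 0 < s < 1 / 2) M f (x y : R) : 0 < y -> bdd_mfun M f ->
  is_derive x 1 (fun x => pext s f (x, y)) (pextx s f (x, y)).
Proof. have /andP[s0 s1] := hs.
move=> y0 bf; have y20 : 0 < y / 2 by lra.
have yy : `|y - y| < y / 2 by rewrite subrr normr0.
apply: (@is_derive_Rintegral (fun x t => pker s x y t) (fun x t => pkerx s x y t)
  (grad_dom s x y) f M x (y / 2)) => //.
- by move=> z t _; exact: pker_is_derivex.
- by move=> z t zr; apply: (le_trans (pkerx_le hs _ _ y0)); exact: grad_weight_near.
- exact: (integrable_grad_dom hs).
- by move=> z _; exact: (@integrable_pker s hs M f z y y0 bf).
Qed.

Lemma pext_is_derivey (s : R) (hs : 0 < s < 1 / 2) M f (x y : R) : 0 < y -> bdd_mfun M f ->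
  is_derive y 1 (fun y => pext s f (x, y)) (pexty s f (x, y)).
Proof. have /andP[s0 s1] := hs.
move=> y0 bf; have y20 : 0 < y / 2 by lra.
have xx : `|x - x| < y / 2 by rewrite subrr normr0.
have pos z : `|z - y| < y / 2 -> 0 < z.
  by rewrite ltr_norml => /andP[? ?]; lra.
apply: (@is_derive_Rintegral (fun y t => pker s x y t) (fun y t => pkery s x y t)
  (grad_dom s x y) f M y (y / 2)) => //.
- by move=> z t /pos z0; exact: pker_is_derivey.
- by move=> z t zr; apply: (le_trans (pkery_le hs _ _ (pos _ zr))); exact: grad_weight_near.
- exact: (integrable_grad_dom hs).
- by move=> z /pos z0; exact: (@integrable_pker s hs M f x z z0 bf).
Qed.

Lemma bdd_mfun1 : bdd_mfun 1 (fun=> 1).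
Proof. by split => // t; rewrite normr1. Qed.

(* The mass of the kernel does not depend on [(x, y)]; differentiating under the
   integral sign, both partial derivatives of the kernel have zero mean. *)
Lemma pext_cst1 (s : R) x y : 0 < y -> pext s (fun=> 1) (x, y) = fine (radial_mass (pexp s)).
Proof.
move=> y0; rewrite /pext /Rintegral; congr fine.
under eq_integral do rewrite mulr1 EFinM.
rewrite ge0_integralZl_EFin ?powR_ge0//; last 2 first.
- by move=> t _; rewrite lee_fin powR_ge0.
- by apply/measurable_EFinP; apply: measurable_powR_comp; exact: measurable_rho.
rewrite radial_integral// muleA -EFinM -powRD ?(gt_eqF y0) ?implybT//.
by rewrite (_ : _ + _ = 0) ?powRr0 ?mul1e// /pexp; lra.
Qed.

Lemma Rintegral_pkerx (s : R) (hs : 0 < s < 1 / 2) x y : 0 < y -> \int[leb]_t pkerx s x y t = 0.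
Proof. have /andP[s0 s1] := hs.
move=> y0; have d := @pext_is_derivex s hs 1 (fun=> 1) x y y0 bdd_mfun1.
have : derive (fun x => pext s (fun=> 1) (x, y)) x 1 = pextx s (fun=> 1) (x, y).
  exact: derive_val.
rewrite (_ : (fun x => _) = cst (fine (radial_mass (pexp s)))); last first.
  by apply/funext => z; exact: pext_cst1.
rewrite derive_cst /pextx => ->; apply: eq_Rintegral => t _ /=.
by rewrite mulr1.
Qed.

Lemma Rintegral_pkery (s : R) (hs : 0 < s < 1 / 2) x y : 0 < y -> \int[leb]_t pkery s x y t = 0.
Proof. have /andP[s0 s1] := hs.
move=> y0; have d := @pext_is_derivey s hs 1 (fun=> 1) x y y0 bdd_mfun1.
have : derive (fun y => pext s (fun=> 1) (x, y)) y 1 = pexty s (fun=> 1) (x, y).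
  exact: derive_val.
(* The mass is known to be constant only at positive heights, so the vertical derivative is computed
   from the germ at [y]. *)
rewrite (near_eq_derive (g := cst (fine (radial_mass (pexp s)))))//; last first.
  by near=> z; apply: pext_cst1; near: z; exact: lt_nbhsr.
rewrite derive_cst /pexty => ->; apply: eq_Rintegral => t _ /=.
by rewrite mulr1.
Unshelve. all: by end_near.
Qed.

End ExtensionKernel.

(** * Energy estimate for the extension *)

Section GradientEnergy.
Set Implicit Arguments.
Unset Strict Implicit.
Variable R : realType.
Notation leb := (@lebesgue_measure R).

(** Testing with l = X / A gives the claim without square roots. When A = 0, the choice l = (B + 1)
    / X contradicts X > 0. *)
Lemma le_sqr_discr (X A B : R) : 0 <= X -> 0 <= A -> 0 <= B ->
  (forall l, 0 < l -> 2 * X <= l * A + B / l) -> X ^+ 2 <= A * B.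
Proof.
move=> X0 A0 B0 H.
have [->|Xn0] := eqVneq X 0; first by rewrite expr0n/= mulr_ge0.
have Xp : 0 < X by rewrite lt_neqAle eq_sym Xn0.
have [Az|An0] := eqVneq A 0.
  have l0 : 0 < (B + 1) / X by rewrite divr_gt0//; lra.
  have := H _ l0; rewrite Az mulr0 add0r invf_div mulrA ler_pdivlMr; last by lra.
  by move=> h; nra.
have Ap : 0 < A by rewrite lt_neqAle eq_sym An0.
have := H (X / A) (divr_gt0 Xp Ap); rewrite divfK// invf_div mulrA => h.
have : X <= B * A / X by lra.
by rewrite ler_pdivlMr// -expr2 mulrC.
Qed.

(** Integrating 2 c <= l a + b / l for every l > 0 yields both that the integral of [c] is finite
    (already with l = 1) and, by optimising in l, the product bound. *)
Lemma ge0_cauchy_schwarz d (T : measurableType d) (mu : {measure set T -> \bar R})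
    (a b c : T -> R) (A B : R) :
  measurable_fun setT a -> measurable_fun setT b -> measurable_fun setT c ->
  (forall t, 0 <= a t) -> (forall t, 0 <= b t) -> (forall t, 0 <= c t) ->
  (forall t, c t ^+ 2 <= a t * b t) ->
  (\int[mu]_t (a t)%:E = A%:E)%E -> (\int[mu]_t (b t)%:E = B%:E)%E ->
  exists2 X : R, 0 <= X /\ (\int[mu]_t (c t)%:E = X%:E)%E & X ^+ 2 <= A * B.
Proof.
move=> ma mb mc a0 b0 c0 cab iA iB.
have A0 : 0 <= A by rewrite -lee_fin -iA integral_ge0// => t _; rewrite lee_fin.
have B0 : 0 <= B by rewrite -lee_fin -iB integral_ge0// => t _; rewrite lee_fin.
have ci0 : (0 <= \int[mu]_t (c t)%:E)%E by apply: integral_ge0 => t _; rewrite lee_fin.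
have key l : 0 < l -> (2%:E * \int[mu]_t (c t)%:E <= (l * A + B / l)%:E)%E.
  move=> l0.
  have -> : ((l * A + B / l)%:E = \int[mu]_t (l%:E * (a t)%:E + l^-1%:E * (b t)%:E))%E.
    rewrite ge0_integralD//.
    - rewrite !ge0_integralZl_EFin ?iA ?iB//.
      + by rewrite EFinD !EFinM [(B%:E * _)%E]muleC.
      + by move=> t _; rewrite lee_fin.
      + exact/measurable_EFinP.
      + by rewrite invr_ge0 ltW.
      + by move=> t _; rewrite lee_fin.
      + exact/measurable_EFinP.
      + exact: ltW.
    - by move=> t _; rewrite -EFinM lee_fin mulr_ge0// ltW.
    - by apply: measurable_funeM; exact/measurable_EFinP.
    - by move=> t _; rewrite -EFinM lee_fin mulr_ge0// invr_ge0 ltW.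
    - by apply: measurable_funeM; exact/measurable_EFinP.
  rewrite -ge0_integralZl_EFin//; last 2 first.
  - by move=> t _; rewrite lee_fin.
  - exact/measurable_EFinP.
  apply: ge0_le_integral => //.
  - by move=> t _; rewrite -EFinM lee_fin mulr_ge0.
  - by apply: measurable_funeM; exact/measurable_EFinP.
  - by apply: emeasurable_funD; apply: measurable_funeM; exact/measurable_EFinP.
  - move=> t _; rewrite -!EFinM -EFinD lee_fin.
    have u0 : 0 <= l * a t + l^-1 * b t.
      by rewrite addr_ge0// mulr_ge0// ?invr_ge0 ltW.
    rewrite -ler_sqr ?nnegrE ?mulr_ge0//.
    have h : a t * b t = (l * a t) * (l^-1 * b t) by field; rewrite gt_eqF.
    have := cab t; rewrite h => h2; have := sqr_ge0 (l * a t - l^-1 * b t).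
    by move: h2; set u := l * a t; set v := l^-1 * b t; rewrite !expr2 => *; nra.
have fin : (\int[mu]_t (c t)%:E)%E \is a fin_num.
  rewrite ge0_fin_numE//; have := key 1 ltr01.
  case: (\int[mu]_t (c t)%:E)%E ci0 => [r|//|//] _; first by rewrite ltry.
  by rewrite mulr_infty gtr0_sg// mul1e leye_eq.
exists (fine (\int[mu]_t (c t)%:E)%E); first by rewrite fine_ge0// fineK.
apply: le_sqr_discr => //; first exact: fine_ge0.
move=> l l0; have := key l l0; rewrite -{1}(fineK fin) -EFinM lee_fin.
by [].
Qed.

Lemma ge0_integral_swap (B : set R) (F : R * R -> \bar R) :
  measurable B -> measurable_fun setT F -> (forall z, (0 <= F z)%E) ->
  (\int[leb]_(y in B) \int[leb]_t F (y, t) = \int[leb]_t \int[leb]_(y in B) F (y, t))%E.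
Proof.
move=> mB mF F0.
have := @fubini_tonelli _ _ _ _ R leb leb (F \_ (B `*` setT)).
move=> H.
transitivity (\int[leb]_y \int[leb]_t (F \_ (B `*` setT)) (y, t))%E.
  rewrite integral_mkcond; apply: eq_integral => y _; rewrite patchE.
  case: ifPn => yB.
    by apply: eq_integral => t _; rewrite patchE in_setX/= yB in_setT.
  by rewrite integral0_eq// => t _; rewrite patchE in_setX/= (negbTE yB).
rewrite H; last 2 first.
- by apply/(measurable_restrictT _ (measurableX mB measurableT)); exact: measurable_funTS.
- by move=> z; apply: erestrict_ge0.
apply: eq_integral => t _; rewrite [RHS]integral_mkcond; apply: eq_integral => y _.
by rewrite !patchE in_setX/= in_setT andbT.
Qed.

(** The density left after Cauchy-Schwarz. Its powers are those of [vertical_integral] with tau = |x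
    - t|, so that integration over the height returns the kernel |x - t|^(-1-2s). *)
Definition diff_weight (s : R) (f : R -> R) (x y t : R) : R :=
  y `^ (s - 1) * rho x y t `^ (- ((1 + 3 * s) / 2)) * (f x - f t) ^+ 2.

(** The 9 is the square of the constant 3 in [pkerx_le] and [pkery_le]; the mass is that of the
    first Cauchy-Schwarz weight. *)
Definition grad_const (s : R) : R := 9 * fine (radial_mass ((1 + s) / 2)).

Lemma grad_const_ge0 (s : R) : 0 <= grad_const s.
Proof.
rewrite /grad_const mulr_ge0// fine_ge0//; apply: integral_ge0 => t _.
by rewrite lee_fin powR_ge0.
Qed.

(* Since [k] has zero mean, [f x] may be subtracted from [f t]; then Cauchy-Schwarz
   with the weights [rho `^ (- (1 + s) / 2)] and [rho `^ (- (1 + 3 * s) / 2)]. This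
   splitting leaves the factor [y `^ (s - 1)], which is integrable at [0]. *)
Lemma grad_sq_bound (s : R) (hs : 0 < s < 1 / 2) (k f : R -> R) (M x y : R) :
  0 < y -> bdd_mfun M f -> measurable_fun setT k ->
  (forall t, `|k t| <= 3 * grad_weight s x y t) ->
  \int[leb]_t k t = 0 ->
  ((y `^ (1 - 2 * s) * (\int[leb]_t (k t * f t)) ^+ 2)%:E <=
   (grad_const s)%:E * \int[leb]_t (diff_weight s f x y t)%:E)%E.
Proof.
move=> y0 bf mk kle ik0; have /andP[s0 s1] := hs; have [mf fM] := bf.
have M0 : 0 <= M by apply: le_trans (fM 0).
pose D t := `|f t - f x|.
have mD : measurable_fun setT D by apply: measurableT_comp => //; exact: measurable_funB.
have DM t : `|D t| <= 2 * M.
  rewrite normr_id; apply: (le_trans (ler_normB _ _)).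
  by have := fM t; have := fM x; lra.
have mrho r : measurable_fun setT (fun t => rho x y t `^ r).
  by apply: measurable_powR_comp; exact: measurable_rho.
(* The two exponents add up to 1 + 2s, twice [pexp s], so [c t ^+ 2] equals [a t * b t]. Both exceed
   1/2, hence both integrals converge. *)
pose a t := rho x y t `^ (- ((1 + s) / 2)).
pose b t := y `^ (4 * s - 2) * (rho x y t `^ (- ((1 + 3 * s) / 2)) * D t ^+ 2).
pose c t := grad_weight s x y t * D t.
have bD2 : bdd_mfun ((2 * M) ^+ 2) (fun t => D t ^+ 2).
  split; first exact: measurable_funX.
  by move=> t; rewrite normrX ler_sqr ?nnegrE ?mulr_ge0//; exact: DM.
have iA : (\int[leb]_t (a t)%:E = (y `^ (- s) * fine (radial_mass ((1 + s) / 2)))%:E)%E.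
  rewrite radial_integral// EFinM fineK; last first.
    rewrite ge0_fin_numE; first by apply: radial_mass_lty; lra.
    by apply: integral_ge0 => t _; rewrite lee_fin powR_ge0.
  by congr ((y `^ _)%:E * _)%E; lra.
have ib : leb.-integrable setT (fun t => (rho x y t `^ (- ((1 + 3 * s) / 2)) * D t ^+ 2)%:E).
  apply: (@integrable_dom _ _ _ 1 _ x y ((1 + 3 * s) / 2) y0 _ _ _ bD2) => //; first by lra.
  by move=> t; rewrite mul1r ger0_norm ?powR_ge0.
pose B0 := fine (\int[leb]_t (rho x y t `^ (- ((1 + 3 * s) / 2)) * D t ^+ 2)%:E)%E.
have iB0 : (\int[leb]_t (rho x y t `^ (- ((1 + 3 * s) / 2)) * D t ^+ 2)%:E = B0%:E)%E.
  by rewrite /B0 fineK// integrable_fin_num.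
have mb0 : measurable_fun setT (fun t => (rho x y t `^ (- ((1 + 3 * s) / 2)) * D t ^+ 2)%:E).
  by apply/measurable_EFinP; apply: measurable_funM => //; exact: measurable_funX.
have iB : (\int[leb]_t (b t)%:E = (y `^ (4 * s - 2) * B0)%:E)%E.
  rewrite EFinM -iB0 -ge0_integralZl_EFin ?powR_ge0//.
  by move=> t _; rewrite lee_fin mulr_ge0 ?powR_ge0 ?sqr_ge0.
have mc : measurable_fun setT c.
  by apply: measurable_funM => //; apply: measurable_funM => //; exact: measurable_cst.
have c0 t : 0 <= c t 
  by apply: mulr_ge0; [rewrite mulr_ge0 ?powR_ge0|exact: normr_ge0].
have [X [X0 iX] XAB] : exists2 X : R, 0 <= X /\ (\int[leb]_t (c t)%:E = X%:E)%E &
    X ^+ 2 <= (y `^ (- s) * fine (radial_mass ((1 + s) / 2))) * (y `^ (4 * s - 2) * B0).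
  apply: (@ge0_cauchy_schwarz _ _ leb a b c) => //.
  - exact: mrho.
  - by apply: measurable_funM => //; exact/measurable_EFinP.
  - by move=> t; exact: powR_ge0.
  - by move=> t; rewrite mulr_ge0 ?powR_ge0// mulr_ge0 ?powR_ge0 ?sqr_ge0.
  - move=> t; rewrite le_eqVlt; apply/orP; left; apply/eqP.
    have r0 := rho_gt0 x t y0.
    have e1 : (y `^ (2 * s - 1)) ^+ 2 = y `^ (4 * s - 2).
      by rewrite -powR_mulrn ?powR_ge0// -powRrM; congr (_ `^ _); lra.
    have e2 : (rho x y t `^ (- pexp s)) ^+ 2 =
        rho x y t `^ (- ((1 + s) / 2)) * rho x y t `^ (- ((1 + 3 * s) / 2)).
      rewrite -powR_mulrn ?powR_ge0// -powRrM -powRD ?(gt_eqF r0) ?implybT//.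
      by congr (_ `^ _); rewrite /pexp; lra.
    by rewrite /a /b /c /grad_weight !exprMn e1 e2; ring.
have ikf : leb.-integrable setT (fun t => (k t * f t)%:E).
  apply: (@integrable_dom _ _ _ (3 * y `^ (2 * s - 1)) M x y (pexp s) y0 (pexp_gt_half hs)) => //.
  by move=> t; rewrite -grad_weightE.
have ik : leb.-integrable setT (fun t => (k t)%:E).
  have := @integrable_dom _ k _ (3 * y `^ (2 * s - 1)) 1 x y (pexp s) y0 (pexp_gt_half hs) mk
    _ (bdd_mfun1 R).
  rewrite (_ : (fun t => (k t * 1)%:E) = (fun t => (k t)%:E)); last first.
    by apply/funext => t; rewrite mulr1.
  by apply => t; rewrite -grad_weightE.
have ikfx : leb.-integrable setT (fun t => (k t * f x)%:E).
  rewrite (_ : (fun t => _) = (fun t => (f x)%:E * (k t)%:E)%E); last first.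
    by apply/funext => t; rewrite -EFinM mulrC.
  exact: integrableZl.
have E1 : \int[leb]_t (k t * f t) = \int[leb]_t (k t * f t - k t * f x).
  rewrite RintegralB//.
  have -> : \int[leb]_t (k t * f x) = 0.
    by rewrite RintegralZr// ik0 mul0r.
  by rewrite subr0.
have L1 : `|\int[leb]_t (k t * f t)| <= 3 * X.
  rewrite E1 -lee_fin.
  apply: (@le_trans _ _ (\int[leb]_t (`|k t * f t - k t * f x|)%:E)%E).
    rewrite EFin_normr_Rintegral//; last first.
      exact: (integrableB measurableT ikf ikfx).
    apply: le_trans (le_abse_integral _ _ _) _ => //.
    apply/measurable_EFinP; apply: measurable_funB; apply: measurable_funM => //.
  rewrite EFinM -iX -ge0_integralZl_EFin//; last 2 first.
  - by move=> t _; rewrite lee_fin.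
  - exact/measurable_EFinP.
  apply: ge0_le_integral => //.
  - apply/measurable_EFinP; apply: measurableT_comp => //.
    by apply: measurable_funB; apply: measurable_funM => //.
  - by apply: measurable_funeM; exact/measurable_EFinP.
  - move=> t _; rewrite -EFinM lee_fin -mulrBr normrM /c mulrA.
    by apply: ler_wpM2r => //.
have L2 : (\int[leb]_t (k t * f t)) ^+ 2 <= 9 * X ^+ 2.
  have := ler_pM (normr_ge0 _) (normr_ge0 _) L1 L1.
  by rewrite -expr2 real_normK ?num_real// => h; apply: le_trans h _; rewrite expr2; lra.
have -> : (\int[leb]_t (diff_weight s f x y t)%:E = (y `^ (s - 1) * B0)%:E)%E.
  rewrite EFinM -iB0 -ge0_integralZl_EFin ?powR_ge0//; last first.
    by move=> t _; rewrite lee_fin mulr_ge0 ?powR_ge0 ?sqr_ge0.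
  apply: eq_integral => t _; rewrite -EFinM; congr EFin.
  by rewrite /diff_weight /D real_normK ?num_real//; ring.
rewrite -EFinM lee_fin /grad_const.
(* Powers of the height: 1 - 2s from the weight of the norm, -s from the integral of [a], 4s - 2
   from [b]. Their sum is the s - 1 in [diff_weight]. *)
have yE : y `^ (s - 1) = y `^ (1 - 2 * s) * (y `^ (- s) * y `^ (4 * s - 2)).
  by rewrite -!powRD ?(gt_eqF y0) ?implybT//; congr (_ `^ _); lra.
rewrite yE; move: XAB L2; set m := fine _; set u := y `^ (1 - 2 * s).
set v := y `^ (- s); set w := y `^ (4 * s - 2) => XAB L2.
have -> : 9 * m * (u * (v * w) * B0) = u * (9 * (v * m * (w * B0))) by ring.
apply: ler_wpM2l; first exact: powR_ge0.
by apply: le_trans L2 _; rewrite ler_pM2l.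
Qed.

Definition gagliardo (s : R) (f : R -> R) (z : R * R) : \bar R :=
  ((f z.1 - f z.2) ^+ 2 / (`|z.1 - z.2| `^ (1 + 2 * s)))%:E.

Lemma measurable_gagliardo s f : measurable_fun setT f -> measurable_fun setT (gagliardo s f).
Proof.
move=> mf; apply/measurable_EFinP; apply: measurable_funM.
  by apply: measurable_funX; apply: measurable_funB; apply: measurableT_comp.
rewrite (_ : (fun z => _) = (fun z : R * R => `|z.1 - z.2| `^ (- (1 + 2 * s)))); last first.
  by apply/funext => z; rewrite powRN.
by apply: measurable_powR_comp; apply: measurableT_comp => //; exact: measurable_funB.
Qed.

Lemma gagliardo_ge0 s f z : (0 <= gagliardo s f z)%E.
Proof. by rewrite lee_fin divr_ge0 ?sqr_ge0 ?powR_ge0. Qed.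

Lemma measurable_diff_weight d (T : measurableType d) s f (u v w : T -> R) :
  measurable_fun setT f ->
  measurable_fun setT u -> measurable_fun setT v -> measurable_fun setT w ->
  measurable_fun setT (fun z => (diff_weight s f (u z) (v z) (w z))%:E).
Proof.
move=> mf mu mv mw; apply/measurable_EFinP; apply: measurable_funM.
  apply: measurable_funM; apply: measurable_powR_comp => //; exact: measurable_rho.
by apply: measurable_funX; apply: measurable_funB; apply: measurableT_comp.
Qed.

Definition vert_const (s : R) : R := 2 `^ ((1 + 3 * s) / 2) / s.

Lemma diff_weight_vertical (s : R) (hs : 0 < s < 1 / 2) f x t :
  measurable_fun setT f ->
  (\int[leb]_(y in `]0%R, +oo[) (diff_weight s f x y t)%:E <=
    (vert_const s)%:E * gagliardo s f (x, t))%E.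
Proof.
move=> mf; have /andP[s0 s1] := hs.
have [<-|xt] := eqVneq x t.
  rewrite integral0_eq; last first.
    by move=> y _; rewrite /diff_weight subrr expr0n mulr0.
  by rewrite mule_ge0 ?gagliardo_ge0// lee_fin divr_ge0 ?powR_ge0// ltW.
have t0 : 0 < `|x - t| by rewrite normr_gt0 subr_eq0.
pose h y : R := y `^ (s - 1) * (`|x - t| ^+ 2 + y ^+ 2) `^ (- ((1 + 3 * s) / 2)).
have mh : measurable_fun setT h.
  apply: measurable_funM; apply: measurable_powR_comp => //.
  by apply: measurable_funD => //; exact: measurable_funX.
rewrite (_ : (\int[leb]_(y in _) _)%E =
    (((f x - f t) ^+ 2)%:E * \int[leb]_(y in `]0%R, +oo[) (h y)%:E)%E); last first.
  rewrite -ge0_integralZl_EFin ?sqr_ge0//; last 2 first.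
  - by move=> y _; rewrite lee_fin mulr_ge0 ?powR_ge0.
  - by apply/measurable_EFinP; exact: measurable_funTS.
  apply: eq_integral => y _; rewrite -EFinM; congr EFin.
  by rewrite /diff_weight /h /rho real_normK ?num_real// mulrC.
apply: le_trans (lee_wpmul2l _ (vertical_integral s0 t0)) _.
  by rewrite lee_fin sqr_ge0.
rewrite /gagliardo /= -!EFinM lee_fin /vert_const -powRN.
by rewrite le_eqVlt; apply/orP; left; apply/eqP; ring.
Qed.

(** By Tonelli, for fixed [x] the height is integrated out before [t], which turns [diff_weight]
    into the Gagliardo kernel. The point [x] never leaves [I], so the estimate is local in [x] and
    global in [t]. The function [g] stands for either partial derivative. *)
Lemma grad_energy_bound (s : R) (hs : 0 < s < 1 / 2) (I : set R) (f : R -> R)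
    (g : R * R -> R) :
  measurable I -> measurable_fun setT f -> measurable_fun setT g ->
  (forall x y, 0 < y -> ((y `^ (1 - 2 * s) * g (x, y) ^+ 2)%:E <=
     (grad_const s)%:E * \int[leb]_t (diff_weight s f x y t)%:E)%E) ->
  (\int[(leb \x leb)%E]_(p in I `*` `]0%R, +oo[) (p.2 `^ (1 - 2 * s) * g p ^+ 2)%:E <=
   (grad_const s * vert_const s)%:E *
     \int[(leb \x leb)%E]_(z in I `*` setT) gagliardo s f z)%E.
Proof.
move=> mI mf mg H; have /andP[s0 s1] := hs.
have mL : measurable_fun setT (fun p : R * R => (p.2 `^ (1 - 2 * s) * g p ^+ 2)%:E).
  apply/measurable_EFinP; apply: measurable_funM; last exact: measurable_funX.
  exact: measurable_powR_comp.
have L0 (p : R * R) : (0 <= (p.2 `^ (1 - 2 * s) * g p ^+ 2)%:E)%E.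
  by rewrite lee_fin mulr_ge0 ?powR_ge0 ?sqr_ge0.
have w0 x y t : (0 <= (diff_weight s f x y t)%:E)%E.
  by rewrite lee_fin /diff_weight mulr_ge0 ?sqr_ge0// mulr_ge0 ?powR_ge0.
have v0 : 0 <= vert_const s by rewrite divr_ge0 ?powR_ge0// ltW.
have c0 := grad_const_ge0 s.
pose W (p : R * R) : \bar R := (\int[leb]_t (diff_weight s f p.1 p.2 t)%:E)%E.
have mW : measurable_fun setT W.
  apply: (@measurable_integral_param _ _ _ _ _ leb setT
    (fun z : (R * R) * R => (diff_weight s f z.1.1 z.1.2 z.2)%:E)) => //.
  by apply: measurable_diff_weight => //; exact: measurableT_comp.
have W0 p : (0 <= W p)%E by apply: integral_ge0.
have mp (x : R) : measurable_fun setT (fun y : R => (x, y)) by exact: pair1_measurable.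
have mi : measurable (`]0%R, +oo[%classic : set R) by exact: measurable_itv.
rewrite !ge0_integral_setX//; [|exact: measurable_gagliardo|exact: gagliardo_ge0].
rewrite EFinM -muleA -ge0_integralZl_EFin//; last 2 first.
- by move=> x _; apply: integral_ge0 => t _; exact: gagliardo_ge0.
- apply: measurable_funTS; apply: (@measurable_integral_param _ _ _ _ _ leb setT (gagliardo s f)) => //.
    exact: measurable_gagliardo.
  exact: gagliardo_ge0.
rewrite -ge0_integralZl_EFin//; last 2 first.
- by move=> x _; rewrite mule_ge0 ?lee_fin// integral_ge0// => t _; exact: gagliardo_ge0.
- apply: measurable_funTS; apply: measurable_funeM.
  apply: (@measurable_integral_param _ _ _ _ _ leb setT (gagliardo s f)) => //.
    exact: measurable_gagliardo.
  exact: gagliardo_ge0.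
apply: ge0_le_integral => //.
- by move=> x _; apply: integral_ge0.
- apply: measurable_funTS; exact: (@measurable_integral_param _ _ _ _ _ leb _
    (fun p : R * R => (p.2 `^ (1 - 2 * s) * g p ^+ 2)%:E)).
- apply: measurable_funTS; apply: measurable_funeM; apply: measurable_funeM.
  apply: (@measurable_integral_param _ _ _ _ _ leb setT (gagliardo s f)) => //.
    exact: measurable_gagliardo.
  exact: gagliardo_ge0.
move=> x _.
apply: (@le_trans _ _ ((grad_const s)%:E * \int[leb]_(y in `]0%R, +oo[) W (x, y))%E).
  rewrite -ge0_integralZl_EFin//; last first.
    by apply: measurable_funTS; exact: measurableT_comp mW (mp x).
  apply: ge0_le_integral => //.
  - by apply: measurable_funTS; exact: measurableT_comp mL (mp x).
  - by apply: measurable_funTS; apply: measurable_funeM; exact: measurableT_comp mW (mp x).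
  - by move=> y /=; rewrite in_itv/= andbT => y0; exact: H.
apply: lee_wpmul2l; first by rewrite lee_fin.
have md : measurable_fun setT (fun z : R * R => (diff_weight s f x z.1 z.2)%:E).
  exact: measurable_diff_weight.
rewrite /W/= (@ge0_integral_swap _ (fun z : R * R => (diff_weight s f x z.1 z.2)%:E))//=.
rewrite -ge0_integralZl_EFin//; last 2 first.
- by move=> t _; exact: gagliardo_ge0.
- exact: measurableT_comp (measurable_gagliardo s mf) (mp x).
apply: ge0_le_integral => //.
- by move=> t _; apply: integral_ge0.
- apply: (@measurable_integral_param _ _ _ _ _ leb _
    (fun z : R * R => (diff_weight s f x z.2 z.1)%:E)) => //.
  exact: measurable_diff_weight.
- by apply: measurable_funeM; exact: measurableT_comp (measurable_gagliardo s mf) (mp x).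
- by move=> t _; exact: diff_weight_vertical.
Qed.

End GradientEnergy.

(** * Scalar extensions: measurability, bounds and limits *)

Section ScalarEnergy.
Set Implicit Arguments.
Unset Strict Implicit.
Variable R : realType.
Notation leb := (@lebesgue_measure R).

Let leb2 := [the measure _ _ of (leb \x leb)%E].

Lemma dominated_cvg0 d (T : measurableType d) (mu : {measure set T -> \bar R})
    (D : set T) (f_ : nat -> T -> R) (G : T -> R) : measurable D ->
  (forall n, measurable_fun D (f_ n)) -> mu.-integrable D (EFin \o G) ->
  (forall n x, D x -> `|f_ n x| <= G x) ->
  (forall x, D x -> f_ n x @[n --> \oo] --> 0) ->
  (\int[mu]_(x in D) (f_ n x)%:E @[n --> \oo] --> 0)%E.
Proof.
move=> mD mf iG fG f0.
have [||||_ _] := @dominated_convergence _ _ _ mu D mD (fun n x => (f_ n x)%:E) (cst 0%E)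
  (EFin \o G) _ _ _ iG _.
- by move=> n; exact/measurable_EFinP.
- exact: measurable_cst.
- by apply: aeW => x Dx; apply: cvg_EFin; [exact: nearW|exact: f0].
- by apply: aeW => x n Dx; rewrite abse_EFin lee_fin; exact: fG.
by rewrite integral0.
Qed.

Lemma measurable_Rintegral_param (F : (R * R) * R -> R) : measurable_fun setT F ->
  measurable_fun setT (fun p : R * R => \int[leb]_t F (p, t)).
Proof.
move=> mF.
have mE : measurable_fun setT (EFin \o F) by exact/measurable_EFinP.
rewrite /Rintegral; apply: (measurableT_comp (fine_measurable measurableT)).
rewrite (_ : (fun p => _) = (fun p => (\int[leb]_t (EFin \o F)^\+%E (p, t) -
    \int[leb]_t (EFin \o F)^\-%E (p, t))%E)); last first.
  apply/funext => p; rewrite [LHS]integralE.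
  by congr (_ - _)%E; apply: eq_integral => t _; rewrite ?funeposE ?funenegE.
apply: emeasurable_funB.
- apply: (@measurable_integral_param _ _ _ _ _ leb setT) => //.
  exact: measurable_funepos.
- apply: (@measurable_integral_param _ _ _ _ _ leb setT) => //.
  exact: measurable_funeneg.
Qed.

Lemma measurable_pext s f : measurable_fun setT f -> measurable_fun setT (@pext R s f).
Proof.
move=> mf; apply: (@measurable_Rintegral_param
  (fun z : (R * R) * R => pker s z.1.1 z.1.2 z.2 * f z.2)).
apply: measurable_funM; last exact: measurableT_comp.
by apply: measurable_pker => //; exact: measurableT_comp.
Qed.

Lemma measurable_pextx s f : measurable_fun setT f -> measurable_fun setT (@pextx R s f).
Proof.
move=> mf; apply: (@measurable_Rintegral_param
  (fun z : (R * R) * R => pkerx s z.1.1 z.1.2 z.2 * f z.2)).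
apply: measurable_funM; last exact: measurableT_comp.
by apply: measurable_pkerx => //; exact: measurableT_comp.
Qed.

Lemma measurable_pexty s f : measurable_fun setT f -> measurable_fun setT (@pexty R s f).
Proof.
move=> mf; apply: (@measurable_Rintegral_param
  (fun z : (R * R) * R => pkery s z.1.1 z.1.2 z.2 * f z.2)).
apply: measurable_funM; last exact: measurableT_comp.
by apply: measurable_pkery => //; exact: measurableT_comp.
Qed.

Lemma Rintegral_kernel_bound (k f : R -> R) (c M x y r : R) : 0 < y -> 1 / 2 < r ->
  measurable_fun setT k -> (forall t, `|k t| <= c * rho x y t `^ (- r)) ->
  bdd_mfun M f ->
  `|\int[leb]_t (k t * f t)| <= c * M * (y `^ (1 - 2 * r) * fine (radial_mass r)).
Proof.
move=> y0 r0 mk kc bf; have [mf fM] := bf.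
have M0 : 0 <= M by apply: le_trans (fM 0).
have c0 : 0 <= c.
  have := le_trans (normr_ge0 _) (kc 0).
  by rewrite pmulr_lge0// powR_gt0// rho_gt0.
have ikf := integrable_dom y0 r0 mk kc bf.
rewrite -lee_fin EFin_normr_Rintegral//.
apply: le_trans (le_abse_integral _ measurableT _) _.
  by apply/measurable_EFinP; exact: measurable_funM.
rewrite EFinM [(_ * fine _)%:E]EFinM fineK; last first.
  rewrite ge0_fin_numE; first exact: radial_mass_lty.
  by apply: integral_ge0 => t _; rewrite lee_fin powR_ge0.
rewrite -(radial_integral x _ y0) -ge0_integralZl_EFin ?mulr_ge0//; last 2 first.
- by move=> t _; rewrite lee_fin powR_ge0.
- by apply/measurable_EFinP; apply: measurable_powR_comp; exact: measurable_rho.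
apply: ge0_le_integral => //.
- apply: measurableT_comp => //; by apply/measurable_EFinP; exact: measurable_funM.
- apply: measurable_funeM; apply/measurable_EFinP; apply: measurable_powR_comp.
  exact: measurable_rho.
- move=> t _; rewrite abse_EFin -EFinM lee_fin normrM mulrAC.
  by apply: ler_pM => //; exact: kc.
Qed.

Lemma Rintegral_kernel_cvg0 (k : R -> R) (f_ : nat -> R -> R) (c M x y r : R) :
  0 < y -> 1 / 2 < r ->
  measurable_fun setT k -> (forall t, `|k t| <= c * rho x y t `^ (- r)) ->
  (forall n, bdd_mfun M (f_ n)) -> (forall t, f_ n t @[n --> \oo] --> 0) ->
  \int[leb]_t (k t * f_ n t) @[n --> \oo] --> 0.
Proof.
move=> y0 r0 mk kc bf f0.
have M0 : 0 <= M by have [_ fM] := bf 0%N; apply: le_trans (fM 0).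
have iG : leb.-integrable setT (EFin \o (fun t => c * M * rho x y t `^ (- r))).
  rewrite (_ : _ \o _ = (fun t => (c * M)%:E * (rho x y t `^ (- r))%:E)%E)//.
  by apply: integrableZl => //; exact: integrable_rho.
have C : (\int[leb]_t (k t * f_ n t)%:E @[n --> \oo] --> 0)%E.
  apply: (dominated_cvg0 measurableT _ iG).
  - by move=> n; apply: measurable_funM => //; have [] := bf n.
  - move=> n t _; rewrite normrM mulrAC; apply: ler_pM => //.
    by have [_] := bf n; exact.
  - move=> t _; rewrite -(mulr0 (k t)); apply: cvgM; first exact: cvg_cst.
    exact: f0.
exact: (fine_cvg C).
Qed.

Section fixed_order.
Variables (s : R) (hs : 0 < s < 1 / 2).

Let pgt : 1 / 2 < pexp s. Proof. exact: pexp_gt_half. Qed.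

(** Scale invariance of the kernel: bounded data have an extension bounded uniformly in the height,
    whereas the next identity makes a derivative cost 1 / y. *)
Lemma powR_weight0 (y : R) : 0 < y -> y `^ (2 * s) * y `^ (1 - 2 * pexp s) = 1.
Proof.
move=> y0; rewrite -powRD ?(gt_eqF y0) ?implybT//.
by rewrite (_ : _ + _ = 0) ?powRr0// /pexp; field.
Qed.

Lemma powR_weight1 (y : R) : 0 < y -> y `^ (2 * s - 1) * y `^ (1 - 2 * pexp s) = y^-1.
Proof.
move=> y0; rewrite -powRD ?(gt_eqF y0) ?implybT//.
by rewrite (_ : _ + _ = -1) ?powR_inv1 ?ltW// /pexp; field.
Qed.

Lemma pext_bound M f x y : 0 < y -> bdd_mfun M f ->
  `|pext s f (x, y)| <= M * fine (radial_mass (pexp s)).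
Proof.
move=> y0 bf.
have -> : M * fine (radial_mass (pexp s)) = y `^ (2 * s) * M *
    (y `^ (1 - 2 * pexp s) * fine (radial_mass (pexp s))).
  transitivity (y `^ (2 * s) * y `^ (1 - 2 * pexp s) * (M * fine (radial_mass (pexp s)))).
    by rewrite powR_weight0// mul1r.
  by ring.
apply: (Rintegral_kernel_bound y0 pgt _ _ bf (x := x)).
  exact: measurable_pker.
by move=> t; rewrite ger0_norm// mulr_ge0 ?powR_ge0.
Qed.

Lemma pextx_bound M f x y : 0 < y -> bdd_mfun M f ->
  `|pextx s f (x, y)| <= 3 * M * fine (radial_mass (pexp s)) / y.
Proof.
move=> y0 bf.
have -> : 3 * M * fine (radial_mass (pexp s)) / y = 3 * y `^ (2 * s - 1) * M *
    (y `^ (1 - 2 * pexp s) * fine (radial_mass (pexp s))).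
  by rewrite -(powR_weight1 y0); ring.
apply: (Rintegral_kernel_bound y0 pgt _ _ bf (x := x)).
  exact: measurable_pkerx.
by move=> t; rewrite -grad_weightE; exact: pkerx_le.
Qed.

Lemma pexty_bound M f x y : 0 < y -> bdd_mfun M f ->
  `|pexty s f (x, y)| <= 3 * M * fine (radial_mass (pexp s)) / y.
Proof.
move=> y0 bf.
have -> : 3 * M * fine (radial_mass (pexp s)) / y = 3 * y `^ (2 * s - 1) * M *
    (y `^ (1 - 2 * pexp s) * fine (radial_mass (pexp s))).
  by rewrite -(powR_weight1 y0); ring.
apply: (Rintegral_kernel_bound y0 pgt _ _ bf (x := x)).
  exact: measurable_pkery.
by move=> t; rewrite -grad_weightE; exact: pkery_le.
Qed.

Lemma pext_cvg0 M f_ x y : 0 < y -> (forall n, bdd_mfun M (f_ n)) ->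
  (forall t, f_ n t @[n --> \oo] --> 0) -> pext s (f_ n) (x, y) @[n --> \oo] --> 0.
Proof.
move=> y0 bf f0.
apply: (Rintegral_kernel_cvg0 y0 pgt _ _ bf f0 (x := x) (c := y `^ (2 * s))).
  exact: measurable_pker.
by move=> t; rewrite ger0_norm// mulr_ge0 ?powR_ge0.
Qed.

Lemma pextx_cvg0 M f_ x y : 0 < y -> (forall n, bdd_mfun M (f_ n)) ->
  (forall t, f_ n t @[n --> \oo] --> 0) -> pextx s (f_ n) (x, y) @[n --> \oo] --> 0.
Proof.
move=> y0 bf f0.
apply: (Rintegral_kernel_cvg0 y0 pgt _ _ bf f0 (x := x) (c := 3 * y `^ (2 * s - 1))).
  exact: measurable_pkerx.
by move=> t; rewrite -grad_weightE; exact: pkerx_le.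
Qed.

Lemma pexty_cvg0 M f_ x y : 0 < y -> (forall n, bdd_mfun M (f_ n)) ->
  (forall t, f_ n t @[n --> \oo] --> 0) -> pexty s (f_ n) (x, y) @[n --> \oo] --> 0.
Proof.
move=> y0 bf f0.
apply: (Rintegral_kernel_cvg0 y0 pgt _ _ bf f0 (x := x) (c := 3 * y `^ (2 * s - 1))).
  exact: measurable_pkery.
by move=> t; rewrite -grad_weightE; exact: pkery_le.
Qed.

End fixed_order.

Definition wsqr (s : R) (g : R * R -> R) (p : R * R) : R := p.2 `^ (1 - 2 * s) * g p ^+ 2.

Lemma measurable_wsqr s g : measurable_fun setT g ->
  measurable_fun setT (fun p => (wsqr s g p)%:E).
Proof.
move=> mg; apply/measurable_EFinP; apply: measurable_funM; last exact: measurable_funX.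
exact: measurable_powR_comp.
Qed.

Lemma wsqr_ge0 s g p : 0 <= wsqr s g p.
Proof. by rewrite mulr_ge0 ?powR_ge0 ?sqr_ge0. Qed.

Definition in_box (K : R) (O : set (R * R)) :=
  forall p, O p -> `|p.1| <= K /\ 0 < p.2 <= K.

Lemma integrable_cst_box (K c : R) (O : set (R * R)) : measurable O -> in_box K O ->
  leb2.-integrable O (EFin \o cst c).
Proof.
move=> mO bO; have mB : measurable (`[- K, K]%classic `*` `[- K, K]%classic : set (R * R)).
  exact: measurableX.
apply: (@integrableS _ _ _ leb2 _ _ _ mB mO).
  move=> p /bO[]; rewrite ler_norml /= !in_itv/= => -> /andP[h1 h2].
  by rewrite h2 andbT; split => //; lra.
apply/integrableP; split; first by apply/measurable_EFinP; apply: measurable_cst.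
under eq_integral do rewrite /=.
rewrite integral_cst//= lte_mul_pinfty// /leb2 /= product_measure1E//=.
by rewrite !lebesgue_measure_itv/=; case: ifP => _; rewrite ?mule0 ?ltry// -EFinB -EFinM ltry.
Qed.

Section bounded_pieces.
Variables (s : R) (hs : 0 < s < 1 / 2) (K : R) (O : set (R * R)).
Hypotheses (mO : measurable O) (bO : in_box K O).

(** The exponent 1 - 2s is positive, so the weight is largest at the top of the box and harmless
    near the real line. *)
Lemma wsqr_le (g : R * R -> R) B p : O p -> `|g p| <= B -> wsqr s g p <= K `^ (1 - 2 * s) * B ^+ 2.
Proof.
have /andP[s0 s1] := hs.
move=> Op gB; have [_ /andP[p0 pK]] := bO Op; apply: ler_pM; rewrite ?powR_ge0 ?sqr_ge0//.
  by apply: ge0_ler_powR; rewrite ?nnegrE; lra.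
by rewrite -[leLHS]real_normK ?num_real// ler_sqr ?nnegrE// (le_trans _ gB).
Qed.

Lemma wsqr_integral_lty (g : R * R -> R) B : measurable_fun setT g ->
  (forall p, O p -> `|g p| <= B) ->
  (\int[(leb \x leb)%E]_(p in O) (wsqr s g p)%:E < +oo)%E.
Proof.
move=> mg gB.
have /integrableP[_] := integrable_cst_box (K `^ (1 - 2 * s) * B ^+ 2) mO bO.
apply: le_lt_trans; apply: ge0_le_integral => //.
- by move=> p _; rewrite lee_fin wsqr_ge0.
- by apply: measurable_funTS; exact: measurable_wsqr.
- apply: measurableT_comp; first exact: abse_measurable.
  by apply/measurable_EFinP; apply: measurable_cst.
- by move=> p Op /=; rewrite lee_fin (le_trans _ (ler_norm _))// wsqr_le// gB.
Qed.

Lemma wsqr_integral_cvg0 (g_ : nat -> R * R -> R) B : (forall n, measurable_fun setT (g_ n)) ->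
  (forall n p, O p -> `|g_ n p| <= B) -> (forall p, O p -> g_ n p @[n --> \oo] --> 0) ->
  (\int[(leb \x leb)%E]_(p in O) (wsqr s (g_ n) p)%:E @[n --> \oo] --> 0)%E.
Proof.
move=> mg gB g0.
apply: (@dominated_cvg0 _ _ leb2 O _ (cst (K `^ (1 - 2 * s) * B ^+ 2)) mO _
  (integrable_cst_box _ mO bO)).
- by move=> n; apply/measurable_EFinP; apply: measurable_funTS; exact: measurable_wsqr.
- by move=> n p Op; rewrite ger0_norm ?wsqr_ge0//= wsqr_le// gB.
- move=> p Op; rewrite /wsqr -(mulr0 (p.2 `^ (1 - 2 * s))); apply: cvgM; first exact: cvg_cst.
  by have := cvgM (g0 p Op) (g0 p Op); rewrite mulr0; apply.
Qed.

End bounded_pieces.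

End ScalarEnergy.

(** * Domains lying over an interval, and vector-valued extensions *)

Section VectorEnergy.
Set Implicit Arguments.
Unset Strict Implicit.
Variable R : realType.
Notation leb := (@lebesgue_measure R).

Lemma ball_prodE (p q : R * R) (e : R) :
  ball p e q <-> `|p.1 - q.1| < e /\ `|p.2 - q.2| < e.
Proof. by split; rewrite /ball/= /prod_ball/= /ball/=. Qed.

(** The product sigma-algebra is generated by rectangles, while openness refers to the product
    topology; countably many rational rectangles connect the two. *)
Lemma open_prod_measurable (O : set (R * R)) : open O -> measurable O.
Proof.
move=> oO.
pose rect (c : (rat * rat) * (rat * rat)) : set (R * R) :=
  `]ratr c.1.1, ratr c.1.2[%classic `*` `]ratr c.2.1, ratr c.2.2[%classic.
have mrect c : measurable (rect c) by exact: measurableX.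
have -> : O = \bigcup_c (if `[< rect c `<=` O >] then rect c else set0).
  apply/seteqP; split => p.
    move=> Op; have /nbhs_ballP[e /= e0 eO] := open_nbhs_nbhs (conj oO Op).
    have lt1 (x : R) : x - e < x by lra.
    have lt2 (x : R) : x < x + e by lra.
    have [a1 /itvP ha1] := rat_in_itvoo (lt1 p.1).
    have [b1 /itvP hb1] := rat_in_itvoo (lt2 p.1).
    have [a2 /itvP ha2] := rat_in_itvoo (lt1 p.2).
    have [b2 /itvP hb2] := rat_in_itvoo (lt2 p.2).
    exists ((a1, b1), (a2, b2)) => //; rewrite ifT.
      by rewrite /rect/= !in_itv/= ha1 hb1 ha2 hb2.
    apply/asboolP => q /=; rewrite /rect/= !in_itv/= => -[/andP[h1 h2] /andP[h3 h4]].
    have := ha1; have := hb1; have := ha2; have := hb2.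
    move=> k1 k2 k3 k4; apply: eO; apply/ball_prodE; rewrite !ltr_norml.
    have u1 : p.1 - e < ratr a1 by rewrite k4.
    have u2 : ratr b1 < p.1 + e by rewrite k3.
    have u3 : p.2 - e < ratr a2 by rewrite k2.
    have u4 : ratr b2 < p.2 + e by rewrite k1.
    by split; apply/andP; split; lra.
  by move=> [c _]; case: asboolP => // cO; exact: cO.
apply: countable_bigcupT_measurable; first exact: countableP.
by move=> c; case: ifP => _.
Qed.

Definition above (e : R) : set (R * R) := [set p | e <= p.2].

Lemma measurable_above e : measurable (above e).
Proof.
have := @measurable_snd _ _ R R measurableT _ (measurable_itv `[e, +oo[).
by rewrite setTI; congr measurable; apply/seteqP; split => p /=; rewrite in_itv/= andbT.
Qed.

Lemma cvg_eq_lim (F : nat -> \bar R) (l l' : \bar R) : l = l' ->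
  F @ \oo --> l -> F @ \oo --> l'.
Proof. by move=> ->. Qed.

Lemma ge0_integral_strip (O : set (R * R)) (I : set R) (e : R) (F : R * R -> R) :
  measurable O -> measurable I -> measurable_fun setT F -> (forall p, 0 <= F p) ->
  (forall p, O p -> 0 < p.2) -> (forall p, O p -> p.2 < e -> I p.1) ->
  (\int[(leb \x leb)%E]_(p in O) (F p)%:E <=
   \int[(leb \x leb)%E]_(p in I `*` `]0%R, +oo[) (F p)%:E +
   \int[(leb \x leb)%E]_(p in O `&` above e) (F p)%:E)%E.
Proof.
move=> mO mI mF F0 Op OI.
have mE := measurable_above e.
have mFE D : measurable_fun D (fun p => (F p)%:E).
  by apply: measurable_funTS; exact/measurable_EFinP.
have {1}-> : O = (O `\` above e) `|` (O `&` above e).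
  by rewrite setUC setUIDK.
have mD1 : measurable (O `\` above e) by exact: measurableD.
have mI1 : measurable (O `&` above e) by exact: measurableI.
have dj : [disjoint O `\` above e & O `&` above e].
  by rewrite disj_set2E; apply/eqP; rewrite -subset0 => p /= [[_ h] [_ h2]].
rewrite ge0_integral_setU;
  [|exact: mD1|exact: mI1|exact: mFE|by move=> p _; rewrite lee_fin|exact: dj].
apply: leeD => //; apply: ge0_subset_integral => //.
- exact: measurableX.
- exact: mFE.
- by move=> p _; rewrite lee_fin.
- move=> p [Opp] /= /negP; rewrite -ltNge => pe; split; first exact: OI.
  by rewrite /= in_itv/= andbT Op.
Qed.

(** What [pextx] and [pexty] have in common: a crude bound used away from the real line and a sharp
    one used near it. Finiteness and convergence are then proved once for both derivatives. *)
Definition gradient_like (s B : R) (f : R -> R) (g : R * R -> R) :=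
  [/\ measurable_fun setT g,
      (forall x y, 0 < y -> `|g (x, y)| <= B / y) &
      (forall x y, 0 < y -> ((y `^ (1 - 2 * s) * g (x, y) ^+ 2)%:E <=
     (grad_const s)%:E * \int[leb]_t (diff_weight s f x y t)%:E)%E)].

Lemma gradient_like_pextx (s : R) (hs : 0 < s < 1 / 2) M f : bdd_mfun M f ->
  gradient_like s (3 * M * fine (radial_mass (pexp s))) f (pextx s f).
Proof.
move=> bf; have [mf _] := bf; split; first exact: measurable_pextx.
- by move=> x y y0; exact: pextx_bound.
- move=> x y y0; apply: (grad_sq_bound hs y0 bf).
  + exact: measurable_pkerx.
  + by move=> t; exact: pkerx_le.
  + exact: Rintegral_pkerx.
Qed.

Lemma gradient_like_pexty (s : R) (hs : 0 < s < 1 / 2) M f : bdd_mfun M f ->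
  gradient_like s (3 * M * fine (radial_mass (pexp s))) f (pexty s f).
Proof.
move=> bf; have [mf _] := bf; split; first exact: measurable_pexty.
- by move=> x y y0; exact: pexty_bound.
- move=> x y y0; apply: (grad_sq_bound hs y0 bf).
  + exact: measurable_pkery.
  + by move=> t; exact: pkery_le.
  + exact: Rintegral_pkery.
Qed.

(** The geometry that the estimates take from an admissible domain: boundedness, and that everything
    below height [e] lies over [I]. *)
Definition strip_domain (K e : R) (I : set R) (O : set (R * R)) :=
  [/\ measurable O, measurable I, in_box K O, 0 < e &
      forall p, O p -> p.2 < e -> I p.1].

Lemma strip_domain_top K e I O : strip_domain K e I O ->
  measurable (O `&` above e) /\ in_box K (O `&` above e).
Proof.
move=> [mO mI bO e0 OI]; split; last by move=> p [/bO].
by apply: measurableI => //; exact: measurable_above.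
Qed.

Lemma gradient_like_top (s : R) B f g K e I O : gradient_like s B f g -> 0 <= B ->
  strip_domain K e I O ->
  forall p, (O `&` above e) p -> `|g p| <= B / e.
Proof.
move=> [_ gB _] B0 [_ _ bO e0 _] [x y] [/bO[_ /andP[/= y0 _]]] /= ey.
apply: le_trans (gB _ _ y0) _; apply: ler_wpM2l => //.
by rewrite lef_pV2.
Qed.

Lemma gradient_like_le (s : R) (hs : 0 < s < 1 / 2) B f g K e I O :
  measurable_fun setT f -> gradient_like s B f g ->
  strip_domain K e I O ->
  (\int[(leb \x leb)%E]_(p in O) (wsqr s g p)%:E <=
   (grad_const s * vert_const s)%:E *
     \int[(leb \x leb)%E]_(z in I `*` setT) gagliardo s f z +
   \int[(leb \x leb)%E]_(p in O `&` above e) (wsqr s g p)%:E)%E.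
Proof.
move=> mf [mg gB gE] [mO mI bO e0 OI].
apply: (le_trans (ge0_integral_strip mO mI _ _ _ OI)).
- by apply/measurable_EFinP; exact: measurable_wsqr.
- by move=> p; exact: wsqr_ge0.
- by move=> p /bO[_ /andP[]].
by apply: leeD => //; exact: (grad_energy_bound hs mI mf mg gE).
Qed.

Lemma gradient_like_lty (s : R) (hs : 0 < s < 1 / 2) B f g K e I O :
  measurable_fun setT f -> gradient_like s B f g -> 0 <= B ->
  strip_domain K e I O ->
  (\int[(leb \x leb)%E]_(z in I `*` setT) gagliardo s f z < +oo)%E ->
  (\int[(leb \x leb)%E]_(p in O) (wsqr s g p)%:E < +oo)%E.
Proof.
move=> mf gg B0 sO fin; have [mT bT] := strip_domain_top sO.
apply: (le_lt_trans (gradient_like_le hs mf gg sO)).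
apply: lte_add_pinfty.
  have v0 : 0 <= vert_const s.
    by have /andP[s0 _] := hs; rewrite divr_ge0 ?powR_ge0// ltW.
  by apply: lte_mul_pinfty => //; rewrite lee_fin mulr_ge0// grad_const_ge0.
apply: (wsqr_integral_lty hs mT bT (B := B / e)); first by have [] := gg.
exact: (gradient_like_top gg B0 sO).
Qed.

Lemma gradient_like_cvg0 (s : R) (hs : 0 < s < 1 / 2) B f_ g_ K e I O :
  (forall n : nat, measurable_fun setT (f_ n)) ->
  (forall n, gradient_like s B (f_ n) (g_ n)) -> 0 <= B ->
  strip_domain K e I O ->
  (forall x y, 0 < y -> g_ n (x, y) @[n --> \oo] --> 0) ->
  (\int[(leb \x leb)%E]_(z in I `*` setT) gagliardo s (f_ n) z @[n --> \oo] --> 0)%E ->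
  (\int[(leb \x leb)%E]_(p in O) (wsqr s (g_ n) p)%:E @[n --> \oo] --> 0)%E.
Proof.
move=> mf gg B0 sO g0 fc; have [mT bT] := strip_domain_top sO.
apply: (@squeeze_cvge _ _ _ _ (cst 0%E) _ (fun n => (grad_const s * vert_const s)%:E *
     \int[(leb \x leb)%E]_(z in I `*` setT) gagliardo s (f_ n) z +
   \int[(leb \x leb)%E]_(p in O `&` above e) (wsqr s (g_ n) p)%:E)%E).
- apply: nearW => n; apply/andP; split.
    by apply: integral_ge0 => p _; rewrite lee_fin wsqr_ge0.
  exact: (gradient_like_le hs (mf n) (gg n) sO).
- exact: cvg_cst.
- have l0 : ((grad_const s * vert_const s)%:E * 0 + 0 = 0)%E by rewrite mule0 adde0.
  apply: (cvg_eq_lim l0); apply: cvgeD; [by rewrite mule0|by apply: cvgeZl|].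
  apply: (wsqr_integral_cvg0 hs mT bT (B := B / e)).
  + by move=> n; have [] := gg n.
  + by move=> n; exact: (gradient_like_top (gg n) B0 sO).
  + have [_ _ bO _ _] := sO.
    by move=> [x y] [/bO[_ /andP[/= y0 _]]] _; exact: g0.
Qed.

Definition vcomp (d : nat) (u : R -> 'rV[R]_d) (i : 'I_d) : R -> R := fun t => u t ord0 i.

Lemma extE s d (u : R -> 'rV[R]_d) p i :
  ext s u p ord0 i = sigma_s s * pext s (vcomp u i) p.
Proof.
rewrite mxE; congr (_ * _); apply: eq_Rintegral => t _.
by rewrite /pker /vcomp powRN /rho /pexp mulrAC.
Qed.

Definition bdd_vec (M : R) d (u : R -> 'rV[R]_d) := forall i, bdd_mfun M (vcomp u i).

Lemma dx_extE (s : R) (hs : 0 < s < 1 / 2) M d (u : R -> 'rV[R]_d) p : 0 < p.2 ->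
  bdd_vec M u -> dx (ext s u) p = \row_i (sigma_s s * pextx s (vcomp u i) p).
Proof.
case: p => x y /= y0 bu.
have D i j : is_derive x 1 (fun x => ext s u (x, y) i j) (sigma_s s * pextx s (vcomp u j) (x, y)).
  have d1 := pext_is_derivex hs x y0 (bu j).
  have d2 := is_deriveZ (sigma_s s) d1.
  rewrite (_ : (fun x => _) = (sigma_s s *: (fun x => pext s (vcomp u j) (x, y))))//.
  by apply/funext => z; rewrite (ord1 i) extE.
have dM : derivable (fun x => ext s u (x, y)) x 1.
  by apply/derivable_mxP => i j; have [] := D i j.
rewrite /dx/= derive1E derive_mx//; apply/rowP => j; rewrite !mxE.
by have dj := D ord0 j; exact: derive_val.
Qed.

Lemma dy_extE (s : R) (hs : 0 < s < 1 / 2) M d (u : R -> 'rV[R]_d) p : 0 < p.2 ->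
  bdd_vec M u -> dy (ext s u) p = \row_i (sigma_s s * pexty s (vcomp u i) p).
Proof.
case: p => x y /= y0 bu.
have D i j : is_derive y 1 (fun y => ext s u (x, y) i j) (sigma_s s * pexty s (vcomp u j) (x, y)).
  have d1 := pext_is_derivey hs x y0 (bu j).
  have d2 := is_deriveZ (sigma_s s) d1.
  rewrite (_ : (fun y => _) = (sigma_s s *: (fun y => pext s (vcomp u j) (x, y))))//.
  by apply/funext => z; rewrite (ord1 i) extE.
have dM : derivable (fun y => ext s u (x, y)) y 1.
  by apply/derivable_mxP => i j; have [] := D i j.
rewrite /dy/= derive1E derive_mx//; apply/rowP => j; rewrite !mxE.
by have dj := D ord0 j; exact: derive_val.
Qed.

Lemma H1a_ext (s : R) (hs : 0 < s < 1 / 2) M d (u : R -> 'rV[R]_d) (O : set (R * R)) :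
  measurable O -> O `<=` @upper R -> bdd_vec M u ->
  H1a_sqnorm (1 - 2 * s) O (ext s u) =
  (\sum_(i < d) (sigma_s s ^+ 2)%:E *
    (\int[(leb \x leb)%E]_(p in O) (wsqr s (pext s (vcomp u i)) p)%:E +
     \int[(leb \x leb)%E]_(p in O) (wsqr s (pextx s (vcomp u i)) p)%:E +
     \int[(leb \x leb)%E]_(p in O) (wsqr s (pexty s (vcomp u i)) p)%:E))%E.
Proof.
move=> mO Ou bu; rewrite /H1a_sqnorm.
have mw g : measurable_fun setT g -> measurable_fun O (fun p => (wsqr s g p)%:E).
  by move=> mg; apply: measurable_funTS; exact: measurable_wsqr.
have w0 g p : (0 <= (wsqr s g p)%:E)%E by rewrite lee_fin wsqr_ge0.
have mu i : measurable_fun setT (vcomp u i) by have [] := bu i.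
have m1 i := mw _ (measurable_pext s (mu i)).
have m2 i := mw _ (measurable_pextx s (mu i)).
have m3 i := mw _ (measurable_pexty s (mu i)).
transitivity (\int[(leb \x leb)%E]_(p in O) (\sum_(i < d) (sigma_s s ^+ 2)%:E *
    ((wsqr s (pext s (vcomp u i)) p)%:E + (wsqr s (pextx s (vcomp u i)) p)%:E +
     (wsqr s (pexty s (vcomp u i)) p)%:E)))%E.
  apply: eq_integral => p; rewrite inE => Op; have p0 : 0 < p.2 := Ou _ Op.
  rewrite (dx_extE hs p0 bu) (dy_extE hs p0 bu) /sqn -!big_split/= mulr_sumr -sumEFin.
  apply: eq_bigr => i _; rewrite -!EFinD -EFinM; congr EFin.
  by rewrite extE !mxE /wsqr; ring.
rewrite ge0_integral_sum//; last 2 first.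
- by move=> i; apply: measurable_funeM; apply: emeasurable_funD; [apply: emeasurable_funD|];
    [exact: m1|exact: m2|exact: m3].
- by move=> i p _; rewrite mule_ge0 ?lee_fin ?sqr_ge0 ?addr_ge0 ?wsqr_ge0.
apply: eq_bigr => i _; rewrite ge0_integralZl_EFin ?sqr_ge0//; last 2 first.
- by move=> p _; rewrite !adde_ge0.
- by apply: emeasurable_funD; [apply: emeasurable_funD|];
    [exact: m1|exact: m2|exact: m3].
rewrite ge0_integralD; [|exact: mO|by move=> p _; apply: adde_ge0|
  by apply: emeasurable_funD; [exact: m1|exact: m2]|by move=> p _|exact: m3].
by rewrite ge0_integralD; [|exact: mO|move=> p _|exact: m1|move=> p _|exact: m2].
Qed.

Lemma gagliardo_comp_le s d (u : R -> 'rV[R]_d) i z : (gagliardo s (vcomp u i) z <= Es_kernel s u z)%E.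
Proof.
rewrite lee_fin ler_wpM2r ?invr_ge0 ?powR_ge0// /sqn /vcomp (bigD1 i)//= !mxE.
by rewrite lerDl sumr_ge0// => j _; exact: sqr_ge0.
Qed.

Lemma Es_kernel_ge0 s d (u : R -> 'rV[R]_d) z : (0 <= Es_kernel s u z)%E.
Proof.
by rewrite lee_fin divr_ge0 ?powR_ge0// sumr_ge0// => i _; exact: sqr_ge0.
Qed.

Lemma measurable_Es_kernel s d (u : R -> 'rV[R]_d) :
  (forall i, measurable_fun setT (vcomp u i)) -> measurable_fun setT (Es_kernel s u).
Proof.
move=> mu; apply/measurable_EFinP; apply: measurable_funM.
  rewrite (_ : (fun z => _) = (fun z : R * R => \sum_(i < d) (vcomp u i z.1 - vcomp u i z.2) ^+ 2)).
    apply: measurable_sum => i; apply: measurable_funX; apply: measurable_funB.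
      exact: measurableT_comp.
    exact: measurableT_comp.
  by apply/funext => z; apply: eq_bigr => i _; rewrite !mxE.
rewrite (_ : (fun z => _) = (fun z : R * R => `|z.1 - z.2| `^ (- (1 + 2 * s)))); last first.
  by apply/funext => z; rewrite powRN.
by apply: measurable_powR_comp; apply: measurableT_comp => //; exact: measurable_funB.
Qed.

Lemma gagliardo_integral_le s d (u : R -> 'rV[R]_d) i (D : set (R * R)) : measurable D ->
  (forall i, measurable_fun setT (vcomp u i)) ->
  (\int[(leb \x leb)%E]_(z in D) gagliardo s (vcomp u i) z <=
   \int[(leb \x leb)%E]_(z in D) Es_kernel s u z)%E.
Proof.
move=> mD mu; apply: ge0_le_integral => //.
- by move=> z _; exact: gagliardo_ge0.
- by apply: measurable_funTS; exact: measurable_gagliardo.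
- by apply: measurable_funTS; exact: measurable_Es_kernel.
- by move=> z _; exact: gagliardo_comp_le.
Qed.

Lemma ext_H1a_lty (s : R) (hs : 0 < s < 1 / 2) M d (u : R -> 'rV[R]_d) K e I O :
  bdd_vec M u -> 0 <= M -> strip_domain K e I O ->
  (\int[(leb \x leb)%E]_(z in I `*` setT) Es_kernel s u z < +oo)%E ->
  (H1a_sqnorm (1 - 2 * s) O (ext s u) < +oo)%E.
Proof.
move=> bu M0 sO fin; have [mO mI bO e0 OI] := sO.
have mu i : measurable_fun setT (vcomp u i) by have [] := bu i.
have B0 : 0 <= 3 * M * fine (radial_mass (pexp s)) :> R.
  by rewrite !mulr_ge0// fine_ge0// integral_ge0// => t _; rewrite lee_fin powR_ge0.
rewrite (H1a_ext hs mO _ bu); last by move=> p /bO[_ /andP[]].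
apply: lte_sum_pinfty => i _.
have fi : (\int[(leb \x leb)%E]_(z in I `*` setT) gagliardo s (vcomp u i) z < +oo)%E.
  by apply: le_lt_trans fin; apply: gagliardo_integral_le => //; exact: measurableX.
apply: lte_mul_pinfty; rewrite ?lee_fin ?sqr_ge0//.
apply: lte_add_pinfty; first apply: lte_add_pinfty.
- apply: (wsqr_integral_lty hs mO bO (B := M * fine (radial_mass (pexp s)))).
    exact: measurable_pext.
  by move=> [x y] /bO[_ /andP[/= y0 _]]; exact: pext_bound.
- exact: (gradient_like_lty hs (mu i) (gradient_like_pextx hs (bu i)) B0 sO fi).
- exact: (gradient_like_lty hs (mu i) (gradient_like_pexty hs (bu i)) B0 sO fi).
Qed.

(** The zero-order term is bounded down to the real line, so dominated convergence treats it on all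
    of [O]; only the gradient terms are split at height [e]. *)
Lemma ext_H1a_cvg0 (s : R) (hs : 0 < s < 1 / 2) M d (w_ : nat -> R -> 'rV[R]_d) K e I O :
  (forall n, bdd_vec M (w_ n)) -> 0 <= M -> strip_domain K e I O ->
  (forall i t, vcomp (w_ n) i t @[n --> \oo] --> 0) ->
  (\int[(leb \x leb)%E]_(z in I `*` setT) Es_kernel s (w_ n) z @[n --> \oo] --> 0)%E ->
  (H1a_sqnorm (1 - 2 * s) O (ext s (w_ n)) @[n --> \oo] --> 0)%E.
Proof.
move=> bw M0 sO w0 fc; have [mO mI bO e0 OI] := sO.
have mw n i : measurable_fun setT (vcomp (w_ n) i) by have [] := bw n i.
have B0 : 0 <= 3 * M * fine (radial_mass (pexp s)) :> R.
  by rewrite !mulr_ge0// fine_ge0// integral_ge0// => t _; rewrite lee_fin powR_ge0.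
under eq_fun => n.
  rewrite (H1a_ext hs mO _ (bw n)); last by move=> p /bO[_ /andP[]].
  over.
have ci i : (\int[(leb \x leb)%E]_(z in I `*` setT) gagliardo s (vcomp (w_ n) i) z @[n --> \oo] --> 0)%E.
  apply: (@squeeze_cvge _ _ _ _ (cst 0%E) _ _ _ _ _ fc); last exact: cvg_cst.
  apply: nearW => n; apply/andP; split; first by apply: integral_ge0 => z _; exact: gagliardo_ge0.
  by apply: gagliardo_integral_le => //; exact: measurableX.
have l0 : (\sum_(i < d) ((sigma_s s ^+ 2)%:E * (0 + 0 + 0)) = 0)%E.
  by rewrite !adde0 mule0 big1.
apply: (cvg_eq_lim l0).
apply: cvg_nnesum.
  move=> i _; apply: nearW => n; rewrite mule_ge0 ?lee_fin ?sqr_ge0//.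
  by apply: adde_ge0; [apply: adde_ge0|]; apply: integral_ge0 => p _; rewrite lee_fin wsqr_ge0.
move=> i _; apply: cvgeZl => //; apply: cvgeD; [by rewrite ?adde0| |].
  apply: cvgeD; [by rewrite ?adde0| |].
    apply: (wsqr_integral_cvg0 hs mO bO (B := M * fine (radial_mass (pexp s)))).
    - by move=> n; exact: measurable_pext.
    - by move=> n [x y] /bO[_ /andP[/= y0 _]]; exact: (pext_bound hs x y0 (bw n i)).
    - by move=> [x y] /bO[_ /andP[/= y0 _]]; apply: (pext_cvg0 hs _ y0 (fun n => bw n i)).
  apply: (gradient_like_cvg0 hs (fun n => mw n i) (fun n => gradient_like_pextx hs (bw n i)) B0 sO).
    by move=> x y y0; apply: (pextx_cvg0 hs _ y0 (fun n => bw n i)).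
  exact: ci.
apply: (gradient_like_cvg0 hs (fun n => mw n i) (fun n => gradient_like_pexty hs (bw n i)) B0 sO).
  by move=> x y y0; apply: (pexty_cvg0 hs _ y0 (fun n => bw n i)).
exact: ci.
Qed.

(** Serves to apply [ext_sub], which is stated at positive heights. Horizontal lines stay in the
    half-plane; for the vertical derivative, agreement at nearby heights is enough. *)
Lemma H1a_congr (a : R) d (v w : R * R -> 'rV[R]_d) (O : set (R * R)) :
  O `<=` @upper R -> (forall p, @upper R p -> v p = w p) ->
  H1a_sqnorm a O v = H1a_sqnorm a O w.
Proof.
move=> Ou vw; apply: eq_integral => p; rewrite inE => Op; have p0 : 0 < p.2 := Ou _ Op.
have -> : dx v p = dx w p.
  have e : (fun x => v (x, p.2)) = (fun x => w (x, p.2)) by apply/funext => x; exact: vw.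
  by rewrite /dx e.
have -> : dy v p = dy w p.
  rewrite /dy !derive1E; apply: near_eq_derive.
  by near=> y; apply: vw; rewrite /upper/=; near: y; exact: lt_nbhsr.
by rewrite vw.
Unshelve. all: by end_near.
Qed.

Lemma ext_sub (s : R) (hs : 0 < s < 1 / 2) M d (u v : R -> 'rV[R]_d) p : 0 < p.2 ->
  bdd_vec M u -> bdd_vec M v -> ext s u p - ext s v p = ext s (fun t => u t - v t) p.
Proof.
case: p => x y /= y0 bu bv; apply/rowP => i; rewrite mxE [in X in _ + X]mxE !extE -mulrBr.
congr (_ * _); rewrite /pext -RintegralB//.
- by apply: eq_Rintegral => t _; rewrite /vcomp !mxE mulrBr.
- exact: (integrable_pker hs x y0 (bu i)).
- exact: (integrable_pker hs x y0 (bv i)).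
Qed.

End VectorEnergy.

(** * Strong convergence of minimizers *)

Section EnergyConvergence.
Set Implicit Arguments.
Unset Strict Implicit.
Variable R : realType.
Notation leb := (@lebesgue_measure R).

Lemma near_lt_limn_einf (x : nat -> \bar R) (l : \bar R) :
  (l < limn_einf x)%E -> \forall n \near \oo, (l < x n)%E.
Proof.
rewrite limn_einf_lim (cvg_lim _ (@cvg_einfs_sup R x))// => /ereal_sup_gt[_ [n _ <-] ln].
exists n => // m /= nm; apply: lt_le_trans ln _.
by apply: ereal_inf_lbound; exists m.
Qed.

(* Fatou applied to [2 p_n + 2 p - w_n]: convergence of the energies upgrades
   pointwise convergence to strong convergence. *)
Lemma energy_cvg0 d (T : measurableType d) (mu : {measure set T -> \bar R}) (D : set T)
    (p_ w_ : nat -> T -> R) (p : T -> R) (P_ e_ : nat -> R) (P : R) :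
  measurable D -> (forall n, measurable_fun D (p_ n)) -> (forall n, measurable_fun D (w_ n)) ->
  measurable_fun D p ->
  (forall n x, D x -> 0 <= w_ n x <= 2 * p_ n x + 2 * p x) ->
  (forall n x, D x -> 0 <= p_ n x) -> (forall x, D x -> 0 <= p x) ->
  (forall x, D x -> p_ n x @[n --> \oo] --> p x) ->
  (forall x, D x -> w_ n x @[n --> \oo] --> 0) ->
  (\int[mu]_(x in D) (p x)%:E = P%:E)%E ->
  (forall n, \int[mu]_(x in D) (p_ n x)%:E = (P_ n)%:E)%E ->
  (forall n, P_ n <= P + e_ n) -> e_ n @[n --> \oo] --> 0 ->
  (\int[mu]_(x in D) (w_ n x)%:E @[n --> \oo] --> 0)%E.
Proof.
move=> mD mp_ mw_ mp wp p_0 p0 cp cw iP iP_ Pe e0.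
pose h n x := 2 * p_ n x + 2 * p x - w_ n x.
have mu_ n : measurable_fun D (fun x => 2 * p_ n x + 2 * p x).
  by apply: measurable_funD; apply: measurable_funM.
have np_ n x : D x -> (0 <= (p_ n x)%:E)%E by move=> Dx; rewrite lee_fin p_0.
have np x : D x -> (0 <= (p x)%:E)%E by move=> Dx; rewrite lee_fin p0.
have mEp_ n : measurable_fun D (fun x => (p_ n x)%:E) by exact/measurable_EFinP.
have mEp : measurable_fun D (fun x => (p x)%:E) by exact/measurable_EFinP.
have iu n : (\int[mu]_(x in D) (2 * p_ n x + 2 * p x)%:E = (2 * P_ n + 2 * P)%:E)%E.
  under eq_integral do rewrite EFinD !EFinM.
  rewrite ge0_integralD//.
  - by rewrite (@ge0_integralZl_EFin _ _ _ mu _ mD _ (np_ n))// iP_ (@ge0_integralZl_EFin _ _ _ mu _ mD _ np)// iP.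
  - by move=> x Dx; apply: mule_ge0 => //; exact: np_.
  - by apply: measurable_funeM.
  - by move=> x Dx; apply: mule_ge0 => //; exact: np.
  - by apply: measurable_funeM.
have W0 n : (0 <= \int[mu]_(x in D) (w_ n x)%:E)%E.
  by apply: integral_ge0 => x Dx; rewrite lee_fin; have /andP[] := wp n x Dx.
have Wfin n : (\int[mu]_(x in D) (w_ n x)%:E)%E \is a fin_num.
  rewrite ge0_fin_numE//; apply: (@le_lt_trans _ _ (2 * P_ n + 2 * P)%:E); last exact: ltry.
  rewrite -iu; apply: ge0_le_integral => //.
  - by move=> x Dx; rewrite lee_fin; have /andP[] := wp n x Dx.
  - exact/measurable_EFinP.
  - exact/measurable_EFinP.
  - by move=> x Dx; rewrite lee_fin; have /andP[] := wp n x Dx.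
pose W n := fine (\int[mu]_(x in D) (w_ n x)%:E)%E.
have WE n : (\int[mu]_(x in D) (w_ n x)%:E = (W n)%:E)%E by rewrite /W fineK.
have h0 n x : D x -> 0 <= h n x.
  by move=> Dx; rewrite /h; have /andP[] := wp n x Dx; lra.
have mh n : measurable_fun D (h n) by exact: measurable_funB.
have ih n : (\int[mu]_(x in D) (h n x)%:E = (2 * P_ n + 2 * P - W n)%:E)%E.
  have H : (\int[mu]_(x in D) (h n x)%:E + (W n)%:E = (2 * P_ n + 2 * P)%:E)%E.
    rewrite -WE -ge0_integralD//.
    - by rewrite -iu; apply: eq_integral => x _; rewrite -EFinD /h subrK.
    - by move=> x Dx; rewrite lee_fin h0.
    - exact/measurable_EFinP.
    - by move=> x Dx; rewrite lee_fin; have /andP[] := wp n x Dx.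
    - exact/measurable_EFinP.
  by rewrite EFinB -H addeK.
have i4 : (\int[mu]_(x in D) limn_einf (fun n => (h n x)%:E) = (4 * P)%:E)%E.
  rewrite EFinM -iP -ge0_integralZl_EFin//.
  apply: eq_integral => x; rewrite inE => Dx.
  rewrite -EFinM (_ : 4 * p x = 2 * p x + 2 * p x - 0); last by lra.
  have C : ((h n x)%:E @[n --> \oo] --> (2 * p x + 2 * p x - 0)%:E)%E.
    apply: cvg_EFin; first exact: nearW.
    apply: cvgB; last exact: cw.
    apply: cvgD; last exact: cvg_cst.
    by apply: cvgM; [exact: cvg_cst|exact: cp].
  by have [-> _] := cvg_limn_einf_sup C.
have F : ((4 * P)%:E <= limn_einf (fun n => (2 * P_ n + 2 * P - W n)%:E))%E.
  have -> : (fun n => (2 * P_ n + 2 * P - W n)%:E) = (fun n => \int[mu]_(x in D) (h n x)%:E)%E.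
    by apply/funext => n; rewrite ih.
  rewrite -i4; apply: fatou => //.
  by move=> n; exact/measurable_EFinP.
under eq_fun do rewrite WE.
apply: cvg_EFin; first exact: nearW.
have W00 n : 0 <= W n by rewrite /W fine_ge0.
apply/cvgrPdist_lt => dl dl0.
(* Since [P_ n <= P + e_ n] enters with factor 2, a tolerance of dl / 4 on [e_ n] costs dl / 2; with
   the dl / 2 lost here, [W n < dl]. *)
have : ((4 * P - dl / 2)%:E < limn_einf (fun n => (2 * P_ n + 2 * P - W n)%:E))%E.
  by apply: lt_le_trans F; rewrite lte_fin; lra.
move=> /near_lt_limn_einf N1.
have N2 : \forall n \near \oo, `|0 - e_ n| < dl / 4.
  by move/cvgrPdist_lt : e0; apply; lra.
near=> n; rewrite /= sub0r normrN ger0_norm//.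
have : ((4 * P - dl / 2)%:E < (2 * P_ n + 2 * P - W n)%:E)%E by near: n.
rewrite lte_fin => h1; have h2 : `|0 - e_ n| < dl / 4 by near: n.
move: h2; rewrite sub0r normrN ltr_norml => /andP[_ h2].
by have := Pe n; rewrite /=; lra.
Unshelve. all: by end_near.
Qed.

Lemma ge0_integral_prod_symm (X Y : set R) (k : R * R -> \bar R) :
  measurable X -> measurable Y -> measurable_fun setT k -> (forall z, (0 <= k z)%E) ->
  (forall x y, k (x, y) = k (y, x)) ->
  (\int[(leb \x leb)%E]_(z in X `*` Y) k z = \int[(leb \x leb)%E]_(z in Y `*` X) k z)%E.
Proof.
move=> mX mY mk k0 ks.
have mr A B : measurable A -> measurable B -> measurable_fun setT (k \_ (A `*` B)).
  move=> mA mB; apply/(measurable_restrictT _ (measurableX mA mB)).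
  exact: measurable_funTS.
rewrite integral_mkcond fubini_tonelli2; last 2 first.
- exact: mr.
- by move=> z; apply: erestrict_ge0.
rewrite [RHS]integral_mkcond fubini_tonelli1; last 2 first.
- exact: mr.
- by move=> z; apply: erestrict_ge0.
apply: eq_integral => y _; apply: eq_integral => x _.
by rewrite !patchE !in_setX/= andbC ks.
Qed.

Definition energy (s : R) d (u : R -> 'rV[R]_d) (D : set (R * R)) : \bar R :=
  (\int[(leb \x leb)%E]_(z in D) Es_kernel s u z)%E.

Definition mcomp d (u : R -> 'rV[R]_d) := forall i, measurable_fun setT (vcomp u i).

Lemma energy_ge0 s d (u : R -> 'rV[R]_d) D : (0 <= energy s u D)%E.
Proof. by apply: integral_ge0 => z _; exact: Es_kernel_ge0. Qed.

Lemma energy_setU s d (u : R -> 'rV[R]_d) (A B : set (R * R)) : mcomp u ->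
  measurable A -> measurable B -> A `&` B = set0 ->
  energy s u (A `|` B) = (energy s u A + energy s u B)%E.
Proof.
move=> mu mA mB AB; rewrite /energy ge0_integral_setU//.
- by apply: measurable_funTS; exact: measurable_Es_kernel.
- by move=> z _; exact: Es_kernel_ge0.
- by rewrite disj_set2E AB.
Qed.

Lemma energy_symm s d (u : R -> 'rV[R]_d) (X Y : set R) : mcomp u ->
  measurable X -> measurable Y -> energy s u (X `*` Y) = energy s u (Y `*` X).
Proof.
move=> mu mX mY; apply: ge0_integral_prod_symm => //.
- exact: measurable_Es_kernel.
- by move=> z; exact: Es_kernel_ge0.
- move=> x y; rewrite /Es_kernel/= distrC; congr (_ / _)%:E.
  by apply: eq_bigr => i _; rewrite !mxE -sqrrN opprB.
Qed.

(* The part of [Es s u om] that only sees the values of [u] outside [I]. *)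
Definition rest_energy (s : R) d (u : R -> 'rV[R]_d) (I om : set R) : \bar R :=
  ((gamma_s s / 2)%:E * energy s u ((om `\` I) `*` (om `\` I)) +
   (gamma_s s)%:E * energy s u ((om `\` I) `*` ~` om))%E.

(** The two mixed blocks carry g / 2 each and merge into one with the full weight g, which then
    joins the exterior term [d1]. Nonnegativity is what allows distributing in the extended
    reals. *)
Lemma split_sum (g : R) (a b c d1 d2 : \bar R) : 0 < g ->
  (0 <= a -> 0 <= b -> 0 <= c -> 0 <= d1 -> 0 <= d2 ->
   (g / 2)%:E * (a + b + (b + c)) + g%:E * (d1 + d2) =
   (g / 2)%:E * a + g%:E * (b + d1) + ((g / 2)%:E * c + g%:E * d2))%E.
Proof.
move=> g0 a0 b0 c0 d10 d20.
rewrite (ge0_muleDr _ (adde_ge0 a0 b0) (adde_ge0 b0 c0)) (ge0_muleDr _ a0 b0).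
rewrite (ge0_muleDr _ b0 c0) (ge0_muleDr _ d10 d20) (ge0_muleDr _ b0 d10).
have -> : (g%:E * b = (g / 2)%:E * b + (g / 2)%:E * b)%E.
  rewrite -ge0_muleDl ?lee_fin ?divr_ge0 ?(ltW g0)//.
  by rewrite -EFinD; congr (_%:E * _)%E; lra.
rewrite -!addeA; congr (_ + (_ + (_ + _)))%E.
by rewrite addeCA.
Qed.

(** The part of the energy that feels the values on [I] is I x I at half weight plus I x (R \ I) at
    full weight, whatever the larger set [om] is. *)
Lemma Es_split s d (u : R -> 'rV[R]_d) (I om : set R) : 0 < gamma_s s -> mcomp u ->
  measurable I -> measurable om -> I `<=` om ->
  Es s u om = ((gamma_s s / 2)%:E * energy s u (I `*` I) +
    (gamma_s s)%:E * energy s u (I `*` ~` I) + rest_energy s u I om)%E.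
Proof.
move=> g0 mu mI mO IO; rewrite /Es -/(energy s u (om `*` om)) -/(energy s u (om `*` ~` om)).
set J := om `\` I.
have mJ : measurable J by exact: measurableD.
have omE : om = I `|` J by rewrite /J setDE setUIr setUv setIT setUC setUidl.
have IJ : I `&` J = set0 by rewrite /J setDE setICA setICr setI0.
have mX A B : measurable A -> measurable B -> measurable (A `*` B : set (R * R)).
  by move=> *; exact: measurableX.
have mC := measurableC mO.
have UX (A B C : set R) : (A `|` B) `*` C = (A `*` C) `|` (B `*` C).
  by apply/seteqP; split => -[x y]/=; tauto.
have XU (A B C : set R) : C `*` (A `|` B) = (C `*` A) `|` (C `*` B).
  by apply/seteqP; split => -[x y]/=; tauto.
have XI (A B C D : set R) : (A `*` C) `&` (B `*` D) = (A `&` B) `*` (C `&` D).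
  by apply/seteqP; split => -[x y]/=; tauto.
have e1 : energy s u (om `*` om) = (energy s u (I `*` I) + energy s u (I `*` J) +
    (energy s u (I `*` J) + energy s u (J `*` J)))%E.
  rewrite {1 2}omE UX energy_setU//; last 3 first.
  - by apply: mX => //; exact: measurableU.
  - by apply: mX => //; exact: measurableU.
  - by rewrite XI IJ set0X.
  rewrite !XU !energy_setU ?(XI, IJ, setX0)//; try exact: mX.
  by rewrite (energy_symm s mu mJ mI).
have e2 : energy s u (om `*` ~` om) = (energy s u (I `*` ~` om) + energy s u (J `*` ~` om))%E.
  by rewrite {1}omE UX energy_setU ?(XI, IJ, set0X)//; exact: mX.
have e3 : energy s u (I `*` ~` I) = (energy s u (I `*` J) + energy s u (I `*` ~` om))%E.
  have -> : ~` I = J `|` ~` om.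
    apply/seteqP; split => x /=; rewrite /J/=.
      by move=> nI; have [h|h] := pselect (om x); [left|right].
    by case=> [[]//|nO] /IO.
  by rewrite XU energy_setU ?XI//; try exact: mX; rewrite /J setDE setIAC setICr set0I setX0.
rewrite e1 e2 e3 /rest_energy -/J.
by apply: split_sum => //; exact: energy_ge0.
Qed.

Lemma eq_energy s d (u v : R -> 'rV[R]_d) (X Y : set R) :
  (forall x, X x -> u x = v x) -> (forall x, Y x -> u x = v x) ->
  energy s u (X `*` Y) = energy s v (X `*` Y).
Proof.
move=> uvX uvY; apply: eq_integral => -[x y]; rewrite inE => -[/= Xx Yy].
by rewrite /Es_kernel/= uvX// uvY.
Qed.

(** Both maps have the same [rest_energy]; cancelling it in the extended reals requires that it be
    finite, which follows from the finiteness of [Es s u om]. *)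
Lemma minimality_local s d (u v : R -> 'rV[R]_d) (I om : set R) : 0 < gamma_s s ->
  mcomp u -> mcomp v -> measurable I -> measurable om -> I `<=` om ->
  (forall x, ~ I x -> u x = v x) -> (Es s u om < +oo)%E -> (Es s u om <= Es s v om)%E ->
  ((1 / 2)%:E * energy s u (I `*` I) + energy s u (I `*` ~` I) <=
   (1 / 2)%:E * energy s v (I `*` I) + energy s v (I `*` ~` I))%E.
Proof.
move=> g0 mu mv mI mO IO uv fin.
have E (w : R -> 'rV[R]_d) : mcomp w -> Es s w om =
   ((gamma_s s)%:E * ((1 / 2)%:E * energy s w (I `*` I) + energy s w (I `*` ~` I)) +
    rest_energy s w I om)%E.
  move=> mw; rewrite (Es_split g0 mw mI mO IO).
  have h2 : (0 <= (1 / 2)%:E * energy s w (I `*` I))%E.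
    by rewrite mule_ge0 ?energy_ge0// lee_fin divr_ge0.
  rewrite (ge0_muleDr _ h2 (energy_ge0 _ _ _)).
  by rewrite muleA -EFinM mulrA mulr1.
have rE : rest_energy s u I om = rest_energy s v I om.
  rewrite /rest_energy (@eq_energy s d u v) ?(@eq_energy s d u v _ (~` om))//.
  - by move=> x [_]; exact: uv.
  - by move=> x nO; apply: uv => /IO.
  - by move=> x [_]; exact: uv.
  - by move=> x [_]; exact: uv.
have r0 : (0 <= rest_energy s u I om)%E.
  by rewrite /rest_energy; apply: adde_ge0;
    (apply: mule_ge0; [rewrite lee_fin; lra|exact: energy_ge0]).
have rfin : rest_energy s u I om \is a fin_num.
  rewrite ge0_fin_numE//; apply: le_lt_trans fin; rewrite (E u mu) leeDr//.
  by rewrite mule_ge0 ?lee_fin ?(ltW g0)// adde_ge0 ?mule_ge0 ?energy_ge0// lee_fin; lra.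
rewrite (E u mu) (E v mv) -rE leeD2rE// => h.
by rewrite -(@lee_pmul2l _ (gamma_s s)%:E) ?lte_fin.
Qed.

Lemma Es_kernel_le_cross s M d (u : R -> 'rV[R]_d) z : bdd_vec M u ->
  (Es_kernel s u z <= (d%:R * (2 * M) ^+ 2)%:E * cross_kernel s z)%E.
Proof.
move=> bu; rewrite /Es_kernel /cross_kernel -EFinM lee_fin powRN.
apply: ler_wpM2r; first by rewrite invr_ge0 powR_ge0.
rewrite /sqn mulr_natl -[X in _ *+ X]card_ord -sumr_const; apply: ler_sum => i _.
have [_ bM] := bu i; rewrite !mxE -[leLHS]real_normK ?num_real//.
have M0 : 0 <= M by apply: le_trans (bM 0).
rewrite ler_sqr ?nnegrE ?mulr_ge0//; apply: (le_trans (ler_normB _ _)).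
by have := bM z.1; have := bM z.2; rewrite /vcomp; lra.
Qed.

(** A switch without transition layer: each value is one of [u] or [v], so the constraint survives.
    The jump at the ends of [I] is paid for by [cross_kernel_lty]. *)
Definition glue d (I : set R) (u v : R -> 'rV[R]_d) : R -> 'rV[R]_d :=
  fun x => if x \in I then u x else v x.

Lemma mcomp_glue d (I : set R) (u v : R -> 'rV[R]_d) : measurable I -> mcomp u -> mcomp v ->
  mcomp (glue I u v).
Proof.
move=> mI mu mv i.
rewrite (_ : vcomp _ i = (fun x => \1_I x * vcomp u i x + (1 - \1_I x) * vcomp v i x)).
  apply: measurable_funD; apply: measurable_funM => //; last apply: measurable_funB => //;
    exact: measurable_indic.
apply/funext => x; rewrite /vcomp /glue indicE.
by case: ifP => _; rewrite ?mul1r ?mul0r ?subrr ?subr0 ?mul1r ?mul0r ?addr0 ?add0r.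
Qed.

Lemma bdd_glue M d (I : set R) (u v : R -> 'rV[R]_d) : measurable I ->
  bdd_vec M u -> bdd_vec M v -> bdd_vec M (glue I u v).
Proof.
move=> mI bu bv i; split.
  by apply: mcomp_glue => // j; [have [] := bu j|have [] := bv j].
move=> t; rewrite /vcomp /glue; case: ifP => _; first by have [_] := bu i; exact.
by have [_] := bv i; exact.
Qed.

End EnergyConvergence.

(** * Convergence of the energy over an interval *)

Section StrongConvergence.
Set Implicit Arguments.
Unset Strict Implicit.
Variable R : realType.
Notation leb := (@lebesgue_measure R).
Let leb2 := [the measure _ _ of (leb \x leb)%E].

(** Real-valued form of [Es_kernel], in which differences can be taken as [energy_cvg0] does. *)
Definition gagliardov (s : R) d (u : R -> 'rV[R]_d) (z : R * R) : R :=
  sqn (u z.1 - u z.2) / (`|z.1 - z.2| `^ (1 + 2 * s)).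

Lemma measurable_gagliardov s d (u : R -> 'rV[R]_d) : mcomp u -> measurable_fun setT (gagliardov s u).
Proof. by move=> mu; apply/measurable_EFinP; exact: measurable_Es_kernel. Qed.

Lemma gagliardov_ge0 s d (u : R -> 'rV[R]_d) z : 0 <= gagliardov s u z.
Proof. by rewrite -lee_fin; exact: (Es_kernel_ge0 s u z). Qed.

Lemma gagliardov_cvg s d (v_ : nat -> R -> 'rV[R]_d) (v : R -> 'rV[R]_d) z :
  (forall i t, vcomp (v_ n) i t @[n --> \oo] --> vcomp v i t) ->
  gagliardov s (v_ n) z @[n --> \oo] --> gagliardov s v z.
Proof.
move=> vv; apply: cvgM; last exact: cvg_cst.
rewrite /sqn; apply: cvg_big => [|i _]; first exact: add_continuous.
have e (w : R -> 'rV[R]_d) : (w z.1 - w z.2) ord0 i = vcomp w i z.1 - vcomp w i z.2 by rewrite !mxE.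
rewrite e expr2; under eq_fun do rewrite e expr2.
by apply: cvgM; apply: cvgB; exact: vv.
Qed.

Lemma Es_kernel_cvg s d (v_ : nat -> R -> 'rV[R]_d) (v : R -> 'rV[R]_d) z :
  (forall i t, vcomp (v_ n) i t @[n --> \oo] --> vcomp v i t) ->
  (Es_kernel s (v_ n) z @[n --> \oo] --> Es_kernel s v z)%E.
Proof.
move=> vv; rewrite [X in _ --> X](_ : _ = (gagliardov s v z)%:E)//.
rewrite (_ : (fun n => _) = (fun n => (gagliardov s (v_ n) z)%:E))//.
by apply: cvg_EFin; [exact: nearW|exact: (gagliardov_cvg vv)].
Qed.

Lemma cross_energy_cvg (s : R) (hs : 0 < s < 1 / 2) (a b M : R) d
    (v_ : nat -> R -> 'rV[R]_d) (v : R -> 'rV[R]_d) : a < b ->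
  (forall n, bdd_vec M (v_ n)) -> mcomp v ->
  (forall i t, vcomp (v_ n) i t @[n --> \oo] --> vcomp v i t) ->
  energy s v (`]a, b[%classic `*` ~` `]a, b[%classic) \is a fin_num /\
  (energy s (v_ n) (`]a, b[%classic `*` ~` `]a, b[%classic) @[n --> \oo] -->
   energy s v (`]a, b[%classic `*` ~` `]a, b[%classic))%E.
Proof.
move=> ab bv mv vv.
have mI : measurable (`]a, b[%classic : set R) by exact: measurable_itv.
have mD : measurable (`]a, b[%classic `*` ~` `]a, b[%classic : set (R * R)).
  by apply: measurableX => //; exact: measurableC.
have mv_ n : mcomp (v_ n) by move=> i; have [] := bv n i.
pose c : R := d%:R * (2 * M) ^+ 2.
have c0 : 0 <= c by rewrite mulr_ge0 ?sqr_ge0.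
have iG : leb2.-integrable (`]a, b[%classic `*` ~` `]a, b[%classic)
    (fun z => c%:E * cross_kernel s z)%E.
  apply: integrableZl => //; apply/integrableP; split.
    by apply: measurable_funTS; exact: measurable_cross_kernel.
  under eq_integral do rewrite gee0_abs ?lee_fin ?powR_ge0//.
  exact: cross_kernel_lty.
have [||||iv _ cv] := @dominated_convergence _ _ _ leb2 _ mD (fun n => Es_kernel s (v_ n))
  (Es_kernel s v) (fun z => c%:E * cross_kernel s z)%E _ _ _ iG _.
- by move=> n; apply: measurable_funTS; exact: (measurable_Es_kernel s (mv_ n)).
- by apply: measurable_funTS; exact: measurable_Es_kernel.
- by apply: aeW => z _; exact: (Es_kernel_cvg vv).
- by apply: aeW => z n _; rewrite gee0_abs ?Es_kernel_ge0//; exact: Es_kernel_le_cross.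
by split; [exact: integrable_fin_num iv|exact: cv].
Qed.

(** The last hypothesis is all that is kept of minimality: one comparison with the glued map. The
    two finiteness conclusions feed the finiteness of the extension norms of [u] and of each
    [u_ n]. *)
Lemma strong_cvg (s : R) (hs : 0 < s < 1 / 2) (a b M C : R) d
    (u_ : nat -> R -> 'rV[R]_d) (u : R -> 'rV[R]_d) : a < b ->
  let I : set R := `]a, b[%classic in
  (forall n, bdd_vec M (u_ n)) -> bdd_vec M u ->
  (forall i t, vcomp (u_ n) i t @[n --> \oo] --> vcomp u i t) ->
  (forall n, (energy s (u_ n) (I `*` I) <= C%:E)%E) ->
  (forall n, ((1 / 2)%:E * energy s (u_ n) (I `*` I) + energy s (u_ n) (I `*` ~` I) <=
   (1 / 2)%:E * energy s (glue I u (u_ n)) (I `*` I) +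
     energy s (glue I u (u_ n)) (I `*` ~` I))%E) ->
  [/\ (energy s u (I `*` setT) < +oo)%E,
      (forall n, (energy s (u_ n) (I `*` setT) < +oo)%E) &
      (energy s (fun t => (u_ n t - u t)%R) (I `*` setT) @[n --> \oo] --> 0)%E].
Proof.
move=> ab I bu_ bu cu CE H.
have mI : measurable I by exact: measurable_itv.
have mII : measurable (I `*` I) by exact: measurableX.
have mIC : measurable (I `*` ~` I) by apply: measurableX => //; exact: measurableC.
have mu_ n : mcomp (u_ n) by move=> i; have [] := bu_ n i.
have mu : mcomp u by move=> i; have [] := bu i.
pose w n t := u_ n t - u t.
have compw n i t : vcomp (w n) i t = vcomp (u_ n) i t - vcomp u i t by rewrite /vcomp /w !mxE.
have mw n : mcomp (w n).
  move=> i; rewrite (_ : vcomp _ i = (fun t => vcomp (u_ n) i t - vcomp u i t)); last first.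
    by apply/funext => t; rewrite compw.
  by apply: measurable_funB; [exact: mu_|exact: mu].
have bw n : bdd_vec (2 * M) (w n).
  move=> i; split; first exact: mw.
  move=> t; rewrite compw; apply: (le_trans (ler_normB _ _)).
  by have [_ b1] := bu_ n i; have [_ b2] := bu i; have := b1 t; have := b2 t; lra.
have cw i t : vcomp (w n) i t @[n --> \oo] --> vcomp (fun=> 0 : 'rV[R]_d) i t.
  under eq_fun do rewrite compw.
  have -> : vcomp (fun=> 0 : 'rV[R]_d) i t = vcomp u i t - vcomp u i t by rewrite subrr /vcomp mxE.
  by apply: cvgB; [exact: cu|exact: cvg_cst].
have m0 : mcomp (fun=> 0 : 'rV[R]_d) by move=> i; exact: measurable_cst.
have cg i t : vcomp (glue I u (u_ n)) i t @[n --> \oo] --> vcomp u i t.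
  rewrite /vcomp /glue; case: (t \in I); first exact: cvg_cst.
  exact: cu.
have nrg0 D : energy s (fun=> 0 : 'rV[R]_d) D = 0%E.
  rewrite /energy integral0_eq// => z _; rewrite /Es_kernel subrr /sqn big1 ?mul0r// => i _.
  by rewrite mxE expr0n.
have [cfin c1] := cross_energy_cvg hs ab bu_ mu cu.
have [_ c2] := cross_energy_cvg hs ab (fun n => bdd_glue mI bu (bu_ n)) mu cg.
have [_ c3] := cross_energy_cvg hs ab bw m0 cw.
(* A constant sequence turns the convergence lemma into a statement of finiteness. *)
have fa n : energy s (u_ n) (I `*` ~` I) \is a fin_num.
  by have [] := cross_energy_cvg hs ab (fun=> bu_ n) (mu_ n) (fun i t => cvg_cst _).
have mg n : mcomp (glue I u (u_ n)) by exact: mcomp_glue.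
have fb n : energy s (glue I u (u_ n)) (I `*` ~` I) \is a fin_num.
  by have [] := cross_energy_cvg hs ab (fun=> bdd_glue mI bu (bu_ n)) (mg n) (fun i t => cvg_cst _).
(* Fatou passes the uniform bound to the limit, so that [P] below is the actual energy and not a
   default value of [fine]. *)
have uC : (energy s u (I `*` I) <= C%:E)%E.
  have E : energy s u (I `*` I) = (\int[leb2]_(z in I `*` I) limn_einf (fun n => Es_kernel s (u_ n) z))%E.
    apply: eq_integral => z _.
    have Cz : (Es_kernel s (u_ n) z @[n --> \oo] --> Es_kernel s u z)%E.
      exact: (Es_kernel_cvg cu).
    by have [-> _] := cvg_limn_einf_sup Cz.
  rewrite E; apply: (le_trans (fatou leb2 mII _ _)).
  - by move=> n; apply: measurable_funTS; exact: (measurable_Es_kernel s (mu_ n)).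
  - by move=> n z _; exact: Es_kernel_ge0.
  rewrite leNgt; apply/negP => /near_lt_limn_einf[n _ /(_ n (leqnn n))].
  by rewrite ltNge CE.
have ffin (v : R -> 'rV[R]_d) D : (energy s v D <= C%:E)%E -> energy s v D \is a fin_num.
  by move=> h; rewrite ge0_fin_numE ?energy_ge0// (le_lt_trans h)// ltry.
have split (v : R -> 'rV[R]_d) : mcomp v -> energy s v (I `*` setT) = (energy s v (I `*` I) + energy s v (I `*` ~` I))%E.
  move=> mv; have -> : I `*` setT = (I `*` I) `|` (I `*` ~` I).
    apply/seteqP; split => -[x y]/=; last by tauto.
    by move=> [Ix _]; have [?|?] := pselect (I y); [left|right].
  by rewrite energy_setU//; apply/seteqP; split => -[x y]/=; tauto.
have fl (x : \bar R) : x \is a fin_num -> (x < +oo)%E by move=> h; rewrite ltey_eq h.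
split.
- by rewrite (split _ mu); apply: lte_add_pinfty; apply: fl; [exact: ffin|exact: cfin].
- move=> n; rewrite (split _ (mu_ n)).
  by apply: lte_add_pinfty; apply: fl; [exact: (ffin _ _ (CE n))|exact: fa].
have -> : (fun n => energy s (fun t => (u_ n t - u t)%R) (I `*` setT)) =
    (fun n => energy s (w n) (I `*` I) + energy s (w n) (I `*` ~` I))%E.
  by apply/funext => n; rewrite -split.
have l0 : (0 + 0 = 0 :> \bar R)%E by rewrite adde0.
apply: (cvg_eq_lim l0); apply: cvgeD; [by []| |by rewrite -(nrg0 (I `*` ~` I))].
pose P_ n := fine (energy s (u_ n) (I `*` I)); pose P := fine (energy s u (I `*` I)).
pose A_ n := fine (energy s (u_ n) (I `*` ~` I)).
pose B_ n := fine (energy s (glue I u (u_ n)) (I `*` ~` I)).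
pose A := fine (energy s u (I `*` ~` I)).
have cA : A_ n @[n --> \oo] --> A.
  by apply: fine_cvg; rewrite /A fineK; [exact: c1|exact: cfin].
have cB : B_ n @[n --> \oo] --> A.
  by apply: fine_cvg; rewrite /A fineK; [exact: c2|exact: cfin].
(* The 2 in the error [2 * (B_ n - A_ n)] clears the weight 1/2 of I x I. The error vanishes in the
   limit because the glued maps and the [u_ n] have the same pointwise limit, so both cross energies
   tend to [A]. *)
apply: (@energy_cvg0 _ _ _ leb2 (I `*` I) (fun n => gagliardov s (u_ n)) (fun n => gagliardov s (w n)) (gagliardov s u)
  P_ (fun n => 2 * (B_ n - A_ n)) P) => //.
- by move=> n; apply: measurable_funTS; exact: measurable_gagliardov.
- by move=> n; apply: measurable_funTS; exact: measurable_gagliardov.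
- by apply: measurable_funTS; exact: measurable_gagliardov.
- move=> n z _; rewrite gagliardov_ge0/= /gagliardov !mulrA -mulrDl; apply: ler_wpM2r.
    by rewrite invr_ge0 powR_ge0.
  rewrite /sqn !mulr_sumr -big_split/=; apply: ler_sum => i _.
  rewrite /w !mxE; set x := u_ n z.1 _ _; set x' := u_ n z.2 _ _.
  set y := u z.1 _ _; set y' := u z.2 _ _.
  have -> : x - y - (x' - y') = (x - x') - (y - y') by ring.
  by have := sqr_ge0 ((x - x') + (y - y')); rewrite !expr2; lra.
- by move=> n z _; exact: gagliardov_ge0.
- by move=> z _; exact: gagliardov_ge0.
- by move=> z _; exact: gagliardov_cvg.
- move=> z _; have := gagliardov_cvg (s := s) (z := z) cw; rewrite {2}/gagliardov subrr /sqn big1 ?mul0r//.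
  by move=> i _; rewrite mxE expr0n.
- by rewrite /P fineK ?ffin.
- by move=> n; rewrite /P_ fineK ?ffin.
- move=> n; have := H n.
  rewrite (@eq_energy _ s d (glue I u (u_ n)) u I I); last 2 first.
  + by move=> x Ix; rewrite /glue mem_set.
  + by move=> x Ix; rewrite /glue mem_set.
  have -> : energy s (u_ n) (I `*` I) = (P_ n)%:E by rewrite /P_ (fineK (ffin _ _ (CE n))).
  have -> : energy s u (I `*` I) = P%:E by rewrite /P (fineK (ffin _ _ uC)).
  have -> : energy s (u_ n) (I `*` ~` I) = (A_ n)%:E by rewrite /A_ (fineK (fa n)).
  have -> : energy s (glue I u (u_ n)) (I `*` ~` I) = (B_ n)%:E by rewrite /B_ (fineK (fb n)).
  by rewrite -!EFinM -!EFinD lee_fin; lra.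
- rewrite -(mulr0 2) -(subrr A); apply: cvgM; first exact: cvg_cst.
  by apply: cvgB; [exact: cB|exact: cA].
Qed.

End StrongConvergence.

(** * Null sets, subsequences and admissible domains *)

Section NullSetsAndSubsequences.
Set Implicit Arguments.
Unset Strict Implicit.
Variable R : realType.
Notation leb := (@lebesgue_measure R).
Let leb2 := [the measure _ _ of (leb \x leb)%E].

Lemma ext_eq_off_null s d (u v : R -> 'rV[R]_d) (Z : set R) p :
  measurable Z -> leb Z = 0%E -> mcomp u -> mcomp v ->
  (forall x, ~ Z x -> u x = v x) -> ext s u p = ext s v p.
Proof.
move=> mZ Z0 mu mv uv; apply/rowP => i; rewrite !extE; congr (_ * _).
have mk (w : R -> 'rV[R]_d) : mcomp w ->
    measurable_fun setT (fun t => (pker s p.1 p.2 t * vcomp w i t)%:E).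
  by move=> mw; apply/measurable_EFinP; apply: measurable_funM => //; exact: measurable_pker.
rewrite /pext /Rintegral; congr fine.
apply: ae_eq_integral => //; [exact: mk|exact: mk|].
exists Z; split => // t /= H; apply: contrapT => nZ; apply: H => _.
by rewrite /vcomp uv.
Qed.

Lemma energy_eq_off_null s d (u v : R -> 'rV[R]_d) (Z : set R) (D : set (R * R)) :
  measurable Z -> leb Z = 0%E -> mcomp u -> mcomp v -> measurable D ->
  (forall x, ~ Z x -> u x = v x) -> energy s u D = energy s v D.
Proof.
move=> mZ Z0 mu mv mD uv.
apply: (@ge0_ae_eq_integral _ _ _ leb2 D) => //.
- by apply: measurable_funTS; exact: measurable_Es_kernel.
- by apply: measurable_funTS; exact: measurable_Es_kernel.
- by move=> z _; exact: Es_kernel_ge0.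
- by move=> z _; exact: Es_kernel_ge0.
have mZ1 : measurable (Z `*` setT : set (R * R)) by exact: measurableX.
have mZ2 : measurable (setT `*` Z : set (R * R)) by exact: measurableX.
have n1 : leb2.-negligible (Z `*` setT).
  by exists (Z `*` setT); split => //; rewrite /leb2/= product_measure1E//= Z0 mul0e.
have n2 : leb2.-negligible (setT `*` Z).
  by exists (setT `*` Z); split => //; rewrite /leb2/= product_measure1E//= Z0 mule0.
apply: (negligibleS _ (negligibleU n1 n2)) => -[x y] /= H.
have [Zx|nZx] := pselect (Z x); first by left.
have [Zy|nZy] := pselect (Z y); first by right.
by exfalso; apply: H => _; rewrite /Es_kernel/= !uv.
Qed.

Lemma Es_eq_off_null s d (u v : R -> 'rV[R]_d) (Z om : set R) :
  measurable Z -> leb Z = 0%E -> mcomp u -> mcomp v -> measurable om ->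
  (forall x, ~ Z x -> u x = v x) -> Es s u om = Es s v om.
Proof.
move=> mZ Z0 mu mv mO uv; rewrite /Es.
have E D : measurable D -> (\int[leb2]_(z in D) Es_kernel s u z =
    \int[leb2]_(z in D) Es_kernel s v z)%E.
  by move=> mD; exact: (energy_eq_off_null s mZ Z0 mu mv mD uv).
rewrite (E _ (measurableX mO mO)).
by rewrite (E _ (measurableX mO (measurableC mO))).
Qed.

(** The condition [n <= psi n] replaces strict monotonicity: it forces [psi] to tend to infinity,
    and a bad sequence [psi] can be chosen term by term. *)
Lemma ge0_cvg0_subseq (x : nat -> \bar R) : (forall n, (0 <= x n)%E) ->
  (forall psi : nat -> nat, (forall n, (n <= psi n)%N) ->
    exists phi : nat -> nat, (forall n, (n <= phi n)%N) /\
      (x (psi (phi n)) @[n --> \oo] --> 0)%E) ->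
  (x n @[n --> \oo] --> 0)%E.
Proof.
move=> x0 H.
have key e : 0 < e -> \forall n \near \oo, (x n < e%:E)%E.
  move=> e0; apply: contrapT => nH.
  have /choice[psi psiP] : forall N, exists n, (N <= n)%N /\ (e%:E <= x n)%E.
    move=> N; apply: contrapT => nN; apply: nH; exists N => // n /= Nn.
    by rewrite ltNge; apply/negP => h; apply: nN; exists n.
  have [phi [_ cphi]] := H psi (fun n => (psiP n).1).
  have : \forall n \near \oo, (x (psi (phi n)) < e%:E)%E.
    move/fine_cvgP : cphi => [ffin /cvgrPdist_lt/(_ e e0) cf].
    near=> n.
    have fn : x (psi (phi n)) \is a fin_num by near: n.
    have : `|0 - (fine \o (fun n => x (psi (phi n)))) n| < e by near: n.
    by rewrite /= sub0r normrN ger0_norm ?fine_ge0// -lte_fin fineK.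
  move=> [n _ /(_ n (leqnn n))].
  by rewrite ltNge (psiP (phi n)).2.
apply/fine_cvgP; split.
  near=> n; rewrite ge0_fin_numE//; apply: (@lt_trans _ _ 1%:E); last exact: ltry.
  by near: n; exact: key.
apply/cvgrPdist_lt => e e0; near=> n; rewrite /= sub0r normrN ger0_norm ?fine_ge0//.
have h : (x n < e%:E)%E by near: n; exact: key.
rewrite -lte_fin fineK// ge0_fin_numE//; exact: lt_trans h (ltry _).
Unshelve. all: by end_near.
Qed.

(* Fast subsequence: the integrals over [-k, k] are summable, so the series of
   the functions is finite almost everywhere. *)
Lemma ae_cvg0_subseq (w_ : nat -> R -> R) :
  (forall n, measurable_fun setT (w_ n)) -> (forall n x, 0 <= w_ n x) ->
  (forall k : nat, (\int[leb]_(x in `[(- k%:R)%R, k%:R%R]) (w_ n x)%:E @[n --> \oo] --> 0)%E) ->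
  exists phi : nat -> nat, (forall n, (n <= phi n)%N) /\
    {ae leb, forall x, w_ (phi n) x @[n --> \oo] --> 0}.
Proof.
move=> mw w0 cw.
pose B (k : nat) : set R := `[- k%:R, k%:R]%classic.
have mB k : measurable (B k) by exact: measurable_itv.
pose eps (k : nat) : R := 1 / (2 ^ k.+1)%:R.
have e0 k : 0 < eps k by rewrite divr_gt0// ltr0n expn_gt0.
have /choice[phi phiP] : forall k, exists n, (k <= n)%N /\
    (\int[leb]_(x in B k) (w_ n x)%:E <= (eps k)%:E)%E.
  move=> k; have /fine_cvgP[ffin /cvgrPdist_lt/(_ _ (e0 k)) cf] := cw k.
  near \oo => n; exists n; split; first by near: n; exact: nbhs_infty_ge.
  have fn : (\int[leb]_(x in `[(- k%:R)%R, k%:R%R]) (w_ n x)%:E)%E \is a fin_num by near: n.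
  have : `|0 - (fine \o (fun n => \int[leb]_(x in `[(- k%:R)%R, k%:R%R]) (w_ n x)%:E)%E) n| < eps k.
    by near: n.
  rewrite /= sub0r normrN ger0_norm; last first.
    by rewrite fine_ge0// integral_ge0// => x _; rewrite lee_fin.
  by rewrite -lte_fin fineK// => /ltW.
exists phi; split; first by move=> n; exact: (phiP n).1.
have step K : {ae leb, forall x, B K x -> w_ (phi n) x @[n --> \oo] --> 0}.
  (* Starting at index [K] puts [B K] inside [B (k + K)], where the fast decay is known; the shift
     is undone at the end. *)
  pose g k x := (w_ (phi (k + K)%N) x)%:E.
  have mg k : measurable_fun (B K) (g k).
    by apply: measurable_funTS; apply/measurable_EFinP.
  have g0 k x : B K x -> (0 <= g k x)%E by rewrite lee_fin.
  have Ig k : (\int[leb]_(x in B K) g k x <= (1 / (2 ^ k.+1)%:R)%:E)%E.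
    apply: (@le_trans _ _ (eps (k + K)%N)%:E).
      apply: (le_trans _ (phiP (k + K)%N).2); apply: ge0_subset_integral => //.
      - exact: mB.
      - exact: mB.
      - by apply: measurable_funTS; rewrite /g; apply/measurable_EFinP; exact: mw.
      - by move=> x _; rewrite lee_fin.
      - move=> x; rewrite /B/= !in_itv/= => /andP[h1 h2].
        have : K%:R <= (k + K)%:R :> R by rewrite ler_nat leq_addl.
        by move=> h; apply/andP; split; [rewrite (le_trans _ h1)// lerN2|exact: le_trans h].
    rewrite lee_fin /eps ler_pM2l// lef_pV2 ?posrE ?ltr0n ?expn_gt0//.
    by rewrite ler_nat leq_exp2l// ltnS leq_addr.
  have iS : (\int[leb]_(x in B K) (\sum_(k <oo) g k x) < +oo)%E.
    have -> : (\int[leb]_(x in B K) (\sum_(k <oo) g k x) = \sum_(k <oo) \int[leb]_(x in B K) g k x)%E.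
      by apply: integral_nneseries; [exact: mB|exact: mg|exact: g0].
    apply: (@le_lt_trans _ _ 1%:E); last exact: ltry.
    apply: (le_trans _ (epsilon_trick0 xpredT (@ler01 R))).
    apply: lee_nneseries => k *; [apply: integral_ge0; exact: g0|exact: Ig].
  have mS : measurable_fun (B K) (fun x => \sum_(k <oo) g k x)%E.
    apply: ge0_emeasurable_sum => [k x *|k *]; [exact: g0|exact: mg].
  have S0 x : B K x -> (0 <= \sum_(k <oo) g k x)%E.
    by move=> Bx; apply: nneseries_ge0 => k _ _; exact: g0.
  have intS : leb.-integrable (B K) (fun x => \sum_(k <oo) g k x)%E.
    apply/integrableP; split => //.
    by under eq_integral => x /[!inE] Bx do rewrite gee0_abs ?S0//.
  have H := @integrable_ae _ _ _ leb _ (mB K) _ intS.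
  move: H; apply: negligibleS; apply: subsetC => x fx Bx.
  have Sfin : (\sum_(k <oo) g k x < +oo)%E by rewrite ltey_eq fx.
  have := cvg_series_cvg_0 (nnseries_is_cvg (fun k => w0 _ _) Sfin).
  by rewrite (cvg_shiftn K (fun n => w_ (phi n) x)).
have /ae_foralln : forall K, {ae leb, forall x, B K x -> w_ (phi n) x @[n --> \oo] --> 0} by [].
apply: filterS => x H.
apply: (H (Num.trunc `|x|).+1).
have : `|x| <= (Num.trunc `|x|).+1%:R by rewrite ltW// truncnS_gt.
by rewrite ler_norml /B/= in_itv.
Unshelve. all: by end_near.
Qed.

(** A point of [closure O] on the real line is a boundary point outside [upper], so the last clause
    of [admissible] puts it in [closure (bdry0 O)], hence strictly between [a] and [b]. Compactness
    makes the margin uniform. *)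
Lemma strip_of_admissible (O : set (R * R)) (a b : R) :
  open O -> bounded2 O -> O `<=` @upper R -> admissible O -> a < b ->
  closure (bdry0 O) `<=` `]a, b[%classic ->
  exists2 e : R, 0 < e < (b - a) / 2 & forall p, O p -> p.2 < e -> a + e < p.1 < b - e.
Proof.
move=> oO [K bO] Ou [_ [[x0 bx0] [_ bdE]]] ab cl.
have cb : closed [set p : R * R | 0 <= p.2].
  rewrite (_ : [set p | _] = snd @^-1` [set y : R | 0 <= y])//.
  by apply: closed_comp => [p _|]; [exact: cvg_snd|exact: closed_ge].
have clO0 p : closure O p -> 0 <= p.2.
  have : O `<=` [set p : R * R | 0 <= p.2] by move=> q /Ou /ltW.
  by move=> Osub /(closure_subset Osub); rewrite -(closure_id _).1.
pose box : set (R * R) := `[- K, K]%classic `*` `[- K, K]%classic.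
have cbox : compact box by apply: compact_setX; exact: segment_compact.
have clbox : closure O `<=` box.
  have Ob : O `<=` box.
    by move=> p /bO[]; rewrite !ler_norml /box/= !in_itv/=.
  move=> p /(closure_subset Ob); rewrite -(closure_id _).1//.
  by apply: compact_closed => //; exact: norm_hausdorff.
have cO : compact (closure O).
  by apply: (subclosed_compact _ cbox clbox); exact: closed_closure.
(* [h] is positive on the compact set [closure O], hence bounded below there. *)
pose h (p : R * R) : R := Num.max p.2 (Num.min (p.1 - a) (b - p.1)).
have ch : continuous h.
  move=> p; apply: (@continuous_max _ _ snd (fun p : R * R => Num.min (p.1 - a) (b - p.1))).
    exact: cvg_snd.
  apply: (@continuous_min _ _ (fun p : R * R => p.1 - a) (fun p : R * R => b - p.1)).
    by apply: cvgB; [exact: cvg_fst|exact: cvg_cst].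
  by apply: cvgB; [exact: cvg_cst|exact: cvg_fst].
have cO0 : closure O !=set0.
  by exists (x0, 0); have [[]] := bx0.
have [c /set_mem cc cmin] := compact_EVT_min cO0 cO (continuous_subspaceT ch).
have hc : 0 < h c.
  rewrite /h lt_max; have [//|c2] := ltP 0 c.2.
  have c20 : c.2 = 0 by apply/eqP; rewrite eq_le c2 clO0.
  have : bdry O c.
    split => // /interior_subset /Ou; rewrite /upper/= c20.
    by rewrite ltxx.
  rewrite bdE => -[[_]|[x xcl cE]]; first by rewrite /upper/= c20 ltxx.
  have := cl _ xcl; rewrite -cE/= in_itv/= => /andP[h1 h2].
  by rewrite lt_min !subr_gt0 h1 h2.
(* Half of the minimum: [p.2 < e] rules out [h c <= p.2], so the other term of the maximum is at
   least [h c], which exceeds [e]. The second bound keeps the shortened interval nonempty. *)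
pose e := Num.min (h c / 2) ((b - a) / 4).
have eh : e <= h c / 2 by rewrite /e ge_min lexx.
have eb : e <= (b - a) / 4 by rewrite /e ge_min lexx orbT.
have e0 : 0 < e by rewrite /e lt_min; apply/andP; split; lra.
exists e; first by apply/andP; split => //; lra.
move=> p Op pe.
have hp : h c <= h p by apply: cmin; rewrite inE; exact: subset_closure.
have : (h c <= p.2) || (h c <= Num.min (p.1 - a) (b - p.1)) by rewrite -le_max.
clearbody e; move: (h c) hc eh => H H0 eH; rewrite le_min => /orP[h1|/andP[h1 h2]].
  have : p.2 < p.2 by lra.
  by rewrite ltxx.
by apply/andP; split; lra.
Qed.

End NullSetsAndSubsequences.

(** * Competitors, and sequences converging almost everywhere *)

Section Compactness.
Set Implicit Arguments.
Unset Strict Implicit.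
Variable R : realType.
Notation leb := (@lebesgue_measure R).

Lemma norm_coord_le d (v : 'rV[R]_d) i : `|v ord0 i| <= `|v|.
Proof.
rewrite [leRHS]/Num.Def.normr/= mx_normrE.
exact: (le_bigmax _ (fun ij : 'I_1 * 'I_d => `|v ij.1 ij.2|) (ord0, i)).
Qed.

Lemma compact_coord_bound d (N : set 'rV[R]_d) : compact N ->
  exists2 M : R, 0 <= M & forall p, N p -> forall i, `|p ord0 i| <= M.
Proof.
move=> /compact_bounded/ex_strict_bound_gt0[M M0 NM]; exists M; first exact: ltW.
by move=> p Np i; apply: (le_trans (norm_coord_le p i)); exact/ltW/NM.
Qed.

Lemma cvg_sqn d (v_ : nat -> 'rV[R]_d) (l : 'rV[R]_d) :
  sqn (v_ n - l) @[n --> \oo] --> 0 -> v_ n @[n --> \oo] --> l.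
Proof.
move=> H; apply/cvgrPdist_le => e e0.
have e20 : 0 < e ^+ 2 by rewrite exprn_gt0.
move/cvgrPdist_lt : H => /(_ _ e20) H; near=> n.
rewrite [leLHS]/Num.Def.normr/= mx_normrE; apply: bigmax_le; first exact: ltW.
move=> [i j] _ /=; rewrite (ord1 i) -ler_sqr ?nnegrE ?(ltW e0)// real_normK ?num_real//.
have h : `|0 - sqn (v_ n - l)| < e ^+ 2 by near: n.
apply: (le_trans _ (ltW h)); rewrite sub0r normrN; apply: (le_trans _ (ler_norm _)).
rewrite /sqn (bigD1 j)//= !mxE -sqrrN opprB lerDl.
by apply: sumr_ge0 => k _; exact: sqr_ge0.
Unshelve. all: by end_near.
Qed.

Lemma cvg_coord d (v_ : nat -> 'rV[R]_d) (l : 'rV[R]_d) i :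
  v_ n @[n --> \oo] --> l -> v_ n ord0 i @[n --> \oo] --> l ord0 i.
Proof.
move=> /cvgrPdist_lt H; apply/cvgrPdist_lt => e e0; near=> n.
have h : `|l - v_ n| < e by near: n; exact: H.
by apply: le_lt_trans h; have := norm_coord_le (l - v_ n) i; rewrite !mxE.
Unshelve. all: by end_near.
Qed.

Lemma measurable_sqn d (u : R -> 'rV[R]_d) : mcomp u ->
  measurable_fun setT (fun x => sqn (u x)).
Proof. by move=> mu; apply: measurable_sum => i; apply: measurable_funX; exact: mu. Qed.

Lemma sqn_ge0 d (v : 'rV[R]_d) : 0 <= sqn v.
Proof. by apply: sumr_ge0 => i _; exact: sqr_ge0. Qed.

Lemma L2loc_glue d (I : set R) (u v : R -> 'rV[R]_d) : measurable I ->
  L2loc u -> L2loc v -> L2loc (glue I u v).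
Proof.
move=> mI [mu Lu] [mv Lv]; have mg := mcomp_glue mI mu mv; split; first exact: mg.
move=> a b; have mE (w : R -> 'rV[R]_d) : mcomp w ->
    measurable_fun `[a, b]%classic (fun x => (sqn (w x))%:E).
  by move=> mw; apply/measurable_EFinP; apply: measurable_funTS; exact: measurable_sqn.
have E0 (w : R -> 'rV[R]_d) x : (0 <= (sqn (w x))%:E)%E by rewrite lee_fin sqn_ge0.
apply: (@le_lt_trans _ _ (\int[leb]_(x in `[a, b]) ((sqn (u x))%:E + (sqn (v x))%:E))%E).
  apply: ge0_le_integral => //.
  - exact: mE.
  - by apply: emeasurable_funD; exact: mE.
  - move=> x _; rewrite -EFinD lee_fin /glue.
    by case: ifP => _; [rewrite lerDl|rewrite lerDr]; exact: sqn_ge0.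
rewrite ge0_integralD//; [|exact: mE|exact: mE].
by apply: lte_add_pinfty.
Qed.

Lemma rest_energy_eq s d (u v : R -> 'rV[R]_d) (I om : set R) : I `<=` om ->
  (forall x, ~ I x -> u x = v x) -> rest_energy s u I om = rest_energy s v I om.
Proof.
move=> IO uv; rewrite /rest_energy (@eq_energy _ s d u v) ?(@eq_energy _ s d u v _ (~` om))//.
- by move=> x [_]; exact: uv.
- by move=> x nO; apply: uv => /IO.
- by move=> x [_]; exact: uv.
- by move=> x [_]; exact: uv.
Qed.

Lemma energy_cross_fin (s : R) (hs : 0 < s < 1 / 2) (a b M : R) d (v : R -> 'rV[R]_d) :
  a < b -> bdd_vec M v ->
  energy s v (`]a, b[%classic `*` ~` `]a, b[%classic) \is a fin_num.
Proof.
move=> ab bv; have mv : mcomp v by move=> i; have [] := bv i.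
by have [] := cross_energy_cvg hs ab (fun=> bv) mv (fun i t => cvg_cst _).
Qed.

Lemma energy_le_Es s d (u : R -> 'rV[R]_d) (I om : set R) (C : R) : 0 < gamma_s s -> mcomp u ->
  measurable I -> measurable om -> I `<=` om -> (Es s u om <= C%:E)%E ->
  (energy s u (I `*` I) <= (2 * C / gamma_s s)%:E)%E.
Proof.
move=> g0 mu mI mO IO; rewrite (Es_split g0 mu mI mO IO) => h.
have r0 : (0 <= (gamma_s s)%:E * energy s u (I `*` ~` I) + rest_energy s u I om)%E.
  rewrite /rest_energy; apply: adde_ge0; last apply: adde_ge0;
    (apply: mule_ge0; [rewrite lee_fin; lra|exact: energy_ge0]).
have h2 : ((gamma_s s / 2)%:E * energy s u (I `*` I) <= C%:E)%E.
  by apply: le_trans h; rewrite -addeA leeDl.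
have E : (C%:E = (gamma_s s / 2)%:E * (2 * C / gamma_s s)%:E)%E.
  by rewrite -EFinM; congr EFin; field; rewrite gt_eqF.
by move: h2; rewrite E lee_pmul2l// lte_fin; lra.
Qed.

Lemma ext_strong_cvg_ae (s : R) (d : nat) (N : set 'rV[R]_d)
    (a b C : R) (v_ : nat -> R -> 'rV[R]_d) (u : R -> 'rV[R]_d) (O : set (R * R)) :
  0 < s < 1 / 2 -> compact N -> a < b ->
  (forall n, Hhat s `]a, b[%classic N (v_ n)) ->
  (forall n, minimizing_sharmonic s `]a, b[%classic N (v_ n)) ->
  (forall n, (Es s (v_ n) `]a, b[%classic <= C%:E)%E) ->
  L2loc u -> {ae leb, forall x, sqn (v_ n x - u x) @[n --> \oo] --> 0} ->
  open O -> bounded2 O -> O `<=` @upper R -> admissible O ->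
  closure (bdry0 O) `<=` `]a, b[%classic ->
  [/\ (H1a_sqnorm (1 - 2 * s) O (ext s u) < +oo)%E,
      (forall n, (H1a_sqnorm (1 - 2 * s) O (ext s (v_ n)) < +oo)%E) &
      (H1a_sqnorm (1 - 2 * s) O (fun p => (ext s (v_ n) p - ext s u p)%R)
         @[n --> \oo] --> 0)%E].
Proof.
move=> hs cN ab Hv minv EsC Lu aev oO bO Ou adm clO.
have g0 := gamma_s_gt0 hs.
have [e /andP[e0 e2] Oe] := strip_of_admissible oO bO Ou adm ab clO.
pose om : set R := `]a, b[%classic; pose I : set R := `]a + e, b - e[%classic.
have aebe : a + e < b - e by lra.
have mI : measurable I by exact: measurable_itv.
have mO : measurable om by exact: measurable_itv.
have IO : I `<=` om.
  by move=> x; rewrite /I /om/= !in_itv/= => /andP[h1 h2]; apply/andP; split; lra.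
have [M M0 NM] := compact_coord_bound cN.
have clN : closed N by apply: compact_closed => //; exact: norm_hausdorff.
have aeN : {ae leb, forall x, forall n, N (v_ n x)}.
  by apply: ae_foralln => n; have [_ [_]] := Hv n.
(* One null set serves all [n]. Off [Z] the limit [u] also takes values in [N], because [N] is
   closed. *)
have [Z [mZ Z0 ZP]] : leb.-negligible (~` [set x | (forall n, N (v_ n x)) /\
    (sqn (v_ n x - u x) @[n --> \oo] --> 0)]).
  apply: (negligibleS _ (negligibleU aeN aev)) => x /= nH.
  have [h|h] := pselect (forall n, N (v_ n x)); last by left.
  by right => h2; apply: nH.
have goodN x n : ~ Z x -> N (v_ n x).
  by move=> nZ; apply: contrapT => h; apply: nZ; apply: ZP => -[/(_ n)].
have goodc x : ~ Z x -> v_ n x @[n --> \oo] --> u x.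
  move=> nZ; apply: cvg_sqn; apply: contrapT => h; apply: nZ; apply: ZP => -[_].
  exact: h.
have goodu x : ~ Z x -> N (u x).
  move=> nZ; apply: (closed_cvg N clN _ _ (goodc x nZ)).
  by apply: nearW => n; exact: goodN.
have mv n : mcomp (v_ n) by have [[]] := Hv n.
have mu : mcomp u by have [] := Lu.
have m0 : mcomp (fun=> 0 : 'rV[R]_d) by move=> i; exact: measurable_cst.
(* With the value 0 on [Z], bounds and convergence hold at every point as the earlier lemmas
   require, while [Es] and [ext] are unchanged. *)
pose cut (w : R -> 'rV[R]_d) := glue Z (fun=> 0) w.
have cutE w x : ~ Z x -> cut w x = w x by move=> nZ; rewrite /cut /glue memNset.
have mcut w : mcomp w -> mcomp (cut w) by move=> mw; exact: mcomp_glue.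
have bcut w : mcomp w -> (forall x, ~ Z x -> N (w x)) -> bdd_vec M (cut w).
  move=> mw Nw i; split; first exact: mcut.
  move=> t; rewrite /vcomp /cut /glue; case: ifPn => [_|nZ]; first by rewrite mxE normr0.
  by apply: NM; apply: Nw => Zt; move/negP : nZ; apply; rewrite inE.
have bv n : bdd_vec M (cut (v_ n)) by apply: bcut => // x; exact: goodN.
have bu : bdd_vec M (cut u) by exact: bcut.
have ccut i t : vcomp (cut (v_ n)) i t @[n --> \oo] --> vcomp (cut u) i t.
  have [Zt|nZ] := pselect (Z t).
    rewrite /vcomp /cut /glue; rewrite mem_set//; exact: cvg_cst.
  rewrite /vcomp; rewrite cutE//; under eq_fun do rewrite cutE//.
  by apply: cvg_coord; exact: goodc.
have Ecut w : mcomp w -> Es s (cut w) om = Es s w om.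
  by move=> mw; apply: (Es_eq_off_null s mZ Z0) => //; [exact: mcut|exact: cutE].
have nrgC n : (energy s (cut (v_ n)) (I `*` I) <= (2 * C / gamma_s s)%:E)%E.
  by apply: (energy_le_Es g0 (mcut _ (mv n)) mI mO IO); rewrite Ecut//; exact: EsC.
have Esfin n : (Es s (v_ n) om < +oo)%E by have [_ []] := Hv n.
have H n : ((1 / 2)%:E * energy s (cut (v_ n)) (I `*` I) + energy s (cut (v_ n)) (I `*` ~` I) <=
   (1 / 2)%:E * energy s (glue I (cut u) (cut (v_ n))) (I `*` I) +
     energy s (glue I (cut u) (cut (v_ n))) (I `*` ~` I))%E.
  set g' := glue I (cut u) (cut (v_ n)).
  have mg' : mcomp g' by apply: mcomp_glue => //; exact: mcut.
  have g'I x : I x -> g' x = cut u x by move=> Ix; rewrite /g' /glue mem_set.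
  have g'C x : ~ I x -> cut (v_ n) x = g' x by move=> Ix; rewrite /g' /glue memNset.
  have nrgI : energy s g' (I `*` I) = energy s (cut u) (I `*` I) by exact: eq_energy.
  have crossfin : energy s g' (I `*` ~` I) \is a fin_num.
    by apply: (energy_cross_fin hs aebe (M := M)); exact: bdd_glue.
  (* If the limit has infinite energy on [I] there is nothing to prove; otherwise
     the glued map is an admissible competitor. *)
  have [uoo|ufin] := eqVneq (energy s (cut u) (I `*` I)) +oo%E.
    have half0 : (0 < (1 / 2)%:E :> \bar R)%E by rewrite lte_fin divr_gt0.
    rewrite nrgI uoo (gt0_muley half0) addye; first exact: leey.
    by rewrite -ltNye; apply: lt_le_trans (energy_ge0 _ _ _).
  apply: (minimality_local g0 (mcut _ (mv n)) mg' mI mO IO g'C); first by rewrite Ecut.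
  (* Minimality is tested with the uncut map, which equals [v_ n] everywhere off [I]; the energy is
     then transferred to [g'], equal to it off the null set. *)
  pose g := glue I u (v_ n).
  have mg : mcomp g by exact: mcomp_glue.
  have gg' : Es s g om = Es s g' om.
    apply: (Es_eq_off_null s mZ Z0) => // x nZ; rewrite /g /g' /glue.
    by case: ifP => _; rewrite cutE.
  rewrite (Ecut _ (mv n)) -gg'; apply: minv.
    split; first exact: (L2loc_glue mI Lu (Hv n).1).
    split.
      (* Three finite pieces: the block I x I is that of the limit, finite in the present case; the
         cross energy is finite for bounded maps; the rest is shared with [v_ n]. *)
      rewrite -/om gg' (Es_split g0 mg' mI mO IO) nrgI -(rest_energy_eq s IO g'C).
      have ufl : (energy s (cut u) (I `*` I) < +oo)%E by rewrite ltey.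
      apply: lte_add_pinfty; first apply: lte_add_pinfty.
      - by apply: lte_mul_pinfty; [rewrite lee_fin; lra|by []|exact: ufl].
      - apply: lte_mul_pinfty; [|by []|by rewrite ltey_eq crossfin].
        by rewrite lee_fin (ltW g0).
      - apply: (le_lt_trans _ (Esfin n)); rewrite -(Ecut _ (mv n)).
        rewrite (Es_split g0 (mcut _ (mv n)) mI mO IO); apply: leeDr; apply: adde_ge0;
          (apply: mule_ge0; [rewrite lee_fin; lra|exact: energy_ge0]).
    exists Z; split; [exact: mZ|exact: Z0|move=> x /= nN]; apply: contrapT => nZ; apply: nN.
    by rewrite /g /glue; case: ifP => _; [exact: goodu|exact: goodN].
  (* [I] keeps distance [e] from the complement of [om]. Around a point outside [om] the ball of
     radius [e] therefore misses [I], and the difference vanishes on it. *)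
  move=> x xs; apply: contrapT => nO; apply: (xs e e0).
  rewrite (_ : _ `&` _ = set0); first exact: negligible_set0.
  rewrite -subset0 => y /= [yx]; rewrite fctE /g /glue.
  case: ifPn => [|_]; last by rewrite subrr eqxx.
  rewrite inE /I/= in_itv/= => /andP[h1 h2] _; apply: nO; rewrite /= in_itv/=.
  by move: yx; rewrite ltr_norml => /andP[h3 h4]; apply/andP; split; lra.
have [n1 n2 n3] := strong_cvg hs aebe bv bu ccut nrgC H.
have [K bK] := bO.
have sO : strip_domain K e I O.
  split => //.
  - exact: open_prod_measurable.
  - move=> p Op; have [h1 h2] := bK p Op; split => //; rewrite (Ou p Op)/=.
    exact: le_trans (ler_norm _) h2.
have extE w : mcomp w -> ext s w = ext s (cut w).
  move=> mw; apply/funext => p; apply: (ext_eq_off_null s p mZ Z0) => //; first exact: mcut.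
  by move=> x nZ; rewrite cutE.
split.
- rewrite (extE u mu); exact: (ext_H1a_lty hs bu M0 sO n1).
- by move=> n; rewrite (extE _ (mv n)); exact: (ext_H1a_lty hs (bv n) M0 sO (n2 n)).
pose w n t := cut (v_ n) t - cut u t.
have bw n : bdd_vec (2 * M) (w n).
  move=> i.
  have [mv1 b1] := bv n i; have [mu1 b2] := bu i.
  have cE t : vcomp (w n) i t = vcomp (cut (v_ n)) i t - vcomp (cut u) i t.
    by rewrite /vcomp /w !mxE.
  split.
    rewrite (_ : vcomp _ i = (fun t => vcomp (cut (v_ n)) i t - vcomp (cut u) i t)).
      exact: measurable_funB.
    by apply/funext => t; exact: cE.
  move=> t; rewrite cE; apply: (le_trans (ler_normB _ _)).
  by have := b1 t; have := b2 t; lra.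
have cw i t : vcomp (w n) i t @[n --> \oo] --> 0.
  rewrite -(subrr (vcomp (cut u) i t)).
  have -> : (fun n => vcomp (w n) i t) =
      (fun n => vcomp (cut (v_ n)) i t - vcomp (cut u) i t).
    by apply/funext => n; rewrite /vcomp /w !mxE.
  by apply: cvgB; [exact: ccut|exact: cvg_cst].
have -> : (fun n => H1a_sqnorm (1 - 2 * s) O (fun p => (ext s (v_ n) p - ext s u p)%R)) =
    (fun n => H1a_sqnorm (1 - 2 * s) O (ext s (w n))).
  apply/funext => n; apply: H1a_congr => // p p0.
  by rewrite (extE u mu) (extE _ (mv n)) (ext_sub hs p0 (bv n) bu).
apply: (ext_H1a_cvg0 hs bw _ sO cw n3).
by rewrite mulr_ge0.
Qed.

End Compactness.

(** * From almost everywhere convergence along subsequences to the whole sequence *)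

Theorem theorem4p2 (R : realType) (s : R) (d : nat) (N : set 'rV[R]_d)
  (a b : R) (u_ : nat -> R -> 'rV[R]_d) (u : R -> 'rV[R]_d) :
  0 < s -> s < 1 / 2 ->
  compact_smooth_submanifold N ->
  a < b ->
  (forall n, Hhat s `]a, b[%classic N (u_ n)) ->
  (forall n, minimizing_sharmonic s `]a, b[%classic N (u_ n)) ->
  (exists C : R, forall n, (Es s (u_ n) `]a, b[%classic <= C%:E)%E) ->
  L2loc u ->
  L2loc_cvg u_ u ->
  forall O : set (R * R),
    open O -> bounded2 O -> O `<=` @upper R -> admissible O ->
    closure (bdry0 O) `<=` `]a, b[%classic ->
    (H1a_sqnorm (1 - 2 * s) O (ext s u) < +oo)%E /\
    (forall n, (H1a_sqnorm (1 - 2 * s) O (ext s (u_ n)) < +oo)%E) /\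
    ((fun n => H1a_sqnorm (1 - 2 * s) O (fun p => (ext s (u_ n) p - ext s u p)%R))
       @ \oo --> 0%E)%E.
Proof.
move=> s0 s1 [cN _] ab Hu minu [C EsC] Lu cu O oO bO Ou adm clO.
have hs : 0 < s < 1 / 2 by rewrite s0 s1.
have mu : mcomp u by have [] := Lu.
have mu_ n : mcomp (u_ n) by have [[]] := Hu n.
have tends (psi : nat -> nat) : (forall n, (n <= psi n)%N) -> psi n @[n --> \oo] --> \oo.
  by move=> npsi A [k _ kA]; exists k => // n /= kn; apply: kA => /=; exact: leq_trans (npsi n).
have extract (psi : nat -> nat) : (forall n, (n <= psi n)%N) ->
    exists phi : nat -> nat, (forall n, (n <= phi n)%N) /\
    {ae (@lebesgue_measure R), forall x, sqn (u_ (psi (phi n)) x - u x) @[n --> \oo] --> 0}.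
  move=> npsi.
  apply: (@ae_cvg0_subseq R (fun n x => sqn (u_ (psi n) x - u x))).
  - move=> n; apply: (@measurable_sqn R d (fun x => u_ (psi n) x - u x)) => i.
    rewrite (_ : vcomp _ i = (fun x => vcomp (u_ (psi n)) i x - vcomp u i x)); last first.
      by apply/funext => x; rewrite /vcomp !mxE.
    by apply: measurable_funB; [exact: mu_|exact: mu].
  - by move=> n x; exact: sqn_ge0.
  - by move=> k; exact: (cvg_comp psi _ (tends psi npsi) (cu (- k%:R) k%:R)).
(* Any selection of indices is allowed here, monotone or not; only almost everywhere convergence
   along it is asked for. *)
have conclude (chi : nat -> nat) :
    {ae (@lebesgue_measure R), forall x, sqn (u_ (chi n) x - u x) @[n --> \oo] --> 0} ->
    [/\ (H1a_sqnorm (1 - 2 * s) O (ext s u) < +oo)%E,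
      (forall n, (H1a_sqnorm (1 - 2 * s) O (ext s (u_ (chi n))) < +oo)%E) &
      (H1a_sqnorm (1 - 2 * s) O (fun p => (ext s (u_ (chi n)) p - ext s u p)%R)
         @[n --> \oo] --> 0)%E].
  move=> aechi.
  exact: (@ext_strong_cvg_ae R s d N a b C (fun n => u_ (chi n)) u O hs cN ab
    (fun n => Hu (chi n)) (fun n => minu (chi n)) (fun n => EsC (chi n)) Lu aechi oO bO Ou adm clO).
have [phi0 [_ ae0]] := extract id leqnn.
have [fu _ _] := conclude _ ae0.
split; first exact: fu.
split.
  move=> n.
  (* Prepending [u_ n] to the subsequence makes the general statement apply to it. *)
  pose chi (k : nat) := if k is k'.+1 then phi0 k'.+1 else n.
  have aechi : {ae (@lebesgue_measure R), forall x,
      sqn (u_ (chi n) x - u x) @[n --> \oo] --> 0}.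
    apply: (negligibleS _ ae0); apply: subsetC => x /=.
    by rewrite -cvg_shiftS => h; rewrite -cvg_shiftS.
  by have [_ /(_ 0%N)] := conclude _ aechi.
apply: ge0_cvg0_subseq.
  move=> n; apply: integral_ge0 => p _.
  by rewrite lee_fin mulr_ge0 ?powR_ge0// !addr_ge0 ?sqn_ge0.
move=> psi npsi; have [phi [nphi aephi]] := extract psi npsi.
exists phi; split => //.
by have [_ _] := conclude _ aephi.
Qed.
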